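(* Let $d\ge 1$ and let $(A_n)_{n\geq 1}$ be rotor-router aggregation in $\mathbb{Z}^d$, starting from any initial configuration of rotors. Then $$\mathcal{L}\left( n^{-1/d} A_n^\Box \,\Delta\, B \right) \rightarrow 0 \quad\text{as } n\to\infty,$$ where $B$ is the ball of unit volume centered at the origin in $\mathbb{R}^d$.
   Context: Rotor-router aggregation in $\mathbb{Z}^d$: fix a cyclic ordering of the $2d$ cardinal directions $\pm\varepsilon_1,\dots,\pm\varepsilon_d$ (the signed standard basis vectors of $\mathbb{Z}^d$). At each site $x\in\mathbb{Z}^d$ there is a rotor pointing in one of the $2d$ cardinal directions (the initial configuration of rotors is an arbitrary choice of direction at every site). Set $A_1=\{o\}$, where $o$ is the origin. Given $A_{n-1}$ and the current rotor configuration, a particle is placed at $o$ and performs rotor-router walk until it first reaches a site not in $A_{n-1}$: in each time step, the rotor at the particle's current location is advanced to the next direction in the cyclic ordering, and the particle then takes a unit step in the direction of the newly advanced rotor. When the particle first reaches a point not in $A_{n-1}$, it stops, and that point is adjoined to $A_{n-1}$ to form $A_n$. The rotor configuration is not reset between particles. Notation: $\mathcal{L}$ is $d$-dimensional Lebesgue measure; $R\,\Delta\,S$ is the symmetric difference of sets; for finite $A\subset\mathbb{Z}^d$, $A^\Box = A+[-\tfrac12,\tfrac12]^d\subset\mathbb{R}^d$ is the union of closed unit cubes centered at the points of $A$; for $R\subset\mathbb{R}^d$ and $\lambda\in\mathbb{R}$, $\lambda R=\{\lambda x : x\in R\}$. *)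

(* Defs.v *)
From HB Require Import structures.
From mathcomp Require Import all_boot all_order all_algebra perm.
From mathcomp Require Import all_classical all_reals all_analysis.

Set Implicit Arguments.
Unset Strict Implicit.
Unset Printing Implicit Defensive.

Import Order.TTheory GRing.Theory Num.Theory.
Import numFieldNormedType.Exports.

Local Open Scope classical_set_scope.
Local Open Scope ring_scope.

(* (i, false) stands for the direction +e_i and (i, true) for -e_i. *)
Definition direction (d : nat) : finType := ('I_d * bool)%type.

Definition dir_vec (d : nat) (u : direction d) : 'rV[int]_d :=
  (-1) ^+ u.2 *: delta_mx 0 u.1.

(* A cyclic ordering is encoded by its successor map: a permutation of the
   2d directions consisting of a single cycle. *)
Definition cyclic_ordering (d : nat) (c : {perm direction d}) : Prop :=
  forall u : direction d, porbit c u = [set: direction d]%SET.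

Definition rotor_config (d : nat) : Type := 'rV[int]_d -> direction d.

Definition rotor_step (d : nat) (c : {perm direction d})
    (s : rotor_config d * 'rV[int]_d) : rotor_config d * 'rV[int]_d :=
  let: (rho, x) := s in
  let rho' : rotor_config d := [eta rho with x |-> c (rho x)] in
  (rho', x + dir_vec (rho' x)).

(* The walk of one particle from the origin, never stopped. *)
Definition rotor_walk (d : nat) (c : {perm direction d})
    (rho : rotor_config d) (t : nat) : rotor_config d * 'rV[int]_d :=
  iter t (rotor_step c) (rho, 0).

Definition first_exit (d : nat) (c : {perm direction d})
    (rho : rotor_config d) (A : set 'rV[int]_d) (t : nat) : Prop :=
  ~ A (rotor_walk c rho t).2 /\
  forall s : nat, (s < t)%N -> A (rotor_walk c rho s).2.

(* At most one t satisfies first_exit, and one exists when A is finite, so the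
   default value 0 is never used along the aggregation. *)
Definition exit_time (d : nat) (c : {perm direction d})
    (rho : rotor_config d) (A : set 'rV[int]_d) : nat :=
  xget 0%N [set t | first_exit c rho A t].

Definition add_particle (d : nat) (c : {perm direction d})
    (s : set 'rV[int]_d * rotor_config d) : set 'rV[int]_d * rotor_config d :=
  let: (A, rho) := s in
  let: (rho', x) := rotor_walk c rho (exit_time c rho A) in
  (A `|` [set x], rho').

(* A_n for n >= 1, starting from A_1 = {o}; index 0 is a junk value. *)
Definition aggregate (d : nat) (c : {perm direction d})
    (rho0 : rotor_config d) (n : nat) : set 'rV[int]_d :=
  (iter n.-1 (add_particle c) ([set 0], rho0)).1.

Section lebesgue_tuple.
Context {R : realType}.
Let T := measurableTypeR R.

Definition tcons (n : nat) (p : T * n.-tuple T) : n.+1.-tuple T :=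
  [tuple of p.1 :: p.2].

Lemma measurable_tcons (n : nat) : measurable_fun setT (@tcons n).
Proof. exact: measurable_cons measurable_fst measurable_snd. Qed.

HB.instance Definition _ (n : nat) :=
  isMeasurableFun.Build _ _ _ _ (@tcons n) (@measurable_tcons n).

Section lebesgue_cons.
Variables (n : nat) (mu : {measure set (n.-tuple T) -> \bar R}).

Definition lebesgue_cons : set (n.+1.-tuple T) -> \bar R :=
  pushforward (lebesgue_measure \x^ mu)%E (@tcons n).

Let lebesgue_cons0 : lebesgue_cons set0 = 0%E.
Proof. exact: measure0. Qed.

Let lebesgue_cons_ge0 A : (0 <= lebesgue_cons A)%E.
Proof. exact: measure_ge0. Qed.

Let lebesgue_cons_sigma_additive : semi_sigma_additive lebesgue_cons.
Proof. exact: measure_semi_sigma_additive. Qed.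

HB.instance Definition _ := isMeasure.Build _ _ _ lebesgue_cons
  lebesgue_cons0 lebesgue_cons_ge0 lebesgue_cons_sigma_additive.

End lebesgue_cons.

(* Lebesgue measure on R^n, as the n-fold product of lebesgue_measure; n.-tuple T
   carries the product (Borel) sigma-algebra. *)
Fixpoint lebesgue_tuple (n : nat) : {measure set (n.-tuple T) -> \bar R} :=
  match n with
  | 0 => \d_ [tuple]
  | n.+1 => lebesgue_cons (lebesgue_tuple n)
  end.

End lebesgue_tuple.

Definition cube_union (R : realType) (d : nat) (A : set 'rV[int]_d) :
    set (d.-tuple (measurableTypeR R)) :=
  [set y | exists2 x, A x & forall i : 'I_d, `|tnth y i - (x 0 i)%:~R| <= 2^-1].

Definition dilate (R : realType) (d : nat) (a : R)
    (S : set (d.-tuple (measurableTypeR R))) :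
    set (d.-tuple (measurableTypeR R)) :=
  [set [tuple a * tnth x i | i < d] | x in S].

Definition euclidean_ball (R : realType) (d : nat) (r : R) :
    set (d.-tuple (measurableTypeR R)) :=
  [set x | Num.sqrt (\sum_(i < d) tnth x i ^+ 2) < r].

(* Main.v *)
Require Import Defs.
From HB Require Import structures.
From mathcomp Require Import all_boot all_order all_algebra perm.
From mathcomp Require Import all_classical all_reals all_analysis.
From mathcomp Require Import ring lra zify.

Set Implicit Arguments.
Unset Strict Implicit.
Unset Printing Implicit Defensive.

Import Order.TTheory GRing.Theory Num.Theory.
Import numFieldNormedType.Exports.

Local Open Scope ring_scope.

(** The proof compares the odometer of the aggregation with an explicit potential,
in the energy norm.

Let [v x] be the number of particle exits from [x] divided by [2 d]. A rotor
serves its directions in turn, so the net flow along an edge is the gradient of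
[v] up to a bounded error. Conservation of particles then reads
  [lap v = 1_A - n delta_0 + div (bounded edge field)],
where [A = A_n], [v >= 0] and [v = 0] off [A] ([aggregate_odometer],
[torus_flow]). The ball [B] with [n] points has, approximately, a potential
[w >= 0] that vanishes off [B], is of order [n ^ (2 / d)] inside [B], and solves
  [lap w = 1_B - n delta_0].
For [h = v - w], summation by parts gives
  [energy h / 2 + sum h (1_A - 1_B) = error],
and since [v] vanishes off [A] and [w] off [B],
  [h (1_A - 1_B) = v 1_(complement of B) + w 1_(complement of A) >= 0].
The error pairs a bounded edge field on [A] with the gradient of [h]; it is at
most a constant times [sqrt (n * energy h)], which the energy absorbs. Hence the
sum of [w] over [B] minus [A] is [O(n)], and since [w] is of order [n ^ (2 / d)]
well inside [B], the aggregate misses only [o(n)] points of [B]. Both sets have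
about [n] points, so this is all that is needed ([energy_comparison]).

Two points need care. The first is the singularity of [w] at the origin. The
explicit profile [growth], [profile] solves a recursion in [q = |x|^2] and has
a source [f] spread over a ball whose radius is a small fraction of that of [B]
([radial_lap_le1], [radial_lap_ge1]). Adding [green T (n delta_0 - f)], a finite
sum of iterates of the lazy walk, turns [f] into a point source up to a
discrepancy smoothed by [T] steps. The correction has total mass [O(n T)], small
when [T] is a small fraction of the squared radius. The smoothed discrepancy is
also absorbed by the energy ([smoothed_oscillation]), because the [l2] norm of
the heat kernel decays at the rate given by Nash's inequality ([nash],
[heat_norm2_dyadic]).

The second is that [1_B] is only matched approximately, by a sink [s]. The term
[sum v (1 - s)] is nonnegative as soon as [s <= 1], so no estimate of [v] itself
is required; to have [s <= 1] the ball is given slightly more than [n] points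
and the profile is scaled down accordingly ([ball_comparison],
[missed_inside_le]).

Counting cubes of side [n ^ (- 1 / d)] transfers the result
([aggregate_fills_ball]) to Lebesgue measure: the scaled aggregate has volume at
most [1] and covers almost all of the unit-volume ball
([lattice_ball_covers], [symdiff_le]). *)

(** * Laplacian, energy and lazy walk on a finite abelian group *)

Section FiniteGroup.

Context {R : realFieldType} {V : finZmodType} {D : finType}.
Variables (opp : D -> D) (step : D -> V).
Hypotheses (oppK : involutive opp) (stepN : forall u, step (opp u) = - step u).
Implicit Types (f g h : V -> R) (x y z : V) (u : D).

Definition lap f x : R := \sum_u (f (x + step u) - f x).

Definition energy f : R := \sum_x \sum_u (f (x + step u) - f x) ^+ 2.

Lemma sum_translate (F : V -> R) y : \sum_x F (x + y) = \sum_x F x.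
Proof. by rewrite [RHS](reindex_inj (addIr y)). Qed.

Lemma lap_ext f g : f =1 g -> lap f =1 lap g.
Proof. by move=> fg x; apply: eq_bigr => u _; rewrite !fg. Qed.

Lemma lapD f g x : lap (fun y => f y + g y) x = lap f x + lap g x.
Proof. by rewrite -big_split; apply: eq_bigr => u _ /=; ring. Qed.

Lemma lapZ a f x : lap (fun y => a * f y) x = a * lap f x.
Proof. by rewrite mulr_sumr; apply: eq_bigr => u _; ring. Qed.

Lemma lapN f x : lap (fun y => - f y) x = - lap f x.
Proof. by rewrite -sumrN; apply: eq_bigr => u _; ring. Qed.

Lemma lap_sum (I : Type) (r : seq I) (P : pred I) (F : I -> V -> R) x :
  lap (fun y => \sum_(i <- r | P i) F i y) x = \sum_(i <- r | P i) lap (F i) x.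
Proof.
by rewrite exchange_big /=; apply: eq_bigr => u _; rewrite -sumrB.
Qed.

Lemma sum_step_shift f g :
  \sum_x \sum_u f x * g (x + step u) = \sum_x \sum_u f (x + step u) * g x.
Proof.
rewrite exchange_big [RHS]exchange_big [RHS](reindex_inj (inv_inj oppK)) /=.
apply: eq_bigr => u _.
rewrite -[LHS](sum_translate _ (step (opp u))).
by apply: eq_bigr => x _; rewrite -addrA stepN addNr addr0.
Qed.

Lemma sum_lapC f g : \sum_x f x * lap g x = \sum_x lap f x * g x.
Proof.
under eq_bigr do rewrite mulr_sumr.
under [RHS]eq_bigr do rewrite mulr_suml.
under eq_bigr do (under eq_bigr do rewrite mulrBr; rewrite sumrB).
under [RHS]eq_bigr do (under eq_bigr do rewrite mulrBl; rewrite sumrB).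
by rewrite !sumrB sum_step_shift.
Qed.

Lemma sum_lap f : \sum_x lap f x = 0.
Proof.
have := sum_lapC (fun=> 1) f.
under eq_bigr do rewrite mul1r.
move=> ->; apply: big1 => x _.
by rewrite (_ : lap _ x = 0) ?mul0r // /lap; apply: big1 => u _; rewrite subrr.
Qed.

Lemma energyE f : energy f = - 2 * \sum_x f x * lap f x.
Proof.
have e1 x : \sum_u (f (x + step u) - f x) ^+ 2 =
   - 2 * (f x * lap f x) + \sum_u (f (x + step u) ^+ 2 - f x ^+ 2).
  rewrite /lap !mulr_sumr -big_split /=.
  by apply: eq_bigr => u _; ring.
rewrite /energy (eq_bigr _ (fun x _ => e1 x)) big_split /= -mulr_sumr.
rewrite -[X in _ = X]addr0; congr (_ + _).
exact: (sum_lap (fun x => f x ^+ 2)).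
Qed.

Lemma energy_ge0 f : 0 <= energy f.
Proof. by do 2!apply: sumr_ge0 => ? _; apply: sqr_ge0. Qed.

(** A path of [size s] steps costs at most [size s] gradients, so by
Cauchy-Schwarz the displacement is controlled by the square of its length. *)
Lemma displacement_le f (s : seq D) :
  \sum_x (f (x + \sum_(u <- s) step u) - f x) ^+ 2
    <= (size s)%:R ^+ 2 * energy f.
Proof.
elim: s => [|u s IH].
  rewrite big_nil /= expr0n /= mul0r big1 // => x _.
  by rewrite addr0 subrr expr0n.
rewrite big_cons /=; set y := \sum_(v <- s) step v in IH *.
have le1 : \sum_x (f (x + step u) - f x) ^+ 2 <= energy f.
  apply: ler_sum => x _; rewrite (bigD1 u) //= lerDl.
  by apply: sumr_ge0 => v _; apply: sqr_ge0.
have le2 : \sum_x (f (x + step u + y) - f (x + step u)) ^+ 2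
    <= (size s)%:R ^+ 2 * energy f.
  by rewrite (sum_translate (fun x => (f (x + y) - f x) ^+ 2)).
case: s @y IH le2 => [|v s] y IH le2.
  rewrite expr1n mul1r; apply: le_trans le1.
  by apply: ler_sum => x _; rewrite /y big_nil addr0.
set m : R := (size (v :: s))%:R in IH le2 *.
have m_gt0 : 0 < m by rewrite ltr0n.
have -> : (size (v :: s)).+1%:R = m + 1 by rewrite -natr1.
have pt a b : (a + b) ^+ 2 <= (1 + m^-1) * a ^+ 2 + (1 + m) * b ^+ 2.
  rewrite -subr_ge0.
  have -> : (1 + m^-1) * a ^+ 2 + (1 + m) * b ^+ 2 - (a + b) ^+ 2 =
     m^-1 * (a - m * b) ^+ 2 by field; rewrite gt_eqF.
  by rewrite mulr_ge0 ?invr_ge0 ?sqr_ge0 // ltW.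
apply: (@le_trans _ _ (\sum_x ((1 + m^-1) *
    (f (x + step u + y) - f (x + step u)) ^+ 2
    + (1 + m) * (f (x + step u) - f x) ^+ 2))).
  apply: ler_sum => x _; rewrite addrA.
  apply: le_trans (pt _ _); rewrite le_eqVlt; apply/orP; left; apply/eqP; ring.
rewrite big_split /= -!mulr_sumr.
have -> : (m + 1) ^+ 2 * energy f =
  (1 + m^-1) * (m ^+ 2 * energy f) + (1 + m) * energy f.
  by field; rewrite gt_eqF.
apply: lerD; apply: ler_wpM2l => //; last by rewrite addr_ge0 // ltW.
by rewrite addr_ge0 // invr_ge0 ltW.
Qed.

(** ** The lazy walk *)

Let c : R := #|D|%:R.
Hypothesis D_gt0 : (0 < #|D|)%N.

Let c_gt0 : 0 < c. Proof. by rewrite ltr0n. Qed.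
Let c_neq0 : c != 0. Proof. by rewrite gt_eqF. Qed.

Definition lazy f x : R := f x + lap f x / (2 * c).

Lemma lazyE f x : lazy f x = f x / 2 + (\sum_u f (x + step u)) / (2 * c).
Proof.
rewrite /lazy /lap sumrB sumr_const -mulr_natr -/c.
by field.
Qed.

Lemma lazy_ext f g : f =1 g -> lazy f =1 lazy g.
Proof. by move=> fg x; rewrite /lazy fg (lap_ext fg). Qed.

Lemma iter_lazyB t f g x :
  iter t lazy (fun y => f y - g y) x = iter t lazy f x - iter t lazy g x.
Proof.
elim: t x => //= t IH x.
rewrite (lazy_ext IH) /lazy lapD lapN; ring.
Qed.

Lemma iter_lazy_translate t f y x :
  iter t lazy (fun z => f (z + y)) x = iter t lazy f (x + y).
Proof.
elim: t x => //= t IH x; rewrite (lazy_ext IH) !lazyE; congr (_ + _ / _).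
by apply: eq_bigr => u _; rewrite addrAC.
Qed.

Lemma sum_lazyC f g : \sum_x f x * lazy g x = \sum_x lazy f x * g x.
Proof.
under eq_bigr do rewrite mulrDr mulrA.
under [RHS]eq_bigr do rewrite mulrDl -mulrA [_^-1 * _]mulrC mulrA.
by rewrite !big_split /= -!mulr_suml sum_lapC.
Qed.

Lemma iter_lazyC t f g :
  \sum_x f x * iter t lazy g x = \sum_x iter t lazy f x * g x.
Proof.
by elim: t f => //= t IH f; rewrite sum_lazyC IH -iterSr.
Qed.

Lemma iter_lazy_ge0 t f : (forall x, 0 <= f x) -> forall x, 0 <= iter t lazy f x.
Proof.
move=> f0; elim: t => //= t IH x; rewrite lazyE addr_ge0 ?divr_ge0 ?sumr_ge0 //.
by rewrite mulr_ge0 // ltW.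
Qed.

Lemma sum_iter_lazy t f : \sum_x iter t lazy f x = \sum_x f x.
Proof.
elim: t => //= t IH.
by rewrite big_split /= -mulr_suml sum_lap mul0r addr0.
Qed.

(** One lazy step dissipates a fixed fraction of the energy: the lazy operator
is a positive contraction [P], so [|P f|^2 <= <f, P f>]. *)
Lemma lazy_norm2 f :
  \sum_x lazy f x ^+ 2 <= \sum_x f x ^+ 2 - energy f / (4 * c).
Proof.
pose m x := (\sum_u f (x + step u)) / c.
have le_m : \sum_x m x ^+ 2 <= \sum_x f x ^+ 2.
  have jensen x : m x ^+ 2 <= (\sum_u f (x + step u) ^+ 2) / c.
    rewrite -subr_ge0.
    have -> : (\sum_u f (x + step u) ^+ 2) / c - m x ^+ 2 =
        (\sum_u (f (x + step u) - m x) ^+ 2) / c.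
      under [X in _ = X / _]eq_bigr do rewrite sqrrB.
      rewrite big_split /= sumrB sumr_const -[_ *+ #|D|]mulr_natr -/c.
      under [X in _ = (_ - X + _) / _]eq_bigr do rewrite -mulrnAr -mulr_natr.
      rewrite -mulr_suml.
      rewrite /m; set s := \sum_u f (x + _); set s2 := \sum_u _ ^+ 2.
      by field.
    by apply: divr_ge0 (ltW c_gt0); apply: sumr_ge0 => u _; apply: sqr_ge0.
  apply: le_trans (ler_sum _ (fun x _ => jensen x)) _.
  rewrite -mulr_suml ler_pdivrMr // exchange_big /=.
  under eq_bigr do rewrite (sum_translate (fun x => f x ^+ 2)).
  by rewrite sumr_const mulr_natr.
have lE x : lazy f x = (f x + m x) / 2 by rewrite lazyE /m; field.
have -> : energy f / (4 * c) = \sum_x f x * (f x - m x) / 2.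
  rewrite energyE mulrAC mulr_sumr; apply: eq_bigr => x _.
  rewrite /m /lap sumrB sumr_const -mulr_natr -/c.
  by field.
rewrite -sumrB -subr_ge0 -sumrB.
rewrite (eq_bigr (fun x => (f x ^+ 2 - m x ^+ 2) / 4)); last first.
  by move=> x _; rewrite lE; field.
by rewrite -mulr_suml sumrB divr_ge0 // subr_ge0.
Qed.

(** ** The heat kernel *)

Definition unit_mass x : R := (x == 0)%:R.

Definition heat t : V -> R := iter t lazy unit_mass.

Definition heat_norm2 t : R := \sum_x heat t x ^+ 2.

Lemma sum_unit_mass f : \sum_x unit_mass x * f x = f 0.
Proof.
rewrite (bigD1 0) //= /unit_mass eqxx mul1r big1 ?addr0 // => x /negPf->.
by rewrite mul0r.
Qed.

Lemma iter_lazy_heat t f y :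
  iter t lazy f y = \sum_x heat t x * f (x + y).
Proof.
rewrite /heat -iter_lazyC sum_unit_mass.
by rewrite (iter_lazy_translate t f y 0) add0r.
Qed.

Lemma heat_ge0 t x : 0 <= heat t x.
Proof. by apply: iter_lazy_ge0 => y; rewrite /unit_mass ler0n. Qed.

Lemma sum_heat t : \sum_x heat t x = 1.
Proof.
rewrite /heat sum_iter_lazy; have := sum_unit_mass (fun=> 1).
by under eq_bigr do rewrite mulr1.
Qed.

Lemma cauchy_schwarz (I : finType) (a b : I -> R) :
  (\sum_i a i * b i) ^+ 2 <= (\sum_i a i ^+ 2) * \sum_i b i ^+ 2.
Proof.
set P := \sum_i a i * b i; set A := \sum_i _ ^+ 2; set B := \sum_i b i ^+ 2.
have B_ge0 : 0 <= B by apply: sumr_ge0 => i _; apply: sqr_ge0.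
have [B0|Bn0] := eqVneq B 0.
  suff -> : P = 0 by rewrite B0 expr0n mulr0.
  apply: big1 => i _; apply/eqP; rewrite mulf_eq0; apply/orP; right.
  move/eqP: B0; rewrite psumr_eq0; last by move=> j _; apply: sqr_ge0.
  by move/allP/(_ i (mem_index_enum _)); rewrite /= sqrf_eq0.
have B_gt0 : 0 < B by rewrite lt_def Bn0.
have : 0 <= \sum_i (a i * B - b i * P) ^+ 2.
  by apply: sumr_ge0 => i _; apply: sqr_ge0.
have -> : \sum_i (a i * B - b i * P) ^+ 2 =
    A * B ^+ 2 - P * (B * P * 2) + B * P ^+ 2.
  rewrite (eq_bigr (fun i => a i ^+ 2 * B ^+ 2 - a i * b i * (B * P * 2)
     + b i ^+ 2 * P ^+ 2)); last by move=> i _; ring.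
  by rewrite big_split sumrB /= -!mulr_suml.
have -> : A * B ^+ 2 - P * (B * P * 2) + B * P ^+ 2 = B * (A * B - P ^+ 2) by ring.
by rewrite pmulr_rge0 // subr_ge0.
Qed.

(** Smoothing makes function values comparable: after [t] lazy steps, values at
two points differ by the energy of the function times the [l2] norm of the
kernel, although the energy itself controls no pointwise quantity. *)
Lemma smoothed_oscillation t f (s : seq D) :
  (iter t lazy f (\sum_(u <- s) step u) - iter t lazy f 0) ^+ 2
    <= heat_norm2 t * ((size s)%:R ^+ 2 * energy f).
Proof.
rewrite !iter_lazy_heat -sumrB.
under eq_bigr do rewrite -mulrBr addr0.
apply: le_trans (cauchy_schwarz _ _) _; apply: ler_wpM2l (displacement_le _ _).
by apply: sumr_ge0 => x _; apply: sqr_ge0.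
Qed.

Lemma sum_injective_le (I : finType) (y : I -> V) f :
  injective y -> (forall x, 0 <= f x) -> \sum_i f (y i) <= \sum_x f x.
Proof.
move=> y_inj f_ge0.
have -> : \sum_i f (y i) = \sum_(x in y @: predT) f x.
  rewrite big_imset /=; last by move=> i j _ _ /y_inj.
  exact: eq_bigl.
rewrite [leRHS](bigID (mem (y @: predT))) /= lerDl.
by apply: sumr_ge0 => x _; apply: f_ge0.
Qed.

(** Nash's inequality. Compare a probability density [f] with its average over
the translates by [y i]: averaging costs energy, and the average is bounded by
[1 / #|I|] because the [y i] are distinct. *)
Lemma nash (I : finType) (y : I -> V) (l : nat) f :
  injective y ->
  (forall i, exists2 s : seq D, y i = \sum_(u <- s) step u & (size s <= l)%N) ->
  (forall x, 0 <= f x) -> \sum_x f x = 1 ->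
  #|I|%:R * \sum_x f x ^+ 2 <= #|I|%:R * (l%:R ^+ 2 / 2 * energy f) + 1.
Proof.
move=> y_inj y_walk f_ge0 f1.
have corr i : \sum_x f x ^+ 2 =
    (\sum_x (f (x + y i) - f x) ^+ 2) / 2 + \sum_x f x * f (x + y i).
  under [X in X / 2]eq_bigr do rewrite sqrrB.
  rewrite big_split sumrB /= (sum_translate (fun x => f x ^+ 2)).
  rewrite sumrMnl; under [X in _ = _ + X]eq_bigr do rewrite mulrC.
  by field.
have -> : #|I|%:R * \sum_x f x ^+ 2 =
  \sum_i ((\sum_x (f (x + y i) - f x) ^+ 2) / 2 + \sum_x f x * f (x + y i)).
  by rewrite -(eq_bigr _ (fun i _ => corr i)) sumr_const mulr_natl.
rewrite big_split /=; apply: lerD.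
  rewrite mulr_natl -sumr_const; apply: ler_sum => i _.
  rewrite mulrAC ler_pM2r; last by rewrite invr_gt0.
  have [s -> le_s] := y_walk i; apply: le_trans (displacement_le _ _) _.
  by apply: (ler_wpM2r (energy_ge0 _)); rewrite lerXn2r ?nnegrE ?ler0n // ler_nat.
rewrite exchange_big /= -[leRHS]f1; apply: ler_sum => x _.
rewrite -mulr_sumr -[leRHS]mulr1; apply: ler_wpM2l => //.
rewrite -f1; under eq_bigr do rewrite addrC.
apply: (@sum_injective_le _ (fun i => y i + x)); last by [].
by move=> i j /addIr/y_inj.
Qed.

Lemma bernoulli_inv (k : R) m :
  0 <= k <= 1 -> (1 - k) ^+ m * (1 + m%:R * k) <= 1.
Proof.
case/andP=> k0 k1; elim: m => [|m IH]; first by rewrite mul0r addr0 mulr1.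
apply: le_trans IH; rewrite exprSr -mulrA.
apply: ler_wpM2l; first by rewrite exprn_ge0 // subr_ge0.
rewrite -natr1 -subr_ge0.
set q : R := m%:R; have -> : 1 + q * k - (1 - k) * (1 + (q + 1) * k) =
  (q + 1) * k ^+ 2 by ring.
by rewrite mulr_ge0 ?sqr_ge0 // addr_ge0 ?ler0n.
Qed.

Lemma heat_norm2_ge0 t : 0 <= heat_norm2 t.
Proof. by apply: sumr_ge0 => x _; apply: sqr_ge0. Qed.

(** Nash's inequality and the dissipation of energy make the excess of
[heat_norm2] over [1 / #|I|] contract by a fixed factor at each step. *)
Lemma heat_norm2_decay (I : finType) (y : I -> V) (l t m : nat) :
  (0 < #|I|)%N -> (0 < l)%N -> injective y ->
  (forall i, exists2 s : seq D, y i = \sum_(u <- s) step u & (size s <= l)%N) ->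
  heat_norm2 (m + t) <=
    #|I|%:R^-1 + heat_norm2 t / (1 + m%:R / (2 * c * l%:R ^+ 2)).
Proof.
move=> I_gt0 l_gt0 y_inj y_walk.
set N : R := #|I|%:R; set k := (2 * c * l%:R ^+ 2)^-1.
have N_gt0 : 0 < N by rewrite ltr0n.
have N_neq0 : N != 0 by rewrite gt_eqF.
have l_ge1 : 1 <= l%:R :> R by rewrite ler1n.
have l2_gt0 : 0 < l%:R ^+ 2 :> R by rewrite exprn_gt0 // ltr0n.
have cl_gt0 : 0 < 2 * c * l%:R ^+ 2 by apply: mulr_gt0 => //; apply: mulr_gt0.
have k01 : 0 <= k <= 1.
  rewrite invr_ge0 invf_le1 //.
  have c_ge1 : 1 <= c by rewrite ler1n.
  have l2_ge1 : 1 <= l%:R ^+ 2 :> R by rewrite exprn_ege1.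
  by apply/andP; split; nra.
have step1 s : heat_norm2 s.+1 - N^-1 <= (1 - k) * (heat_norm2 s - N^-1).
  have /= := lazy_norm2 (heat s); rewrite -[\sum_x lazy _ _ ^+ 2]/(heat_norm2 s.+1).
  rewrite -/(heat_norm2 s) => le1.
  have := nash y_inj y_walk (heat_ge0 s) (sum_heat s).
  rewrite -/N -/(heat_norm2 s) => le2.
  have le3 : heat_norm2 s - N^-1 <= l%:R ^+ 2 / 2 * energy (heat s).
    rewrite -(ler_pM2l N_gt0) mulrBr divff // lerBlDr; exact: le2.
  have le4 : k * (heat_norm2 s - N^-1) <= energy (heat s) / (4 * c).
    rewrite /k mulrC ler_pdivrMr //.
    apply: le_trans le3 _; rewrite le_eqVlt; apply/orP; left; apply/eqP.
    by field.
  lra.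
have stepm j : heat_norm2 (j + t) - N^-1 <= (1 - k) ^+ j * (heat_norm2 t - N^-1).
  elim: j => [|j IH]; first by rewrite mul1r.
  rewrite addSn exprS -mulrA; apply: le_trans (step1 _) _.
  by apply: ler_wpM2l IH; rewrite subr_ge0; case/andP: k01.
have {}stepm := stepm m.
have mk_gt0 : 0 < 1 + m%:R * k.
  by rewrite addrC ltr_wpDl // mulr_ge0 ?ler0n //; case/andP: k01.
have le5 : (1 - k) ^+ m * (heat_norm2 t - N^-1) <= heat_norm2 t / (1 + m%:R * k).
  rewrite ler_pdivlMr //.
  apply: (@le_trans _ _ ((1 - k) ^+ m * (1 + m%:R * k) * heat_norm2 t)); last first.
    by rewrite -[leRHS]mul1r ler_wpM2r ?heat_norm2_ge0 ?bernoulli_inv.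
  rewrite mulrAC; apply: ler_wpM2l.
    apply: mulr_ge0 (ltW mk_gt0); apply: exprn_ge0.
    by rewrite subr_ge0; case/andP: k01.
  by rewrite lerBlDr lerDl invr_ge0 ltW.
lra.
Qed.

(** Iterating over dyadic scales gives the diffusive decay rate [t^(-d/2)] of the
return probability: [C * 4 ^ k] steps suffice at scale [2 ^ k]. *)
Lemma heat_norm2_dyadic (d k : nat) :
  (0 < d)%N ->
  (forall j, (j <= k)%N -> exists y : {ffun 'I_d -> 'I_(2 ^ j)} -> V,
     injective y /\
     forall i, exists2 s : seq D,
       y i = \sum_(u <- s) step u & (size s <= d * 2 ^ j)%N) ->
  heat_norm2 (8 * #|D| * d ^ 2 * 2 ^ d * 4 ^ k) <= 2 * (2 ^+ k ^+ d)^-1.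
Proof.
move=> d_gt0; set C := (8 * _ * _ * _)%N; elim: k => [|k IH] cubes.
  rewrite expr1n invr1 mulr1.
  have heat_le1 t : heat_norm2 t <= 1.
    rewrite -(sum_heat t); apply: ler_sum => x _.
    rewrite expr2 -[leRHS]mulr1; apply: (ler_wpM2l (heat_ge0 _ _)).
    rewrite -(sum_heat t) (bigD1 x) //= lerDl.
    by apply: sumr_ge0 => *; apply: heat_ge0.
  by apply: le_trans (heat_le1 _) _; rewrite ler1n.
have {}IH := IH (fun j le_jk => cubes j (leqW le_jk)).
have [y [y_inj y_walk]] := cubes k.+1 (leqnn _).
have -> : (C * 4 ^ k.+1 = 3 * C * 4 ^ k + C * 4 ^ k)%N.
  by rewrite expnS; nia.
have cardI : #|{ffun 'I_d -> 'I_(2 ^ k.+1)}| = ((2 ^ k.+1) ^ d)%N.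
  by rewrite card_ffun !card_ord.
have I_gt0 : (0 < #|{ffun 'I_d -> 'I_(2 ^ k.+1)}|)%N by rewrite cardI !expn_gt0.
have l_gt0 : (0 < d * 2 ^ k.+1)%N by rewrite muln_gt0 d_gt0 expn_gt0.
apply: le_trans (heat_norm2_decay _ _ I_gt0 l_gt0 y_inj y_walk) _.
rewrite cardI !natrX.
set a := (_ ^+ k.+1 ^+ d)^-1; have a_ge0 : 0 <= a by rewrite invr_ge0 !exprn_ge0.
have -> : (3 * C * 4 ^ k)%:R / (2 * c * (d * 2 ^ k.+1)%:R ^+ 2) = 3 * 2 ^+ d :> R.
  rewrite /C !natrM !natrX -/c (exprS 2 k).
  have -> : 4 ^+ k = (2 ^+ k) ^+ 2 :> R by rewrite -exprM mulnC exprM; congr (_ ^+ k); ring.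
  have d_neq0 : d%:R != 0 :> R by rewrite pnatr_eq0 -lt0n.
  have p_neq0 : 2 ^+ k != 0 :> R by rewrite expf_neq0 // pnatr_eq0.
  move: (2 ^+ k) (2 ^+ d) p_neq0 => p q p_neq0.
  by field; rewrite c_neq0 d_neq0 p_neq0.
suff le1 : heat_norm2 (C * 4 ^ k) / (1 + 3 * 2 ^+ d) <= a by lra.
have p_gt0 : 0 < 2 ^+ d :> R by rewrite exprn_gt0.
rewrite ler_pdivrMr; last by lra.
apply: le_trans IH _.
have -> : (2 ^+ k ^+ d)^-1 = 2 ^+ d * a :> R.
  by rewrite /a exprS exprMn invfM mulrA divff ?mul1r // gt_eqF.
nra.
Qed.

(** ** Comparison with a profile *)

(** The Green potential of [f] for the walk stopped after [T] lazy steps. *)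
Definition green T f x : R := (\sum_(t < T) iter t lazy f x) / (2 * c).

Lemma lap_green T f x : lap (green T f) x = iter T lazy f x - f x.
Proof.
have -> : lap (green T f) x =
    (2 * c)^-1 * lap (fun y => \sum_(t < T) iter t lazy f y) x.
  by rewrite -lapZ; apply: lap_ext => y; rewrite /green mulrC.
rewrite lap_sum; elim: T => [|T IH]; first by rewrite big_ord0 mulr0 subrr.
rewrite big_ord_recr /= mulrDr IH [lazy (iter _ _ _) x]/lazy.
by field.
Qed.

Lemma sum_green_le T f g :
  (forall x, 0 <= f x) -> (forall x, 0 <= g x) ->
  \sum_x `|green T (fun y => f y - g y) x|
    <= T%:R / (2 * c) * (\sum_x f x + \sum_x g x).
Proof.
move=> f_ge0 g_ge0.
have c2_ge0 : 0 <= (2 * c)^-1 by rewrite invr_ge0 mulr_ge0 // ltW.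
apply: (@le_trans _ _ (\sum_x (\sum_(t < T)
    (iter t lazy f x + iter t lazy g x)) / (2 * c))).
  apply: ler_sum => x _; rewrite normrM [X in _ * X]ger0_norm //.
  apply: ler_wpM2r => //; apply: le_trans (ler_norm_sum _ _ _) _.
  apply: ler_sum => t _; rewrite iter_lazyB; apply: le_trans (ler_normB _ _) _.
  by rewrite !ger0_norm //; apply: iter_lazy_ge0.
rewrite -mulr_suml exchange_big /=.
under eq_bigr do rewrite big_split /= !sum_iter_lazy.
by rewrite sumr_const card_ord -[_ *+ T]mulr_natl mulrAC.
Qed.

(** Let [v] be an odometer supported in [A], with [lap v = 1_A - n unit_mass] up to
the divergence of a bounded flow [r], and let [w >= 0] be a reference profile
with [lap w = s - f], where [f] is a source of mass [n] near the origin and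
[s <= 1] is the sink. The potential [h = v - (w + green T (n unit_mass - f))] has
[lap h = 1_A - s] up to that divergence and a smoothed source discrepancy. Hence
  [energy h / 2 + sum h (1_A - s) = error],
and since [v] vanishes off [A],
  [(v - w) (1_A - s) = v (1 - s) + w (s - 1) + w 1_(~: A)]
has a nonnegative first term, while both parts of the error are absorbed by the
energy. What remains bounds the mass of [w] outside [A]. *)
Lemma energy_comparison (A : {set V}) (v w s f : V -> R) (r : V -> D -> R)
    (T l : nat) :
  (0 < #|A|)%N ->
  (forall x, 0 <= v x) -> (forall x, x \notin A -> v x = 0) ->
  (forall x u, `|r x u| <= 1) ->
  (forall h, \sum_(x in A) h x - #|A|%:R * h 0 =
     \sum_x v x * lap h x
     + \sum_(x in A) \sum_u r x u * (h (x + step u) - h x)) ->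
  (forall x, 0 <= w x) -> (forall x, lap w x = s x - f x) ->
  (forall x, -1 <= s x <= 1) ->
  (forall x, 0 <= f x) -> \sum_x f x = #|A|%:R ->
  (forall x, f x != 0 ->
     exists2 p : seq D, x = \sum_(u <- p) step u & (size p <= l)%N) ->
  \sum_(x in ~: A) w x <=
    \sum_x w x * (1 - s x) + 2 * c * #|A|%:R
    + 2 * #|A|%:R ^+ 2 * l%:R ^+ 2 * heat_norm2 T
    + 2 * (T%:R / c) * #|A|%:R.
Proof.
move=> A_gt0 v_ge0 v_supp r_le1 flow w_ge0 lap_w s_le1 f_ge0 sum_f f_supp.
set n : R := #|A|%:R in flow sum_f *.
have n_gt0 : 0 < n by rewrite ltr0n.
pose g x := n * unit_mass x - f x; pose G := green T g.
pose h x := v x - (w x + G x).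
pose chi x : R := (x \in A)%:R.
have lapW x : lap (fun y => w y + G y) x = s x - n * unit_mass x + iter T lazy g x.
  by rewrite lapD lap_w lap_green /g; ring.
set E := energy h; have E_ge0 : 0 <= E := energy_ge0 h.
pose err := \sum_(x in A) \sum_u r x u * (h (x + step u) - h x).
pose sm := \sum_x h x * iter T lazy g x.
have identity : E / 2 + \sum_x h x * (chi x - s x) = sm + err.
  have sum_chi F : \sum_(x in A) F x = \sum_x F x * chi x.
    rewrite big_mkcond /=; apply: eq_bigr => x _; rewrite /chi.
    by case: (x \in A); rewrite ?mulr1 ?mulr0.
  have vE : \sum_x v x * lap h x =
      \sum_x h x * lap h x + \sum_x h x * (s x - n * unit_mass x + iter T lazy g x).
    under [X in _ = _ + X]eq_bigr do rewrite -lapW mulrC.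
    have /= <- := sum_lapC (fun x => w x + G x) h.
    by rewrite -big_split; apply: eq_bigr => x _; rewrite /h /=; ring.
  have := flow h; rewrite vE.
  have -> : \sum_x h x * lap h x = - E / 2 by rewrite /E energyE; field.
  have -> : \sum_i h i * (s i - n * unit_mass i + iter T lazy g i) =
      \sum_i h i * s i - n * h 0 + sm.
    rewrite -(sum_unit_mass h) mulr_sumr -sumrB -big_split.
    by apply: eq_bigr => x _ /=; ring.
  rewrite -/err (sum_chi h) => eq1.
  have -> : \sum_x h x * (chi x - s x) = \sum_x h x * chi x - \sum_x h x * s x.
    by rewrite -sumrB; apply: eq_bigr => x _; ring.
  lra.
(* Young's inequality: [err] and [sm] may together use up to [E / 2]. *)
have err_le : err <= E / 8 + 2 * c * n.
  have pt (a b : R) : `|a| <= 1 -> a * b <= b ^+ 2 / 8 + 2.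
    rewrite ler_norml => /andP[a1 a2].
    have : 0 <= (b - 4) ^+ 2 by apply: sqr_ge0.
    have : 0 <= (b + 4) ^+ 2 by apply: sqr_ge0.
    case: (lerP 0 b) => b0; nra.
  apply: (@le_trans _ _ (\sum_(x in A) (\sum_u (h (x + step u) - h x) ^+ 2) / 8
      + \sum_(x in A) 2 * c)).
    rewrite -big_split; apply: ler_sum => x _ /=.
    have -> : 2 * c = \sum_(u : D) 2 by rewrite sumr_const mulr_natr.
    rewrite mulr_suml -big_split; apply: ler_sum => u _ /=.
    exact: pt (r_le1 _ _).
  apply: lerD; last by rewrite sumr_const -[leLHS]mulr_natr.
  rewrite -mulr_suml; apply: ler_wpM2r; first by rewrite invr_ge0.
  rewrite /E /energy [leRHS](bigID (mem A)) /= lerDl.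
  by do 2!apply: sumr_ge0 => ? _; apply: sqr_ge0.
have sm_le : sm <= E / 8 + 2 * (n ^+ 2 * l%:R ^+ 2 * heat_norm2 T).
  pose H := iter T lazy h.
  have smE : sm = \sum_x f x * (H 0 - H x).
    rewrite /sm iter_lazyC -/H.
    under eq_bigr do rewrite /g mulrBr mulrC.
    rewrite sumrB; under eq_bigr do rewrite -mulrA.
    rewrite -mulr_sumr sum_unit_mass -sum_f mulr_suml -sumrB.
    by apply: eq_bigr => x _; ring.
  set b := n ^+ 2 * _ * _.
  have b_ge0 : 0 <= b by rewrite !mulr_ge0 ?sqr_ge0 ?heat_norm2_ge0.
  rewrite -(ler_pM2l n_gt0) -sum_f smE sum_f mulr_sumr -[X in _ <= X * _]sum_f.
  rewrite mulr_suml; apply: ler_sum => x _; rewrite mulrCA.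
  have [->|fx] := eqVneq (f x) 0; first by rewrite !mul0r.
  apply: ler_wpM2l => //.
  have [p xE le_p] := f_supp x fx.
  have osc := smoothed_oscillation T h p.
  rewrite -xE -/H -/E in osc.
  set z := n * _; have z2 : z ^+ 2 <= b * E.
    rewrite /z exprMn -[(H 0 - _) ^+ 2]sqrrN opprB.
    apply: (@le_trans _ _ (n ^+ 2 * (heat_norm2 T * ((size p)%:R ^+ 2 * E)))).
      by apply: ler_wpM2l; rewrite ?sqr_ge0.
    have -> : b * E = n ^+ 2 * (heat_norm2 T * (l%:R ^+ 2 * E)) by rewrite /b; ring.
    apply: ler_wpM2l; first exact: sqr_ge0.
    apply: ler_wpM2l; first exact: heat_norm2_ge0.
    by apply: ler_wpM2r => //; rewrite lerXn2r ?nnegrE ?ler0n // ler_nat.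
  rewrite leNgt; apply/negP => lt_z.
  have : 0 <= (E / 8 - 2 * b) ^+ 2 by apply: sqr_ge0.
  nra.
have G_le : \sum_x `|G x| <= T%:R / c * n.
  have np_ge0 x : 0 <= n * unit_mass x.
    by rewrite mulr_ge0 ?ler0n.
  apply: le_trans (sum_green_le T np_ge0 f_ge0) _.
  rewrite -mulr_sumr sum_f.
  have -> : \sum_x unit_mass x = 1.
    by rewrite -(sum_heat 0).
  by rewrite le_eqVlt; apply/orP; left; apply/eqP; field.
have main : \sum_(x in ~: A) w x - \sum_x w x * (1 - s x) - 2 * \sum_x `|G x| <=
    \sum_x h x * (chi x - s x).
  rewrite big_mkcond /= mulr_sumr -!sumrB; apply: ler_sum => x _.
  have /andP[s1 s2] := s_le1 x.
  have G1 : G x <= `|G x| by rewrite ler_norm.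
  have G2 : - `|G x| <= G x by have := lerNnormlW (lexx `|G x|); lra.
  have v0 := v_ge0 x; have w0 := w_ge0 x.
  have N0 := normr_ge0 (G x).
  rewrite inE /h /chi; have [xA|xA] /= := boolP (x \in A); first by nra.
  rewrite v_supp //; nra.
lra.
Qed.

End FiniteGroup.

(** * The radial profile *)

Section Profile.

Context {R : realFieldType}.
Variables (d J I : nat).

(** The profile is a function of [q = |x|^2]. Writing [- slope q] for its forward
difference, its Laplacian at [x] is, to leading order,
  [4 q (slope (q - 1) - slope q) - 2 d slope q],
and requiring this to equal [1] for [I < q <= J], with [slope J = 0], is a
first-order recursion solved by the product below. It is a discrete stand-in
for [(J / q) ^ (d / 2)]. *)
Definition growth (q : nat) : R :=
  \prod_(q.+1 <= j < J.+1) (1 + d%:R / (2 * j%:R)).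

Definition slope (q : nat) : R := (growth (maxn q I) - 1) / (2 * d%:R).

Definition profile (q : nat) : R := \sum_(q <= j < J) slope j.

(** The Laplacian of [x |-> profile (|x|^2)] at a point with [|x|^2 = q] and
[|x_i| = a i]. *)
Definition radial_lap (q : nat) (a : 'I_d -> nat) : R :=
  \sum_(i < d) (profile (q.+1 + 2 * a i) + profile (q.+1 - 2 * a i)
                - 2 * profile q).

Lemma growth_far q : (J <= q)%N -> growth q = 1.
Proof. by move=> Jq; rewrite /growth big_geq // ltnS. Qed.

Lemma growth_step q : (q < J)%N ->
  growth q = growth q.+1 * (1 + d%:R / (2 * q.+1%:R)).
Proof. by move=> qJ; rewrite /growth big_ltn ?ltnS // mulrC. Qed.

Lemma growth_ge1 q : 1 <= growth q.
Proof.
apply: (big_ind (fun x : R => 1 <= x)) => // [x y x1 y1|j _].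
  by rewrite -[1]mulr1 ler_pM.
by rewrite lerDl divr_ge0 ?mulr_ge0.
Qed.

Lemma growth_gt0 q : 0 < growth q.
Proof. exact: lt_le_trans ltr01 (growth_ge1 q). Qed.

Lemma growth_anti p q : (p <= q)%N -> growth q <= growth p.
Proof.
move=> /subnK <-; elim: (q - p)%N => // k; apply: le_trans; rewrite addSn.
have [far|near] := leqP J (k + p)%N; first by rewrite !growth_far //; lia.
rewrite (growth_step near) -[leLHS]mulr1; apply: ler_wpM2l.
  exact: ltW (growth_gt0 _).
by rewrite lerDl divr_ge0 ?ler0n ?mulr_ge0.
Qed.

Lemma bernoulli (t : R) n : -1 <= t -> 1 + n%:R * t <= (1 + t) ^+ n.
Proof.
move=> t_ge; elim: n => [|n IH]; first by rewrite mul0r addr0.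
have t1 : 0 <= 1 + t by lra.
rewrite exprS; apply: le_trans (ler_wpM2l t1 IH); rewrite -natr1.
have : 0 <= n%:R * t ^+ 2 by rewrite mulr_ge0 ?ler0n ?sqr_ge0.
by move: (n%:R) => z; nra.
Qed.

(** The true exponent is [d / 2]; an integer exponent avoids square roots and
only affects constants. *)
Lemma growth_ratio p q : (0 < p)%N -> (p <= q)%N ->
  growth p <= growth q * (q%:R / p%:R) ^+ d.
Proof.
move=> p_gt0 /subnK <-; have p0 : p%:R != 0 :> R by rewrite pnatr_eq0 -lt0n.
elim: (q - p)%N => [|k IH]; first by rewrite divff // expr1n mulr1.
apply: le_trans IH _; rewrite addSn.
set m := (k + p)%N; have m_gt0 : (0 < m)%N by rewrite /m; lia.
have m0 : m%:R != 0 :> R by rewrite pnatr_eq0 -lt0n.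
have -> : m.+1%:R / p%:R = m%:R / p%:R * (1 + m%:R^-1) :> R.
  by rewrite -natr1; field; rewrite p0 m0.
rewrite [leRHS]mulrC [(_ * (1 + _)) ^+ d]exprMn -mulrA [leLHS]mulrC; apply: ler_wpM2l.
  by rewrite exprn_ge0 // divr_ge0.
have le1 : 1 + d%:R * m%:R^-1 <= (1 + m%:R^-1) ^+ d :> R.
  have m1 : 0 <= m%:R^-1 :> R by rewrite invr_ge0.
  by apply: bernoulli; lra.
have [far|near] := leqP J m.
  rewrite !growth_far ?leqW // mulr1; apply: le_trans le1.
  by rewrite lerDl divr_ge0.
rewrite (growth_step near) [leRHS]mulrC; apply: ler_wpM2l; first exact: ltW (growth_gt0 _).
apply: le_trans le1; rewrite lerD2l; apply: ler_wpM2l => //.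
rewrite lef_pV2 ?posrE ?mulr_gt0 ?ltr0n //.
have : 0 <= m%:R :> R by []. rewrite -[m.+1%:R]natr1; lra.
Qed.

Lemma growth_ge q : (q <= J)%N ->
  1 + (J - q)%N%:R * (d%:R / (2 * J%:R)) <= growth q.
Proof.
move=> /subnK; move: (J - q)%N => k; elim: k q => [|k IH] q.
  by rewrite mul0r addr0 growth_ge1.
rewrite addSnnS => eq_J; apply: (@le_trans _ _ (growth q.+1 + d%:R / (2 * J%:R))).
  by rewrite -natr1 mulrDl mul1r addrA lerD2r IH.
rewrite (@growth_step q); last by rewrite -eq_J leq_addl.
rewrite mulrDr mulr1 lerD2l -[leLHS]mul1r.
have J0 : 0 < J%:R :> R by rewrite ltr0n -eq_J addnS.
rewrite ler_pM ?growth_ge1 ?divr_ge0 ?mulr_ge0 ?ler01 //.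
apply: ler_wpM2l => //.
have q0 : 0 < q.+1%:R :> R by rewrite ltr0n.
by rewrite lef_pV2 ?posrE ?mulr_gt0 // ler_pM2l // ler_nat -eq_J leq_addl.
Qed.

Hypotheses (d_gt0 : (0 < d)%N) (I_gt0 : (0 < I)%N) (I_leJ : (I <= J)%N).

Lemma slope_ge0 q : 0 <= slope q.
Proof. by rewrite divr_ge0 ?mulr_ge0 // subr_ge0 growth_ge1. Qed.

Lemma slope_far q : (J <= q)%N -> slope q = 0.
Proof. by move=> Jq; rewrite /slope growth_far ?subrr ?mul0r // leq_max Jq. Qed.

Lemma slope_anti p q : (p <= q)%N -> slope q <= slope p.
Proof.
move=> pq; rewrite /slope ler_pM2r ?invr_gt0 ?mulr_gt0 ?ltr0n //.
by rewrite lerD2r growth_anti // geq_max leq_maxr leq_max pq.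
Qed.

Lemma slope_mul q : (I <= q)%N -> 2 * d%:R * slope q = growth q - 1.
Proof.
move=> Iq; rewrite /slope (maxn_idPl Iq) mulrC divfK //.
by rewrite mulf_neq0 ?pnatr_eq0 // -lt0n.
Qed.

Lemma profile_step q : profile q = slope q + profile q.+1.
Proof.
have [far|near] := leqP J q; last by rewrite /profile big_ltn.
by rewrite /profile !big_geq ?leqW // slope_far // addr0.
Qed.

Lemma profile_ge0 q : 0 <= profile q.
Proof. by apply: sumr_ge0 => j _; apply: slope_ge0. Qed.

Lemma profile_far q : (J <= q)%N -> profile q = 0.
Proof. by move=> Jq; rewrite /profile big_geq. Qed.

Lemma profile_second_difference m b : (b <= m)%N ->
  profile (m + b) + profile (m - b) - 2 * profile m =
  \sum_(e < b) (slope (m - e.+1) - slope (m + e)).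
Proof.
elim: b => [|b IH] le_bm; first by rewrite big_ord0 addn0 subn0; ring.
rewrite big_ord_recr /= -(IH (ltnW le_bm)).
have := profile_step (m + b); rewrite -addnS => ->.
rewrite [profile (m - b.+1)]profile_step.
have -> : (m - b.+1).+1 = (m - b)%N by lia.
ring.
Qed.

Lemma radial_lapE q (a : 'I_d -> nat) :
  (forall i, (a i ^ 2 <= q)%N) ->
  radial_lap q a =
  \sum_(i < d) \sum_(e < 2 * a i) (slope (q - e) - slope (q.+1 + e))
  - 2 * d%:R * slope q.
Proof.
move=> le_aq.
have -> : 2 * d%:R * slope q = \sum_(i < d) 2 * slope q.
  by rewrite sumr_const card_ord -[RHS]mulr_natl; ring.
rewrite -sumrB; apply: eq_bigr => i _.
have /profile_second_difference : (2 * a i <= q.+1)%N by have := le_aq i; nia.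
under [RHS]eq_bigr do rewrite subSS.
by move=> eq1; rewrite -eq1 [profile q]profile_step; ring.
Qed.

(** The recursion that defines [growth], read as a formula for the second
difference of [profile]. *)
Lemma slope_drop j : (I < j)%N ->
  slope j.-1 - slope j = (if (j <= J)%N then growth j / (4 * j%:R) else 0).
Proof.
case: j => // j lt_Ij; case: ifPn => [le_jJ|]; last first.
  by rewrite -leqNgt => lt_Jj; rewrite /= !slope_far ?subrr //; lia.
rewrite /= /slope !(maxn_idPl _) ?(leqW lt_Ij) //; last exact: ltnW.
rewrite (growth_step le_jJ); field.
by rewrite nat1r !pnatr_eq0 /= -lt0n.
Qed.

Lemma slope_drop_small j : (j <= I)%N -> slope j.-1 - slope j = 0.
Proof.
by move=> le_jI; rewrite /slope !(maxn_idPr _) ?subrr //; case: j le_jI => // j /ltnW.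
Qed.

Lemma slope_sub_le p n k :
  (forall j, (p < j <= p + n)%N -> slope j.-1 - slope j <= k) ->
  slope p - slope (p + n) <= n%:R * k.
Proof.
elim: n => [|n IH] le_k; first by rewrite addn0 subrr mul0r.
have le1 : slope (p + n) - slope (p + n.+1) <= k.
  by have := le_k (p + n.+1)%N; rewrite addnS /=; apply; lia.
have le2 : slope p - slope (p + n) <= n%:R * k.
  by apply: IH => j lt_j; apply: le_k; lia.
rewrite -natr1 mulrDl mul1r; lra.
Qed.

Lemma slope_sub_ge p n k :
  (forall j, (p < j <= p + n)%N -> k <= slope j.-1 - slope j) ->
  n%:R * k <= slope p - slope (p + n).
Proof.
elim: n => [|n IH] ge_k; first by rewrite addn0 subrr mul0r.
have ge1 : k <= slope (p + n) - slope (p + n.+1).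
  by have := ge_k (p + n.+1)%N; rewrite addnS /=; apply; lia.
have ge2 : n%:R * k <= slope p - slope (p + n).
  by apply: IH => j lt_j; apply: ge_k; lia.
rewrite -natr1 mulrDl mul1r; lra.
Qed.

Lemma sum_odd_mul (k : R) n : \sum_(e < n) (2 * e).+1%:R * k = n%:R ^+ 2 * k.
Proof.
elim: n => [|n IH]; first by rewrite big_ord0 expr0n mul0r.
by rewrite big_ord_recr /= IH -!natr1 natrM; ring.
Qed.

Section Windows.

Variables (q w : nat) (a : 'I_d -> nat).
Hypotheses (sum_a : (\sum_(i < d) a i ^ 2 = q)%N)
  (a_le_w : forall i, (2 * a i <= w)%N).

Let a2_le i : (a i ^ 2 <= q)%N.
Proof. by rewrite -sum_a (bigD1 i) //= leq_addr. Qed.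

Let sum_const (k : R) :
  \sum_(i < d) \sum_(e < 2 * a i) (2 * e).+1%:R * k = 4 * q%:R * k.
Proof.
under eq_bigr do rewrite sum_odd_mul.
rewrite -mulr_suml -sum_a natr_sum mulr_sumr; congr (_ * _).
by apply: eq_bigr => i _; rewrite natrM natrX; ring.
Qed.

(** In coordinate [i] the Laplacian collects the decrements of [slope] in a window
of half-width [2 a i] around [q], with total weight [4 (a i) ^ 2]; summed over
[i] the weights are [4 q]. Bounds on decrements become bounds on the Laplacian. *)
Lemma radial_lap_le k :
  (forall j, (q.+2 <= j + w)%N -> slope j.-1 - slope j <= k) ->
  radial_lap q a <= 4 * q%:R * k - 2 * d%:R * slope q.
Proof.
move=> le_k; rewrite radial_lapE // lerD2r -sum_const.
apply: ler_sum => i _; apply: ler_sum => e _.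
have := ltn_ord e; have := a_le_w i; have := a2_le i => le1 le2 lt_e.
have le_eq : (e <= q)%N by nia.
have -> : (q.+1 + e = (q - e) + (2 * e).+1)%N by lia.
by apply: slope_sub_le => j lt_j; apply: le_k; lia.
Qed.

Lemma radial_lap_ge k :
  (forall j, (q.+2 <= j + w)%N -> (j <= q + w)%N -> k <= slope j.-1 - slope j) ->
  4 * q%:R * k - 2 * d%:R * slope q <= radial_lap q a.
Proof.
move=> ge_k; rewrite radial_lapE // lerD2r -sum_const.
apply: ler_sum => i _; apply: ler_sum => e _.
have := ltn_ord e; have := a_le_w i; have := a2_le i => le1 le2 lt_e.
have le_eq : (e <= q)%N by nia.
have -> : (q.+1 + e = (q - e) + (2 * e).+1)%N by lia.
by apply: slope_sub_ge => j lt_j; apply: ge_k; lia.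
Qed.

End Windows.

Lemma profile_le q : profile q <= J%:R * growth I.
Proof.
have slope_le j : slope j <= growth I.
  have := slope_anti (leq0n j); have := slope_mul (leqnn I).
  rewrite /slope max0n maxnn -/(slope I) => eq1 le1.
  have d1 : 1 <= d%:R :> R by rewrite ler1n.
  have := slope_ge0 j; have := growth_gt0 I.
  by move: (slope I) eq1 le1 => y; move: (growth I) (slope j) => z t; nra.
apply: (@le_trans _ _ (\sum_(q <= j < J) growth I)); first exact: ler_sum.
rewrite big_const_nat iter_addr_0 -[leLHS]mulr_natl ler_pM2r ?growth_gt0 //.
by rewrite ler_nat leq_subr.
Qed.

Lemma slope_ge q : (I <= q)%N -> (q <= J)%N -> (J - q)%N%:R / (4 * J%:R) <= slope q.
Proof.
move=> le_Iq le_qJ; have d0 : 0 < d%:R :> R by rewrite ltr0n.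
have J0 : 0 < J%:R :> R by rewrite ltr0n (leq_trans I_gt0 (leq_trans le_Iq le_qJ)).
have d2 : 0 < 2 * d%:R :> R by rewrite mulr_gt0.
rewrite -(ler_pM2l d2) (slope_mul le_Iq) lerBrDl.
apply: le_trans (growth_ge le_qJ); rewrite lerD2l.
by rewrite le_eqVlt; apply/orP; left; apply/eqP; field; rewrite gt_eqF.
Qed.

(** Deep inside the ball, the profile is a definite fraction of [J]: at least
[J / (2 m)] of the slopes in the sum are at least [1 / (8 m)]. *)
Lemma profile_ge (m q : nat) :
  (0 < m)%N -> (4 * m <= J)%N -> (2 * I <= J)%N -> (m * q <= (m - 1) * J)%N ->
  J%:R / (64 * m%:R ^+ 2) <= profile q.
Proof.
move=> m_gt0 le_mJ le_IJ le_q.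
set b := (J %/ (2 * m))%N.
have m2_gt0 : (0 < 2 * m)%N by rewrite muln_gt0.
have b_le : (2 * m * b <= J)%N by rewrite mulnC leq_trunc_div.
have b_ge : (J < 2 * m * b.+1)%N by rewrite mulnC ltn_ceil.
have qb : (q + b <= J - b)%N by nia.
have Ib : (I <= J - b)%N by nia.
have slope_b j : (j < q + b)%N -> b%:R / (4 * J%:R) <= slope j.
  move=> lt_j; apply: (@le_trans _ _ (slope (J - b))); last first.
    by apply: slope_anti; apply: ltnW; apply: leq_trans lt_j qb.
  have := slope_ge Ib (leq_subr b J); rewrite subKn //; by nia.
have J0 : 0 < J%:R :> R by rewrite ltr0n; lia.
have m0 : 0 < m%:R :> R by rewrite ltr0n.
apply: (@le_trans _ _ (b%:R * (b%:R / (4 * J%:R)))); last first.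
  rewrite /profile (@big_cat_nat _ _ _ (q + b)) ?leq_addr //=; last first.
    by apply: leq_trans qb (leq_subr _ _).
  rewrite -[leLHS]addr0; apply: lerD; last first.
    by apply: sumr_ge0 => j _; apply: slope_ge0.
  have -> : b%:R * (b%:R / (4 * J%:R)) = \sum_(q <= j < q + b) b%:R / (4 * J%:R) :> R.
    by rewrite big_const_nat iter_addr_0 addKn mulr_natl.
  by apply: ler_sum_nat => j /andP[_ /slope_b].
have b1 : J%:R <= 4 * m%:R * b%:R :> R by rewrite -!natrM ler_nat; nia.
have -> : b%:R * (b%:R / (4 * J%:R)) = (4 * m%:R * b%:R) ^+ 2 / (64 * m%:R ^+ 2 * J%:R) :> R.
  by field; rewrite !gt_eqF.
have -> : J%:R / (64 * m%:R ^+ 2) = J%:R ^+ 2 / (64 * m%:R ^+ 2 * J%:R) :> R.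
  by field; rewrite !gt_eqF.
rewrite ler_pM2r ?invr_gt0 ?mulr_gt0 ?exprn_gt0 //.
by rewrite lerXn2r // nnegrE ?mulr_ge0.
Qed.

(** ** Accuracy of the profile *)

Variable (del : R).
Hypotheses (del_gt0 : 0 < del) (del_small : 2 * (d%:R + 1) * del <= 1)
  (I_large : 4 <= del ^+ 2 * I%:R).

Let d_ge1 : 1 <= d%:R :> R. Proof. by rewrite ler1n. Qed.

Let del_le : del <= 1 / 4.
Proof.
have : 0 <= del * (d%:R - 1) by rewrite mulr_ge0 ?subr_ge0 // ltW.
by have := del_small; lra.
Qed.

Let pow_del n : 1 - n%:R * del <= (1 - del) ^+ n.
Proof.
have := @bernoulli (- del) n; rewrite mulrN; apply.
by have := del_le; lra.
Qed.

Let ratio_sub q j : (0 < q)%N -> (0 < j)%N -> (1 - del) * q%:R <= j%:R ->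
  (q%:R / j%:R) ^+ d.+1 <= 1 + 2 * (d%:R + 1) * del.
Proof.
have dsm := del_small; have dle := del_le; have dgt := del_gt0; have d0 := d_ge1.
move=> q_gt0 j_gt0 le_j.
have q0 : 0 < q%:R :> R by rewrite ltr0n.
have j0 : 0 < j%:R :> R by rewrite ltr0n.
have d1 : 0 < 1 - del by lra.
have le1 : q%:R / j%:R <= (1 - del)^-1.
  by rewrite ler_pdivrMr // mulrC ler_pdivlMr // mulrC.
have qj0 : 0 <= q%:R / j%:R :> R by rewrite divr_ge0 // ltW.
have le2 : (q%:R / j%:R) ^+ d.+1 <= (1 - del)^-1 ^+ d.+1.
  by rewrite lerXn2r // nnegrE // invr_ge0 ltW.
apply: le_trans le2 _; rewrite exprVn.
have := pow_del d.+1; rewrite -natr1 => le3.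
have d2 : (d%:R + 1) * del <= 1 / 2 by lra.
have le4 : 0 < (1 - del) ^+ d.+1 by rewrite exprn_gt0.
rewrite -[leLHS]mul1r ler_pdivrMr //.
have e0 : 0 <= (d%:R + 1) * del by apply: mulr_ge0; lra.
rewrite -mulrA; move: (_ * del) (_ ^+ d.+1) d2 le3 le4 e0 => e z *; nra.
Qed.

Section Estimates.

Variables (q : nat) (a : 'I_d -> nat).
Hypothesis (sum_a : (\sum_(i < d) a i ^ 2 = q)%N).

Let window : (I <= q)%N ->
  exists2 w, (forall i, 2 * a i <= w)%N & w%:R <= del * q%:R.
Proof.
move=> le_Iq; exists (\max_(i < d) (2 * a i))%N.
  by move=> i; apply: (bigop.leq_bigmax i).
have [|i ->] := @bigop.eq_bigmax _ (fun i => 2 * a i)%N; first by rewrite card_ord.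
have q0 : 0 <= del * q%:R by rewrite mulr_ge0 // ltW.
rewrite -ler_sqr ?nnegrE //.
have : (a i ^ 2 <= q)%N by rewrite -sum_a (bigD1 i) //= leq_addr.
rewrite -(ler_nat R) natrX => le1.
have le2 : I%:R <= q%:R :> R by rewrite ler_nat.
have : del ^+ 2 * I%:R <= del ^+ 2 * q%:R by apply: ler_wpM2l; rewrite ?sqr_ge0.
rewrite natrM !exprMn => le3.
have q_ge0 : 0 <= q%:R :> R by [].
by move: (del ^+ 2) I_large le3 => z *; nra.
Qed.

Lemma slope_drop_ge0 j : 0 <= slope j.-1 - slope j.
Proof. by rewrite subr_ge0 slope_anti // leq_pred. Qed.

Lemma slope_drop_le j : (I < j)%N -> slope j.-1 - slope j <= growth j / (4 * j%:R).
Proof.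
move=> lt_Ij; rewrite slope_drop //; case: ifP => // _.
by rewrite divr_ge0 ?mulr_ge0 // ltW // growth_gt0.
Qed.

(** For small [q] the bound uses only that the decrements vanish up to [I]. For
[q >= I] the window around [q] has relative width [del], so all decrements in it
are close to [growth q / (4 q)]. *)
Lemma radial_lap_le1 : radial_lap q a <= 1 + 2 * (d%:R + 1) * del * growth I.
Proof.
have dsm := del_small; have dle := del_le; have dgt := del_gt0; have d0 := d_ge1.
have gI := growth_gt0 I; have del0 := ltW del_gt0.
have I0 : 0 < I%:R :> R by rewrite ltr0n.
have [lt_qI|le_Iq] := ltnP q I.
  have le_k j : (q.+2 <= j + q.+2)%N ->
      slope j.-1 - slope j <= growth I / (4 * I%:R).
    move=> _; have [le_jI|lt_Ij] := leqP j I.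
      by rewrite slope_drop_small // divr_ge0 ?mulr_ge0 // ltW.
    apply: le_trans (slope_drop_le lt_Ij) _.
    have j0 : 0 < j%:R :> R by rewrite ltr0n (leq_ltn_trans _ lt_Ij).
    rewrite ler_pM ?invr_ge0 ?mulr_ge0 ?(ltW (growth_gt0 _)) //.
      by rewrite growth_anti // ltnW.
    by rewrite lef_pV2 ?posrE ?mulr_gt0 // ler_pM2l // ler_nat ltnW.
  have a_le i : (2 * a i <= q.+2)%N.
    have : (a i ^ 2 <= q)%N by rewrite -sum_a (bigD1 i) //= leq_addr.
    by nia.
  apply: le_trans (radial_lap_le sum_a a_le le_k) _.
  have -> : 2 * d%:R * slope q = growth I - 1.
    by rewrite -(slope_mul (leqnn I)) /slope maxnn (maxn_idPr (ltnW lt_qI)).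
  have le1 : 4 * q%:R * (growth I / (4 * I%:R)) <= growth I.
    have -> : 4 * q%:R * (growth I / (4 * I%:R)) = growth I * (q%:R / I%:R).
      by field; rewrite gt_eqF.
    rewrite -[leRHS]mulr1 ler_pM2l // ler_pdivrMr // mul1r ler_nat ltnW //.
  have : 0 <= 2 * (d%:R + 1) * del * growth I.
    by apply: mulr_ge0; [apply: mulr_ge0; lra | exact: ltW].
  lra.
have [w a_le le_w] := window le_Iq.
have q_gt0 : (0 < q)%N := leq_trans I_gt0 le_Iq.
have q0 : 0 < q%:R :> R by rewrite ltr0n.
have gq := growth_gt0 q.
set e := 2 * (d%:R + 1) * del; have e0 : 0 <= e by apply: mulr_ge0; lra.
have le_k j : (q.+2 <= j + w)%N ->
    slope j.-1 - slope j <= growth q / (4 * q%:R) * (1 + e).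
  move=> le_j; have [le_jI|lt_Ij] := leqP j I.
    rewrite slope_drop_small // mulr_ge0 //; last by lra.
    by rewrite divr_ge0 ?mulr_ge0 // ltW.
  have j_gt0 : (0 < j)%N := leq_ltn_trans (leq0n I) lt_Ij.
  have j0 : 0 < j%:R :> R by rewrite ltr0n.
  have le1 : (1 - del) * q%:R <= j%:R.
    have : (q + 2)%:R <= (j + w)%:R :> R by rewrite ler_nat addn2.
    rewrite !natrD; lra.
  apply: le_trans (slope_drop_le lt_Ij) _.
  have [le_jq|lt_qj] := leqP j q.
    apply: (@le_trans _ _ (growth q * (q%:R / j%:R) ^+ d / (4 * j%:R))).
      by rewrite ler_pM2r ?invr_gt0 ?mulr_gt0 // growth_ratio.
    have -> : growth q * (q%:R / j%:R) ^+ d / (4 * j%:R) =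
        growth q / (4 * q%:R) * (q%:R / j%:R) ^+ d.+1.
      by rewrite exprSr; move: (_ ^+ d) => z; field; rewrite !gt_eqF.
    by apply: ler_wpM2l (ratio_sub q_gt0 j_gt0 le1); rewrite divr_ge0 ?mulr_ge0 // ltW.
  apply: (@le_trans _ _ (growth q / (4 * q%:R))).
    rewrite ler_pM ?invr_ge0 ?mulr_ge0 ?(ltW (growth_gt0 _)) //.
      by rewrite growth_anti // ltnW.
    by rewrite lef_pV2 ?posrE ?mulr_gt0 // ler_pM2l // ler_nat ltnW.
  rewrite -[leLHS]mulr1; apply: ler_wpM2l; last by lra.
  by rewrite divr_ge0 ?mulr_ge0 // ltW.
apply: le_trans (radial_lap_le sum_a a_le le_k) _.
rewrite (slope_mul le_Iq).
have -> : 4 * q%:R * (growth q / (4 * q%:R) * (1 + e)) = growth q * (1 + e).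
  by field; rewrite gt_eqF.
have : growth q <= growth I by apply: growth_anti.
move: (growth q) (growth I) => y z; nra.
Qed.

Lemma radial_lap_ge1 : (2 * I <= q)%N -> (1 + del) * q%:R <= J%:R ->
  1 - (d%:R + 1) * del * growth I <= radial_lap q a.
Proof.
have dsm := del_small; have dle := del_le; have dgt := del_gt0; have d0 := d_ge1.
move=> le_Iq le_qJ; have le_Iq1 : (I <= q)%N by lia.
have [w a_le le_w] := window le_Iq1.
have q_gt0 : (0 < q)%N := leq_trans I_gt0 le_Iq1.
have q0 : 0 < q%:R :> R by rewrite ltr0n.
have gq := growth_gt0 q; have del0 := ltW del_gt0.
set e := (d%:R + 1) * del; have e0 : 0 <= e by apply: mulr_ge0; lra.
have ge_k j : (q.+2 <= j + w)%N -> (j <= q + w)%N ->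
    growth q / (4 * q%:R) * (1 - e) <= slope j.-1 - slope j.
  rewrite -(ler_nat R) -(ler_nat R _ (q + w)) -[q.+2]addn2 !natrD => le1 le2.
  have lt_Ij : (I < j)%N.
    rewrite -(ltr_nat R).
    have : 2 * I%:R <= q%:R :> R by rewrite -natrM ler_nat.
    have : del * q%:R <= 1 / 4 * q%:R by rewrite ler_pM2r.
    lra.
  have j_gt0 : (0 < j)%N := leq_ltn_trans (leq0n I) lt_Ij.
  have j0 : 0 < j%:R :> R by rewrite ltr0n.
  have le_jJ : (j <= J)%N by rewrite -(ler_nat R); lra.
  rewrite slope_drop // le_jJ.
  have gq4 : 0 <= growth q / (4 * q%:R) by rewrite divr_ge0 ?mulr_ge0 // ltW.
  have [le_jq|lt_qj] := leqP j q.
    apply: (@le_trans _ _ (growth q / (4 * q%:R))).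
      by rewrite -[leRHS]mulr1; apply: ler_wpM2l => //; lra.
    rewrite ler_pM ?invr_ge0 ?mulr_ge0 ?(ltW (growth_gt0 _)) //.
      by rewrite growth_anti.
    by rewrite lef_pV2 ?posrE ?mulr_gt0 // ler_pM2l // ler_nat.
  have ratio : 1 - e <= (q%:R / j%:R) ^+ d.+1.
    have le3 : 1 - del <= q%:R / j%:R.
      rewrite ler_pdivlMr //.
      have : (1 - del) * j%:R <= (1 - del) * (q%:R + del * q%:R).
        by apply: ler_wpM2l; lra.
      nra.
    have le4 := pow_del d.+1; rewrite -natr1 -/e in le4; apply: le_trans le4 _.
    by rewrite lerXn2r // nnegrE; [lra | rewrite divr_ge0].
  apply: (@le_trans _ _ (growth q / (4 * q%:R) * (q%:R / j%:R) ^+ d.+1)).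
    exact: ler_wpM2l.
  have le4 : growth q * (q%:R / j%:R) ^+ d <= growth j.
    rewrite -ler_pdivlMr ?exprn_gt0 ?divr_gt0 // -exprVn invf_div.
    by apply: growth_ratio => //; apply: ltnW.
  have -> : growth q / (4 * q%:R) * (q%:R / j%:R) ^+ d.+1 =
      growth q * (q%:R / j%:R) ^+ d / (4 * j%:R).
    by rewrite exprSr; move: (_ ^+ d) => z; field; rewrite !gt_eqF.
  by rewrite ler_pM2r // invr_gt0 mulr_gt0.
apply: le_trans (radial_lap_ge sum_a a_le ge_k).
rewrite (slope_mul le_Iq1).
have -> : 4 * q%:R * (growth q / (4 * q%:R) * (1 - e)) = growth q * (1 - e).
  by field; rewrite gt_eqF.
have : growth q <= growth I by apply: growth_anti.
move: (growth q) (growth I) => y z; nra.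
Qed.

Let growth_le2 : (I <= q)%N -> J%:R <= (1 + del) * q%:R -> growth q <= 2.
Proof.
have dsm := del_small; have dle := del_le; have dgt := del_gt0; have d0 := d_ge1.
move=> le_Iq le_Jq.
have [far|near] := leqP J q; first by rewrite growth_far // ler1n.
have q_gt0 : (0 < q)%N := leq_trans I_gt0 le_Iq.
have q0 : 0 < q%:R :> R by rewrite ltr0n.
have := growth_ratio q_gt0 (ltnW near); rewrite (growth_far (leqnn J)) mul1r.
move=> le1; apply: le_trans le1 _.
have le2 : J%:R / q%:R <= 1 + del by rewrite ler_pdivrMr.
have J0 : 0 <= J%:R / q%:R :> R by rewrite divr_ge0.
apply: (@le_trans _ _ ((1 + del) ^+ d)).
  by rewrite lerXn2r // nnegrE; lra.
have le3 := pow_del d.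
have le4 : (1 + del) ^+ d * (1 - del) ^+ d <= 1.
  have del2 : del ^+ 2 <= 1 by rewrite expr_le1 ?ltW //; lra.
  have -> : (1 + del) ^+ d * (1 - del) ^+ d = (1 - del ^+ 2) ^+ d.
    by rewrite -exprMn; congr (_ ^+ d); ring.
  by rewrite exprn_ile1 ?subr_ge0 // gerBl sqr_ge0.
have le5 : 0 <= (1 + del) ^+ d by rewrite exprn_ge0 //; lra.
by move: (_ ^+ d) (_ ^+ d) le3 le4 le5 => y z *; nra.
Qed.

Lemma radial_lap_geN1 : (I <= q)%N -> J%:R <= (1 + del) * q%:R ->
  -1 <= radial_lap q a.
Proof.
have dsm := del_small; have dle := del_le; have dgt := del_gt0; have d0 := d_ge1.
move=> le_Iq le_Jq; have [w a_le _] := window le_Iq.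
have := @radial_lap_ge _ _ _ sum_a a_le 0.
rewrite mulr0 sub0r (slope_mul le_Iq) => ge0.
have := growth_le2 le_Iq le_Jq.
have := ge0 (fun j _ _ => slope_drop_ge0 j); lra.
Qed.

Lemma radial_lap_eq0 : (I <= q)%N -> J%:R <= (1 - del) * q%:R ->
  radial_lap q a = 0.
Proof.
have dsm := del_small; have dle := del_le; have dgt := del_gt0; have d0 := d_ge1.
move=> le_Iq le_Jq; have [w a_le le_w] := window le_Iq.
have le_Jqw : (J <= q - w)%N.
  have : (J + w <= q)%N by rewrite -(ler_nat R) natrD; lra.
  by clear; lia.
apply: big1 => i _; have := a_le i => le_i.
have [far1 far2 far3] : [/\ J <= q.+1 + 2 * a i, J <= q.+1 - 2 * a i & J <= q]%N.
  by clear -le_i le_Jqw; split; lia.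
by rewrite !profile_far //; ring.
Qed.

Lemma profile_edge : (I <= q)%N -> (q <= J)%N -> J%:R <= (1 + del) * q%:R ->
  profile q <= del * J%:R.
Proof.
have dsm := del_small; have dle := del_le; have dgt := del_gt0; have d0 := d_ge1.
move=> le_Iq le_qJ le_Jq; rewrite /profile.
have slope_le1 j : (q <= j)%N -> slope j <= 1.
  move=> le_qj; apply: le_trans (slope_anti le_qj) _.
  have := slope_mul le_Iq; have := growth_le2 le_Iq le_Jq.
  by have := slope_ge0 q; move: (slope q) (growth q) => y z; nra.
apply: (@le_trans _ _ (\sum_(q <= j < J) 1)).
  by apply: ler_sum_nat => j /andP[le_qj _]; apply: slope_le1.
rewrite big_const_nat iter_addr_0 natrB //.
have : q%:R <= J%:R :> R by rewrite ler_nat.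
by nra.
Qed.

End Estimates.

End Profile.

(** * The odometer of rotor-router aggregation *)

Section Turns.

Variables (T : finType) (c : {perm T}).
Hypothesis c_full : forall u, porbit c u = [set: T]%SET.

Definition turns (u0 : T) (k : nat) (u : T) : nat :=
  \sum_(i < k) (iter i.+1 c u0 == u).

Let iter_card u : iter #|T| c u = u.
Proof. by rewrite -[#|T|]cardsT -(c_full u) iter_porbit. Qed.

Let turns_card u0 u : turns u0 #|T| u = 1%N.
Proof.
have -> : turns u0 #|T| u = count_mem u (traject c (c u0) #|T|).
  rewrite /turns; elim: #|T| => [|n IH]; first by rewrite big_ord0.
  by rewrite trajectSr -cats1 count_cat big_ord_recr IH /= addn0 -iterSr.
rewrite -cardsT -(c_full (c u0)) count_uniq_mem ?uniq_traject_porbit //.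
by rewrite -porbit_traject c_full inE.
Qed.

Let turns_leq u0 m n u : (m <= n)%N -> (turns u0 m u <= turns u0 n u)%N.
Proof. by move=> /subnKC <-; rewrite /turns big_split_ord leq_addr. Qed.

Let turns_addcard u0 k u : turns u0 (#|T| + k) u = (1 + turns u0 k u)%N.
Proof.
rewrite /turns big_split_ord /= -/(turns u0 #|T| u) turns_card.
congr (_ + _)%N; apply: eq_bigr => i _.
by rewrite addnC iterD iter_card.
Qed.

(** A rotor uses every direction once per turn around the cycle. *)
Lemma turns_balanced (R : realFieldType) u0 k u :
  `|(turns u0 k u)%:R - k%:R / #|T|%:R| <= 1 :> R.
Proof.
set N := #|T|; have N_gt0 : (0 < N)%N by apply/card_gt0P; exists u.
have N0 : 0 < N%:R :> R by rewrite ltr0n.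
have [t [t_le1 tE]] : exists t, (t <= 1)%N /\ turns u0 k u = (k %/ N + t)%N.
  exists (turns u0 (k %% N) u); split.
    rewrite -(turns_card u0 u) -/N; apply: turns_leq.
    exact: ltnW (ltn_pmod k N_gt0).
  rewrite {1}(divn_eq k N); elim: (k %/ N)%N => // a IH.
  by rewrite mulSn -addnA turns_addcard IH addSn.
rewrite tE natrD {2}(divn_eq k N) natrD natrM mulrDl mulfK ?gt_eqF //.
have b1 : (k %% N)%:R / N%:R < 1 :> R.
  by rewrite ltr_pdivrMr // mul1r ltr_nat ltn_pmod.
have b0 : 0 <= (k %% N)%:R / N%:R :> R by rewrite divr_ge0.
have t1 : t%:R <= 1 :> R by rewrite lern1.
have t0 : 0 <= t%:R :> R by [].
by rewrite ler_norml; apply/andP; split; lra.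
Qed.

Lemma sum_turns (R : realFieldType) u0 k (G : T -> R) :
  \sum_(i < k) G (iter i.+1 c u0) =
  k%:R / #|T|%:R * \sum_u G u
  + \sum_u ((turns u0 k u)%:R - k%:R / #|T|%:R) * G u.
Proof.
rewrite mulr_sumr -big_split /=.
under [RHS]eq_bigr do rewrite -mulrDl addrC subrK /turns natr_sum mulr_suml.
rewrite exchange_big /=; apply: eq_bigr => i _.
rewrite (bigD1 (iter i.+1 c u0)) //= eqxx mul1r big1 ?addr0 // => u /negPf.
by rewrite eq_sym => ->; rewrite mul0r.
Qed.

End Turns.

Definition sqnorm (d : nat) (x : 'rV[int]_d) : int := \sum_i x 0 i ^+ 2.

Lemma dir_vecE d (u : direction d) j :
  dir_vec u 0 j = if j == u.1 then (-1) ^+ u.2 else 0.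
Proof.
by rewrite !mxE eqxx /=; case: eqP => _; rewrite ?mulr1 ?mulr0.
Qed.

Lemma sqnorm_step d (x : 'rV[int]_d) u :
  sqnorm (x + dir_vec u) = sqnorm x + 2 * ((-1) ^+ u.2 * x 0 u.1) + 1.
Proof.
rewrite /sqnorm (bigD1 u.1) // [in RHS](bigD1 u.1) //= mxE dir_vecE eqxx.
rewrite (eq_bigr (fun i => x 0 i ^+ 2)); last first.
  by move=> i /negPf ne; rewrite mxE dir_vecE ne addr0.
have : ((-1) ^+ u.2) ^+ 2 = 1 :> int by rewrite sqrr_sign.
by rewrite sqrrD => ->; ring.
Qed.

Section Aggregation.

Context {R : realType} {d : nat}.
Variables (c : {perm direction d}) (c_cyclic : cyclic_ordering c)
  (rho0 : rotor_config d).
Local Notation site := 'rV[int]_d.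
Implicit Types (s : seq site) (k : site -> nat) (f : site -> R).

Definition jumps s k f : R :=
  \sum_(x <- s) \sum_(i < k x) (f (x + dir_vec (iter i.+1 c (rho0 x))) - f x).

Definition odometer_of s k (rho : rotor_config d) : Prop :=
  (forall x, rho x = iter (k x) c (rho0 x)) /\ (forall x, x \notin s -> k x = 0%N).

Definition excess k x u : R :=
  (turns c (rho0 x) (k x) u)%:R - (k x)%:R / #|direction d|%:R.

Lemma excess_le1 k x u : `|excess k x u| <= 1.
Proof. exact: turns_balanced. Qed.

(** Separating the jumps out of each site into their mean over the directions and
a bounded remainder turns the balance of jumps into a Laplacian identity. *)
Lemma jumpsE s k f : jumps s k f =
  \sum_(x <- s) (k x)%:R / #|direction d|%:R * (\sum_u (f (x + dir_vec u) - f x))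
  + \sum_(x <- s) \sum_u excess k x u * (f (x + dir_vec u) - f x).
Proof.
rewrite -big_split; apply: eq_bigr => x _ /=.
exact: (sum_turns c _ _ (fun u => f (x + dir_vec u) - f x)).
Qed.

Definition bump k (p : site) : site -> nat := fun x => (k x + (x == p))%N.

Lemma jumps_bump s k p f : uniq s -> p \in s ->
  jumps s (bump k p) f =
  jumps s k f + (f (p + dir_vec (iter (k p).+1 c (rho0 p))) - f p).
Proof.
move=> s_uniq ps; rewrite /jumps !(bigD1_seq p) //=.
have -> : bump k p p = (k p).+1 by rewrite /bump eqxx addn1.
rewrite big_ord_recr /= addrAC; congr (_ + _ + _); apply: eq_bigr => x /negPf xp.
by have -> : bump k p x = k x by rewrite /bump xp addn0.
Qed.

Section Walk.

Variables (s : seq site) (k : site -> nat) (rho : rotor_config d).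
Hypotheses (s_uniq : uniq s) (od : odometer_of s k rho)
  (balance : forall f, \sum_(x <- s) f x = (size s)%:R * f 0 + jumps s k f).

Let pos t := (rotor_walk c rho t).2.

Let walkS t : rotor_walk c rho t.+1 = rotor_step c (rotor_walk c rho t).
Proof. by []. Qed.

Lemma walk_invariant t : (forall t', (t' < t)%N -> pos t' \in s) ->
  exists k', [/\ odometer_of s k' (rotor_walk c rho t).1,
    (\sum_(x <- s) k' x = \sum_(x <- s) k x + t)%N &
    forall f, \sum_(x <- s) f x + f (pos t) =
      (size s).+1%:R * f 0 + jumps s k' f].
Proof.
elim: t => [|t IH] in_s.
  exists k; split=> //= [|f]; first by rewrite addn0.
  by rewrite balance /pos /= -natr1; ring.
have {IH}[k' [od' sum_k' bal']] := IH (fun t' lt_t => in_s t' (leqW lt_t)).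
have ps : pos t \in s by apply: in_s.
case eq_t : (rotor_walk c rho t) od' => [r p] /= [rhoE k'0].
have pE : pos t = p by rewrite /pos eq_t.
rewrite pE in ps bal'.
have posS : pos t.+1 = p + dir_vec (iter (k' p).+1 c (rho0 p)).
  by rewrite /pos walkS eq_t /= eqxx rhoE.
exists (bump k' p); split.
- split=> [x|x xs].
    rewrite eq_t /= /bump.
    by case: eqP => [->|_]; rewrite ?addn1 ?addn0 rhoE.
  rewrite /bump k'0 //; case: eqP => // xp.
  by rewrite xp ps in xs.
- rewrite big_split /= sum_k' -[t.+1]addn1 addnA; congr (_ + _)%N.
  by rewrite (bigD1_seq p) //= eqxx big1 // => x /negPf->.
- move=> f; rewrite jumps_bump // posS addrA -bal'; ring.
Qed.

(** Rotor walk leaves every finite set: with [f x = |x|^2], each jump increases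
[f] by [1] on average over a turn of the rotor, so [f] at the particle would
grow without bound. *)
Lemma walk_exits : exists t, pos t \notin s.
Proof.
apply/not_existsP => stay.
have in_s t : pos t \in s by apply/negPn/negP; apply: stay.
pose f (x : site) : R := (sqnorm x)%:~R.
pose G (x : site) : R := \sum_u `|f (x + dir_vec u) - f x|.
have f_ge0 x : 0 <= f x by rewrite ler0z; apply: sumr_ge0 => i _; apply: sqr_ge0.
pose C := 2 * \sum_(x <- s) f x + \sum_(x <- s) G x.
have C_ge0 : 0 <= C.
  apply: addr_ge0; first by rewrite mulr_ge0 // sumr_ge0.
  by apply: sumr_ge0 => x _; apply: sumr_ge0.
have [k' [od' sum_k' bal']] := walk_invariant (fun t' _ => in_s t') (t := Num.bound C).
have := bal' f; rewrite jumpsE.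
have -> : f 0 = 0 by rewrite /f /sqnorm big1 // => i _; rewrite mxE expr0n.
rewrite mulr0 add0r => eq_f.
have lap_f x : \sum_u (f (x + dir_vec u) - f x) = #|direction d|%:R.
  rewrite -(pair_big predT predT (fun i b => f (x + dir_vec (i, b)) - f x)) /=.
  rewrite card_prod card_ord card_bool natrM mulr_natl -[d in RHS]card_ord -sumr_const.
  apply: eq_bigr => i _; rewrite big_bool /f !sqnorm_step !rmorphD !rmorphM /=.
  by ring.
have N0 : #|direction d|%:R != 0 :> R.
  have /card_gt0P : exists u : direction d, u \in predT.
    by exists (rho0 0).
  by rewrite pnatr_eq0 -lt0n.
have sum1 : \sum_(x <- s) (k' x)%:R / #|direction d|%:R *
    (\sum_u (f (x + dir_vec u) - f x)) = (\sum_(x <- s) k x + Num.bound C)%:R.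
  by rewrite -sum_k' natr_sum; apply: eq_bigr => x _; rewrite lap_f divfK.
rewrite sum1 natrD in eq_f.
have sum2 : - \sum_(x <- s) G x <=
    \sum_(x <- s) \sum_u excess k' x u * (f (x + dir_vec u) - f x).
  rewrite -sumrN; apply: ler_sum => x _; rewrite -sumrN; apply: ler_sum => u _.
  apply: lerNnormlW; rewrite normrM -[leRHS]mul1r.
  by apply: ler_wpM2r => //; apply: excess_le1.
have le_pos : f (pos (Num.bound C)) <= \sum_(x <- s) f x.
  by rewrite (bigD1_seq (pos (Num.bound C))) //= lerDl sumr_ge0.
have := archi_boundP C_ge0.
have : 0 <= (\sum_(x <- s) k x)%:R :> R by [].
rewrite /C; lra.
Qed.

End Walk.

(** Each particle travels from the origin to the site it occupies, so along its
path the increments of [f] telescope to the difference of the two end values. *)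
Lemma aggregate_odometer n : (0 < n)%N -> exists s k,
  [/\ uniq s, size s = n, forall x, aggregate c rho0 n x <-> x \in s &
      (forall x, x \notin s -> k x = 0%N) /\
      forall f, \sum_(x <- s) f x = n%:R * f 0 + jumps s k f].
Proof.
case: n => // n _.
suff [s [k [s_uniq size_s sE od bal]]] : exists s k,
  [/\ uniq s, size s = n.+1, (aggregate c rho0 n.+1 = [set` s])%classic,
     odometer_of s k (iter n (add_particle c) ([set 0]%classic, rho0)).2 &
     forall f, \sum_(x <- s) f x = n.+1%:R * f 0 + jumps s k f].
  exists s, k; split=> // [x|]; first by rewrite sE.
  by split=> //; case: od.
rewrite /aggregate /=; elim: n => [|n [s [k [s_uniq size_s sE od bal]]]].
  exists [:: 0], (fun=> 0%N); split=> // [|f].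
    by apply/seteqP; split=> x /=; rewrite inE => /eqP.
  by rewrite /jumps !big_seq1 big_ord0 addr0 mul1r.
rewrite iterS; case: (iter n _ _) sE od => A rho /= -> od.
rewrite -size_s in bal.
have [t0 exit0] := walk_exits s_uniq od bal.
have ex_exit : exists t, (rotor_walk c rho t).2 \notin s by exists t0.
have : first_exit c rho [set` s] (exit_time c rho [set` s]%classic).
  apply: (@xgetPex _ 0%N [set t | first_exit c rho [set` s] t]%classic).
  exists (ex_minn ex_exit); case: ex_minnP => t exit_t min_t; split=> /=.
    exact/negP.
  by move=> t' lt_t; apply/negPn/negP => /min_t; rewrite leqNgt lt_t.
set t := exit_time _ _ _ => -[exit_t stay_t].
have [k' [[rhoE k'0] _ bal']] := walk_invariant s_uniq od bal stay_t.
case: (rotor_walk c rho t) exit_t rhoE bal' => rho' p /= /negP ps rhoE bal'.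
exists (p :: s), k'; split=> //=; first by rewrite ps.
- by rewrite size_s.
- apply/seteqP; split=> x /=; rewrite inE.
    by case=> [-> | ->]; rewrite ?eqxx ?orbT.
  by case/orP => [/eqP -> | xs]; [right | left].
- by split=> // x; rewrite inE negb_or => /andP[_ /k'0].
move=> f; rewrite big_cons addrC bal' size_s; congr (_ + _).
by rewrite /jumps big_cons k'0 // big_ord0 add0r.
Qed.

End Aggregation.

(** * The discrete torus *)

(** Sums by parts are carried out on the torus of side [2 m + 3], whose residues
have centered representatives of absolute value at most [m + 1]; a large enough
[m] makes wrapping around invisible to functions supported near the origin. *)
Section Torus.

Variables (m d : nat).
Local Notation Z := 'I_(m.*2.+3).
Local Notation torus := 'rV[Z]_d.
Local Notation site := 'rV[int]_d.

Definition centered1 (z : Z) : int :=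
  if (z <= m.+1)%N then z%:Z else z%:Z - (m.*2.+3)%:Z.

Lemma centered1_bound z : (`|centered1 z| <= m.+1)%N.
Proof. by rewrite /centered1; have := ltn_ord z; case: ifP; lia. Qed.

Lemma intr_centered1 z : (centered1 z)%:~R = z.
Proof.
have nat_z : (z%:Z)%:~R = z by rewrite -pmulrn Zp_nat; apply: valZpK.
rewrite /centered1; case: ifP => // _; rewrite rmorphB /= nat_z.
rewrite -pmulrn (_ : _%:R = 0) ?subr0 //.
by rewrite Zp_nat; apply/val_inj; exact: modnn.
Qed.

Lemma centered1_intr (x : int) : (`|x| <= m.+1)%N -> centered1 (x%:~R) = x.
Proof.
case: x => n le_n.
  rewrite -pmulrn Zp_nat /centered1 /= modn_small; last by lia.
  by rewrite le_n.
rewrite NegzE rmorphN /= -pmulrn Zp_nat /centered1 /=.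
rewrite (@modn_small n.+1); last by lia.
rewrite modn_small; last by lia.
by case: ifP; lia.
Qed.

Definition proj (x : site) : torus := map_mx intr x.

Definition centered (z : torus) : site := map_mx centered1 z.

Lemma projD x y : proj (x + y) = proj x + proj y.
Proof. exact: map_mxD. Qed.

Lemma proj_sum (I : Type) (r : seq I) (F : I -> site) :
  proj (\sum_(i <- r) F i) = \sum_(i <- r) proj (F i).
Proof. by rewrite /proj (raddf_sum (map_mx intr)). Qed.

Lemma proj_centered z : proj (centered z) = z.
Proof. by apply/matrixP => i j; rewrite !mxE intr_centered1. Qed.

Lemma centered_inj : injective centered.
Proof. exact: can_inj proj_centered. Qed.

Lemma centered_proj (x : site) : (forall i, (`|x 0%R i| <= m.+1)%N) -> centered (proj x) = x.
Proof.
move=> x_le; apply/matrixP => i j; rewrite !mxE (ord1 i).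
by rewrite centered1_intr.
Qed.

Definition step (u : direction d) : torus := proj (dir_vec u).

Definition opp_dir (u : direction d) : direction d := (u.1, ~~ u.2).

Lemma opp_dirK : involutive opp_dir.
Proof. by case=> i b; rewrite /opp_dir /= negbK. Qed.

Lemma stepN u : step (opp_dir u) = - step u.
Proof.
by rewrite /step /dir_vec /= signrN scaleNr /proj map_mxN.
Qed.

Lemma card_direction : #|direction d| = (2 * d)%N.
Proof. by rewrite card_prod card_ord card_bool mulnC. Qed.

(** Representatives commute with a unit step except across the cut, where a
function supported near the origin vanishes on both sides. *)
Lemma centered_step (R : Type) (r0 : R) (F : site -> R) (z : torus) u :
  (forall (x : site) i, (m.+1 <= `|x 0%R i|)%N -> F x = r0) ->
  F (centered (z + step u)) = F (centered z + dir_vec u).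
Proof.
move=> F0; set y := centered z + dir_vec u.
have zE : z + step u = proj y by rewrite projD proj_centered.
have [in_box|] := boolP [forall i, (`|y 0%R i| <= m.+1)%N].
  by rewrite zE centered_proj //; apply/forallP.
rewrite negb_forall => /existsP[i]; rewrite -ltnNge => lt_y.
have yE : y 0 i = centered1 (z 0 i) + dir_vec u 0 i by rewrite !mxE.
rewrite (F0 y i) ?(ltnW lt_y) // (F0 _ i) // zE.
clearbody y; rewrite !mxE.
have := centered1_bound (z 0 i).
have : (`|(dir_vec u) 0%R i| <= 1)%N.
  by rewrite dir_vecE; case: ifP => // _; case: (u.2).
move: lt_y; rewrite yE; move: (centered1 _) (dir_vec u 0 i) => a b lt_ab le_b le_a.
have period : (m.*2.+3)%:~R = 0 :> Z.
  by rewrite -pmulrn Zp_nat; apply/val_inj; exact: modnn.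
have [->|->] : a + b = m.+2%:Z \/ a + b = - m.+2%:Z by lia.
  have -> : (m.+2%:Z)%:~R = (- m.+1%:Z)%:~R :> Z.
    have -> : m.+2%:Z = (m.*2.+3)%:Z - m.+1%:Z by lia.
    by rewrite rmorphB /= period sub0r rmorphN.
  by rewrite centered1_intr; lia.
have -> : (- m.+2%:Z)%:~R = (m.+1%:Z)%:~R :> Z.
  have -> : - m.+2%:Z = m.+1%:Z - (m.*2.+3)%:Z by lia.
  by rewrite rmorphB /= period subr0.
by rewrite centered1_intr; lia.
Qed.

(** ** Radius *)

Definition abs_coord (z : torus) (i : 'I_d) : nat := `|centered1 (z 0%R i)|%N.

Definition radius2 (z : torus) : nat := \sum_i abs_coord z i ^ 2.

Lemma sqnorm_centered z : sqnorm (centered z) = (radius2 z)%:Z.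
Proof.
rewrite /sqnorm /radius2 -[RHS]natz natr_sum; apply: eq_bigr => i _.
by rewrite natz mxE -abszX gez0_abs // sqr_ge0.
Qed.

Lemma abs_coord_sqr_le z i : (abs_coord z i ^ 2 <= radius2 z)%N.
Proof. by rewrite /radius2 (bigD1 i) //= leq_addr. Qed.

Lemma lap_radial (R : realFieldType) (psi : nat -> R) (J : nat) (z : torus) :
  (J <= m.+1 ^ 2)%N -> (forall q, (J <= q)%N -> psi q = 0) ->
  lap step (fun y => psi (radius2 y)) z =
  \sum_i (psi ((radius2 z).+1 + 2 * abs_coord z i)%N
    + psi ((radius2 z).+1 - 2 * abs_coord z i)%N - 2 * psi (radius2 z)).
Proof.
move=> le_J psi0; pose F (x : site) : R := psi `|sqnorm x|%N.
have F0 (x : site) i : (m.+1 <= `|x 0%R i|)%N -> F x = 0.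
  move=> le_x; apply: psi0; apply: leq_trans le_J _.
  have : (x 0 i) ^+ 2 <= sqnorm x.
    by rewrite /sqnorm (bigD1 i) //= lerDl sumr_ge0 // => j _; apply: sqr_ge0.
  move: le_x; move: (x 0 i) (sqnorm x) => t q; rewrite !expr2; nia.
have FE y : psi (radius2 y) = F (centered y) by rewrite /F sqnorm_centered.
rewrite /lap; under eq_bigr do rewrite FE (centered_step _ _ F0) FE.
rewrite -(pair_big predT predT
  (fun i b => F (centered z + dir_vec (i, b)) - F (centered z))) /=.
apply: eq_bigr => i _; rewrite big_bool /= /F !sqnorm_step /= sqnorm_centered.
rewrite expr0 expr1 mul1r mulN1r mxE /abs_coord.
have := abs_coord_sqr_le z i; rewrite /abs_coord.
move: (centered1 _) (radius2 z) => t q le_t.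
have [[-> ->]|[-> ->]] :
    (absz (q%:Z + 2 * t + 1) = (q.+1 + 2 * absz t)%N /\
      absz (q%:Z + 2 * - t + 1) = (q.+1 - 2 * absz t)%N) \/
    (absz (q%:Z + 2 * t + 1) = (q.+1 - 2 * absz t)%N /\
      absz (q%:Z + 2 * - t + 1) = (q.+1 + 2 * absz t)%N).
- have le2 : (2 * `|t| <= q.+1)%N by nia.
  by clear -le2; lia.
- ring.
- ring.
Qed.

(** ** Paths *)

Lemma walk_to (x : site) : exists2 p : seq (direction d),
  proj x = \sum_(u <- p) step u & size p = (\sum_i `|x 0%R i|)%N.
Proof.
exists (flatten [seq nseq `|x 0%R i|%N (i, x 0 i < 0) | i : 'I_d]).
  rewrite big_flatten big_map big_enum /= [x in LHS]row_sum_delta proj_sum.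
  apply: eq_bigr => i _.
  rewrite big_nseq iter_addr_0 /step /proj -raddfMn /= /dir_vec /= scalerMnl.
  congr (map_mx _ (_ *: _)); rewrite {1}[x 0 i]intEsign.
  by rewrite -mulr_natr natz.
rewrite size_flatten /shape -map_comp sumnE big_map big_enum /=.
by apply: eq_bigr => i _; rewrite size_nseq.
Qed.

Lemma walk_to_coord (z : torus) : exists2 p : seq (direction d),
  z = \sum_(u <- p) step u & size p = (\sum_i abs_coord z i)%N.
Proof.
have [p pE sp] := walk_to (centered z); exists p; first by rewrite -pE proj_centered.
by rewrite sp; apply: eq_bigr => i _; rewrite mxE.
Qed.

Lemma cube_walks (L : nat) : (L <= m.+1)%N ->
  exists y : {ffun 'I_d -> 'I_L} -> torus, injective y /\
    forall a, exists2 p : seq (direction d),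
      y a = \sum_(u <- p) step u & (size p <= d * L)%N.
Proof.
move=> le_L; pose x (a : {ffun 'I_d -> 'I_L}) : site := \row_i (a i)%:Z.
exists (fun a => proj (x a)); split=> [a b|a].
  have x_le e i : (`|(x e) 0%R i| <= m.+1)%N.
    by rewrite mxE; apply: leq_trans le_L; apply: ltnW (ltn_ord _).
  move=> /(congr1 centered); rewrite !centered_proj // => /matrixP xab.
  by apply/ffunP => i; apply/val_inj; have := xab 0 i; rewrite !mxE => -[].
have [p pE sp] := walk_to (x a); exists p => //; rewrite sp.
have -> : (d * L = \sum_(i < d) L)%N by rewrite sum_nat_const card_ord.
by apply: leq_sum => i _; rewrite mxE; apply: ltnW (ltn_ord _).
Qed.

(** ** Counting lattice points *)

Lemma card_box_le (b : nat) :
  (#|[set z : torus | [forall i, (abs_coord z i <= b)%N]]| <= (2 * b).+1 ^ d)%N.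
Proof.
pose f (z : torus) : {ffun 'I_d -> 'I_(2 * b).+1} :=
  [ffun i => inord (absz (centered1 (z 0 i) + b%:Z)%R)].
rewrite -[X in (_ <= X ^ _)%N]card_ord -[X in (_ <= _ ^ X)%N]card_ord -card_ffun.
apply: (@leq_card_in _ _ f) => z1 z2; rewrite !inE.
move=> /forallP z1_le /forallP z2_le /ffunP eq_f.
apply: centered_inj; apply/matrixP => i0 i; rewrite (ord1 i0) !mxE.
have := congr1 val (eq_f i); rewrite !ffunE /=.
have := z1_le i; have := z2_le i; rewrite /abs_coord.
move: (centered1 _) (centered1 _) => s t le_s le_t.
by rewrite !inordK; lia.
Qed.

Lemma card_box_ge (b : nat) : (b <= m.+1)%N ->
  ((2 * b).+1 ^ d <= #|[set z : torus | [forall i, (abs_coord z i <= b)%N]]|)%N.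
Proof.
move=> le_b; pose x (a : {ffun 'I_d -> 'I_(2 * b).+1}) : site :=
  \row_i ((a i)%:Z - b%:Z).
have x_le a i : (`|(x a) 0%R i| <= b)%N.
  by rewrite mxE; have := ltn_ord (a i); lia.
have projK a : centered (proj (x a)) = x a.
  by apply: centered_proj => i; apply: leq_trans le_b.
rewrite -[X in (X ^ _ <= _)%N]card_ord -[X in (_ ^ X <= _)%N]card_ord -card_ffun.
have inj : injective (fun a => proj (x a)).
  move=> a1 a2 /(congr1 centered); rewrite !projK => /matrixP eq_x.
  apply/ffunP => i; apply/val_inj; have := eq_x 0 i; rewrite !mxE /=; lia.
rewrite -(card_imset _ inj); apply: subset_leq_card; apply/fintype.subsetP => z.
case/imsetP => a _ ->; rewrite inE; apply/forallP => i.
have := congr1 (fun y : site => y 0 i) (projK a); rewrite /abs_coord [LHS]mxE => ->.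
exact: x_le.
Qed.

End Torus.

(** A thin spherical shell contains few points: once all but one coordinate are
fixed, the square of the last one ranges over an interval of length [g ^ 2],
which leaves at most [g + 1] absolute values. *)
Lemma card_shell_le m d b g s t :
  (t <= s + g ^ 2)%N -> (t < b.+1 ^ 2)%N ->
  (#|[set z : 'rV['I_(m.*2.+3)]_d.+1 | s < radius2 z <= t]|
     <= (2 * b).+1 ^ d * (2 * g.+1))%N.
Proof.
move=> le_ts lt_tb; set Sh := [set z | _].
have ex_a (w : nat) : exists a, (s < a ^ 2 + w)%N by exists s.+1; nia.
pose low w := ex_minn (ex_a w).
pose w (z : 'rV['I_(m.*2.+3)]_d.+1) : nat :=
  (\sum_(i < d) abs_coord z (lift ord0 i) ^ 2)%N.
have radE z : radius2 z = (abs_coord z ord0 ^ 2 + w z)%N.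
  by rewrite /radius2 big_ord_recl.
pose f (z : 'rV['I_(m.*2.+3)]_d.+1) :
    ({ffun 'I_d -> 'I_(2 * b).+1} * (bool * 'I_g.+1))%type :=
  ([ffun i => inord (absz (centered1 (z 0 (lift ord0 i)) + b%:Z)%R)],
   (centered1 (z 0 ord0) < 0, inord (abs_coord z ord0 - low (w z)))).
have card_target : #|{: {ffun 'I_d -> 'I_(2 * b).+1} * (bool * 'I_g.+1)}|
    = ((2 * b).+1 ^ d * (2 * g.+1))%N.
  by rewrite !card_prod card_ffun !card_ord card_bool.
rewrite -card_target; apply: (@leq_card_in _ _ f).
have inSh z : z \in Sh -> [/\ forall i, (abs_coord z i <= b)%N,
    (low (w z) <= abs_coord z ord0)%N & (abs_coord z ord0 - low (w z) < g.+1)%N].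
  rewrite inE => /andP[gt_s le_t]; split.
  - move=> i; have := abs_coord_sqr_le z i; move: (abs_coord z i) => a le_a.
    have : (a ^ 2 < b.+1 ^ 2)%N by apply: leq_ltn_trans lt_tb; apply: leq_trans le_t.
    by rewrite ltn_exp2r.
  - by rewrite /low; case: ex_minnP => a _; apply; rewrite -radE.
  - rewrite /low; case: ex_minnP => a gt_a _; rewrite ltnNge; apply/negP => ge_g.
    by move: le_t gt_a ge_g; rewrite radE; move: (abs_coord _ _) (w z) => p q; nia.
move=> z1 z2 /inSh[b1 l1 g1] /inSh[b2 l2 g2] [/ffunP eq1 eq2 eq3].
have eq_other i : centered1 (z1 0 (lift ord0 i)) = centered1 (z2 0 (lift ord0 i)).
  have := congr1 val (eq1 i); rewrite !ffunE /=.
  have := b1 (lift ord0 i); have := b2 (lift ord0 i); rewrite /abs_coord.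
  move: (centered1 _) (centered1 _) => p q le_p le_q.
  by rewrite !inordK; lia.
have eq_w : w z1 = w z2.
  by apply: eq_bigr => i _; rewrite /abs_coord eq_other.
apply: centered_inj; apply/matrixP => i0 i; rewrite (ord1 i0) !mxE.
case: (unliftP ord0 i) => [j|] ->; first exact: eq_other.
have := congr1 val eq3; rewrite /= !inordK // -eq_w.
rewrite -eq_w in l2; move: l1 l2 eq2; rewrite /abs_coord.
by move: (centered1 _) (centered1 _) (low _) => p q r; lia.
Qed.

(** * The profile as a test function *)

Section Comparison.

Context {R : realType}.
Variables (m d J I : nat) (del : R).
Hypotheses (d_gt0 : (0 < d)%N) (I_gt0 : (0 < I)%N) (le_IJ : (2 * I <= J)%N)
  (le_Jm : (J <= m.+1 ^ 2)%N) (del_gt0 : 0 < del)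
  (del_small : 2 * (d%:R + 1) * del <= 1) (I_large : 4 <= del ^+ 2 * I%:R).
Local Notation torus := 'rV['I_(m.*2.+3)]_d.
Implicit Types z : torus.

Let step := @step m d.

Definition ball_profile z : R := profile d J I (radius2 z).

(** The source is cut out near the origin so that the sink is at least [1] there;
taking a positive part keeps the source a positive measure. *)
Definition ball_source z : R :=
  if (radius2 z <= 2 * I)%N then Num.max 0 (1 - lap step ball_profile z) else 0.

Definition ball_sink z : R := lap step ball_profile z + ball_source z.

Definition sink_error : R := 2 * (d%:R + 1) * del * growth d J I.

Let I_leJ : (I <= J)%N.
Proof. by apply: leq_trans le_IJ; rewrite leq_pmull. Qed.

Let lapE z : lap step ball_profile z = radial_lap J I (radius2 z) (abs_coord z).
Proof. by apply: lap_radial le_Jm _ => q; apply: profile_far. Qed.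

Lemma sink_error_ge0 : 0 <= sink_error.
Proof.
by rewrite !mulr_ge0 ?addr_ge0 ?(ltW del_gt0) ?(ltW (growth_gt0 _ _ _)).
Qed.

Lemma ball_source_ge0 z : 0 <= ball_source z.
Proof. by rewrite /ball_source; case: ifP => // _; rewrite le_max lexx. Qed.

Lemma ball_sink_le z : ball_sink z <= 1 + sink_error.
Proof.
have le1 : lap step ball_profile z <= 1 + sink_error.
  by rewrite lapE; apply: radial_lap_le1.
have := sink_error_ge0.
rewrite /ball_sink /ball_source; case: ifP => _; last by rewrite addr0.
by move: (lap _ _ _) le1 => L le1; rewrite maxEge; case: ifP => _; lra.
Qed.

Let ball_sink_near z : (radius2 z <= 2 * I)%N -> 1 <= ball_sink z.
Proof.
rewrite /ball_sink /ball_source => ->; rewrite -lerBlDl.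
by rewrite le_max lexx orbT.
Qed.

Lemma ball_sink_ge z : (1 + del) * (radius2 z)%:R <= J%:R ->
  1 - sink_error <= ball_sink z.
Proof.
move=> le_J; have e0 := sink_error_ge0.
have [near|far] := leqP (radius2 z) (2 * I).
  by have := ball_sink_near near; lra.
have := radial_lap_ge1 d_gt0 I_gt0 I_leJ del_gt0 del_small I_large
  (erefl (radius2 z)) (ltnW far) le_J.
rewrite -lapE /ball_sink /ball_source leqNgt far addr0.
rewrite /sink_error in e0 *; lra.
Qed.

Hypothesis sink_error_le1 : sink_error <= 1.

Lemma ball_sink_geN1 z : -1 <= ball_sink z.
Proof.
have e1 := sink_error_le1.
have [le_J|lt_J] := lerP ((1 + del) * (radius2 z)%:R) J%:R.
  by have := ball_sink_ge le_J; lra.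
have [near|far] := leqP (radius2 z) (2 * I).
  by have := ball_sink_near near; lra.
have le_Iq : (I <= radius2 z)%N.
  by apply: ltnW; apply: leq_ltn_trans far; rewrite leq_pmull.
have := radial_lap_geN1 d_gt0 I_gt0 I_leJ del_gt0 del_small I_large
  (erefl (radius2 z)) le_Iq (ltW lt_J).
by rewrite -lapE /ball_sink /ball_source leqNgt far addr0.
Qed.

Lemma ball_sink_eq0 z : J%:R <= (1 - del) * (radius2 z)%:R -> ball_sink z = 0.
Proof.
move=> le_J; have q0 : 0 <= (radius2 z)%:R :> R by [].
have J0 : 0 < J%:R :> R by rewrite ltr0n (leq_trans I_gt0 I_leJ).
have lt_Jq : (J < radius2 z)%N.
  rewrite -(ltr_nat R); apply: (le_lt_trans le_J).
  rewrite -subr_gt0 -[X in X - _]mul1r -mulrBl opprB addrC subrK mulr_gt0 //.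
  rewrite lt_def q0 andbT; apply/eqP => eq0; move: le_J; rewrite eq0 mulr0; lra.
have far : (2 * I < radius2 z)%N by apply: leq_ltn_trans lt_Jq.
have le_Iq : (I <= radius2 z)%N by apply: leq_trans I_leJ (ltnW lt_Jq).
rewrite /ball_sink /ball_source leqNgt far addr0 lapE.
exact: (radial_lap_eq0 d_gt0 del_gt0 del_small I_large (erefl (radius2 z)) le_Iq).
Qed.

Lemma sum_ball_sink : \sum_z ball_sink z = \sum_z ball_source z.
Proof.
by rewrite big_split /= (sum_lap (@opp_dirK d) (@stepN m d)) add0r.
Qed.

Lemma ball_source_walk (l : nat) z : (d * (2 * I) < l.+1 ^ 2)%N ->
  ball_source z != 0 ->
  exists2 p : seq (direction d), z = \sum_(u <- p) step u & (size p <= l)%N.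
Proof.
move=> lt_l; rewrite /ball_source; case: ifP => [near _|_]; last by rewrite eqxx.
have [p zE sp] := walk_to_coord z; exists p => //; rewrite sp.
rewrite -ltnS -(@ltn_exp2r _ _ 2) //; apply: leq_ltn_trans lt_l.
have /= := @cauchy_schwarz R 'I_d (fun=> 1) (fun i => (abs_coord z i)%:R).
under eq_bigr do rewrite mul1r.
under [X in _ <= X * _]eq_bigr do rewrite expr1n.
rewrite -natr_sum -natrX sumr_const card_ord.
under [X in _ <= _ * X]eq_bigr do rewrite -natrX.
rewrite -natr_sum -natrM ler_nat => le1; apply: leq_trans le1 _.
by rewrite leq_mul2l near orbT.
Qed.

(** The comparison principle applied to the profile, rescaled by [lam] so that
its source has exactly the mass of the aggregate and its sink is at most [1]. *)
Lemma ball_comparison (A : {set torus}) (v : torus -> R)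
    (r : torus -> direction d -> R) (k l : nat) (lam : R) :
  (0 < #|A|)%N ->
  (forall z, 0 <= v z) -> (forall z, z \notin A -> v z = 0) ->
  (forall z u, `|r z u| <= 1) ->
  (forall h, \sum_(z in A) h z - #|A|%:R * h 0 =
     \sum_z v z * lap step h z
     + \sum_(z in A) \sum_u r z u * (h (z + step u) - h z)) ->
  (d * (2 * I) < l.+1 ^ 2)%N -> (2 ^ k <= m.+1)%N ->
  (1 + sink_error) * #|A|%:R <= \sum_z ball_sink z ->
  lam = #|A|%:R / \sum_z ball_sink z ->
  lam * (\sum_(z in ~: A) ball_profile z) <=
    lam * (\sum_z ball_profile z * (1 - lam * ball_sink z))
    + #|A|%:R * (4 * d%:R
      + 4 * #|A|%:R * l%:R ^+ 2 * (2 ^+ k ^+ d)^-1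
      + 16 * d%:R ^+ 2 * 2 ^+ d * 4 ^+ k).
Proof.
move=> A_gt0 v_ge0 v_supp r_le1 flow lt_l le_k le_mass lamE.
set n : R := #|A|%:R in flow le_mass lamE *.
have n_gt0 : 0 < n by rewrite ltr0n.
have e0 := sink_error_ge0.
set M := \sum_z ball_sink z in le_mass lamE.
have M_gt0 : 0 < M by apply: lt_le_trans le_mass; rewrite mulr_gt0 //; lra.
have lam_gt0 : 0 < lam by rewrite lamE divr_gt0.
have lam_le : lam * (1 + sink_error) <= 1.
  by rewrite lamE mulrAC ler_pdivrMr // mul1r mulrC.
have lam_le1 : lam <= 1.
  by have := mulr_ge0 (ltW lam_gt0) e0; lra.
have D_gt0 : (0 < #|direction d|)%N by rewrite card_direction muln_gt0.
pose T := (8 * #|direction d| * d ^ 2 * 2 ^ d * 4 ^ k)%N.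
have heat : heat_norm2 (R := R) step T <= 2 * (2 ^+ k ^+ d)^-1.
  apply: (heat_norm2_dyadic (@opp_dirK d) (@stepN m d) D_gt0 d_gt0) => j le_j.
  by apply: cube_walks; apply: leq_trans le_k; rewrite leq_pexp2l.
have w_ge0 z : 0 <= lam * ball_profile z.
  by apply: mulr_ge0 (ltW lam_gt0) _; apply: profile_ge0.
have lapw z : lap step (fun y => lam * ball_profile y) z =
    lam * ball_sink z - lam * ball_source z.
  by rewrite lapZ /ball_sink; ring.
have s_le z : -1 <= lam * ball_sink z <= 1.
  have := ball_sink_le z; have := ball_sink_geN1 z.
  by move: (ball_sink z) lam_le lam_le1 lam_gt0 => s *; apply/andP; split; nra.
have f_ge0 z : 0 <= lam * ball_source z.
  by apply: mulr_ge0 (ltW lam_gt0) _; apply: ball_source_ge0.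
have sum_f : \sum_z lam * ball_source z = n.
  by rewrite -mulr_sumr -sum_ball_sink -/M lamE divfK // gt_eqF.
have f_supp z : lam * ball_source z != 0 ->
    exists2 p : seq (direction d), z = \sum_(u <- p) step u & (size p <= l)%N.
  by rewrite mulf_eq0 negb_or => /andP[_]; apply: ball_source_walk.
have := energy_comparison (@opp_dirK d) (@stepN m d) D_gt0 T A_gt0 v_ge0 v_supp
  r_le1 flow w_ge0 lapw s_le f_ge0 sum_f f_supp.
rewrite -mulr_sumr -/n => le1; apply: le_trans le1 _.
have -> : \sum_z lam * ball_profile z * (1 - lam * ball_sink z) =
    lam * \sum_z ball_profile z * (1 - lam * ball_sink z).
  by rewrite mulr_sumr; apply: eq_bigr => z _; rewrite mulrA.
rewrite -!addrA lerD2l.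
have cE : #|direction d|%:R = 2 * d%:R :> R by rewrite card_direction natrM.
have d0 : d%:R != 0 :> R by rewrite pnatr_eq0 -lt0n.
have -> : T%:R / #|direction d|%:R = 8 * d%:R ^+ 2 * 2 ^+ d * 4 ^+ k :> R.
  rewrite /T !natrM !natrX cE; move: (2 ^+ d) (4 ^+ k) => x y.
  by field.
rewrite cE.
have le2 : 2 * n ^+ 2 * l%:R ^+ 2 * heat_norm2 (R := R) step T <=
    2 * n ^+ 2 * l%:R ^+ 2 * (2 * (2 ^+ k ^+ d)^-1).
  by apply: ler_wpM2l heat; rewrite !mulr_ge0 ?sqr_ge0.
move: (heat_norm2 _ _) le2 => a le2.
move: (_^-1) (2 ^+ d) (4 ^+ k) le2 => x y t le2.
nra.
Qed.

End Comparison.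

(** * Filling the ball *)

(** ** The odometer on the torus *)

Section Transfer.

Context {R : realType}.
Variables (m d : nat) (s : seq 'rV[int]_d).
Hypotheses (s_uniq : uniq s)
  (s_box : forall (x : 'rV[int]_d) i, x \in s -> (`|x 0%R i| <= m.+1)%N).
Local Notation torus := 'rV['I_(m.*2.+3)]_d.

Definition torus_set : {set torus} := [set z | centered z \in s].

Let centered_projS x : x \in s -> centered (proj m x) = x.
Proof. by move=> xs; apply: centered_proj => i; apply: s_box. Qed.

Let perm_s : perm_eq s (map (@centered m d) (enum torus_set)).
Proof.
apply: uniq_perm => // [|x].
  by rewrite map_inj_uniq ?enum_uniq //; apply: centered_inj.
apply/idP/mapP => [xs|[z]]; last by rewrite mem_enum inE => zs ->.
by exists (proj m x); rewrite ?mem_enum ?inE centered_projS.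
Qed.

Lemma card_torus_set : #|torus_set| = size s.
Proof. by rewrite (perm_size perm_s) size_map -cardE. Qed.

Lemma sum_torus_set (F : 'rV[int]_d -> R) :
  \sum_(x <- s) F x = \sum_(z in torus_set) F (centered z).
Proof. by rewrite (perm_big _ perm_s) /= big_map big_enum. Qed.

(** A function on the torus pulls back to the lattice, where it is a legitimate
test function for the balance of jumps. *)
Lemma torus_flow (c : {perm direction d}) (rho0 : rotor_config d)
    (k : 'rV[int]_d -> nat) :
  (forall f, \sum_(x <- s) f x = (size s)%:R * f 0 + jumps c rho0 s k f :> R) ->
  exists (v : torus -> R) (r : torus -> direction d -> R),
  [/\ forall z, 0 <= v z, forall z, z \notin torus_set -> v z = 0 &
    cyclic_ordering c -> forall z u, `|r z u| <= 1] /\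
  forall h, \sum_(z in torus_set) h z - #|torus_set|%:R * h 0 =
     \sum_z v z * lap (@step m d) h z
     + \sum_(z in torus_set) \sum_u r z u * (h (z + step m u) - h z).
Proof.
move=> balance.
exists (fun z => if z \in torus_set then
  (k (centered z))%:R / #|direction d|%:R else 0).
exists (fun z u => excess c rho0 k (centered z) u); split; [split|].
- by move=> z; case: ifP => // _; rewrite divr_ge0.
- by move=> z /negPf ->.
- by move=> c_cyclic z u; apply: excess_le1.
move=> h; pose f x := h (proj m x).
have f_step x u : f (x + dir_vec u) = h (proj m x + step m u).
  by rewrite /f projD.
have f_cent z : f (centered z) = h z by rewrite /f proj_centered.
have f_0 : f 0 = h 0 by rewrite /f /proj map_mx0.
have := balance f; rewrite jumpsE !sum_torus_set f_0 -card_torus_set.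
under eq_bigr do rewrite f_cent.
move=> ->; rewrite addrAC subrr add0r; congr (_ + _); last first.
  apply: eq_bigr => z _; apply: eq_bigr => u _.
  by rewrite f_step f_cent proj_centered.
rewrite big_mkcond /=; apply: eq_bigr => z _; case: ifP => _; last by rewrite mul0r.
congr (_ * _); apply: eq_bigr => u _.
by rewrite f_step f_cent proj_centered.
Qed.

End Transfer.

(** ** Regularity of the counting function *)

Section Counting.

Context {R : realType}.
Variables (m d B J : nat).
Hypotheses (B_gt0 : (0 < B)%N) (le_BJ : (B ^ 2 <= J)%N) (lt_JB : (J < B.+1 ^ 2)%N)
  (le_Bm : (B <= m.+1)%N).
Local Notation torus d := 'rV['I_(m.*2.+3)]_d.

Definition ball_set d' J' : {set torus d'} := [set z | (radius2 z <= J')%N].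

Lemma card_ball_le : (#|ball_set d J| <= (2 * B).+1 ^ d)%N.
Proof.
apply: leq_trans (card_box_le m d B); apply: subset_leq_card.
apply/fintype.subsetP => z; rewrite !inE => le_J; apply/forallP => i.
rewrite -ltnS -(@ltn_exp2r _ _ 2) //; apply: leq_ltn_trans lt_JB.
by apply: leq_trans le_J; apply: abs_coord_sqr_le.
Qed.

Lemma card_ball_ge : (0 < d)%N -> (B ^ d <= d ^ d * #|ball_set d J|)%N.
Proof.
move=> d_gt0; set b := (B %/ d)%N.
have b_le : (b * d <= B)%N by apply: leq_trunc_div.
have b_ge : (B < b.+1 * d)%N by apply: ltn_ceil.
apply: (@leq_trans (d ^ d * (2 * b).+1 ^ d)).
  rewrite -expnMn leq_exp2r //; nia.
rewrite leq_mul2l; apply/orP; right.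
have le_bm : (b <= m.+1)%N by apply: leq_trans le_Bm; apply: leq_div.
apply: leq_trans (card_box_ge d le_bm) _; apply: subset_leq_card.
apply/fintype.subsetP => z; rewrite !inE => /forallP le_b.
apply: leq_trans le_BJ; apply: (@leq_trans (\sum_(i < d) b ^ 2)).
  by apply: leq_sum => i _; rewrite leq_exp2r.
rewrite sum_nat_const card_ord; nia.
Qed.

Definition shell_ratio (d' h : nat) : R :=
  (7 * d'.+1)%:R ^+ d'.+1 * (8 / h%:R + 8 / B%:R).

End Counting.

(** The square root in [card_shell_le] turns a relative width of order [1 / h ^ 2]
into a fraction of order [1 / h] of the ball. *)
Lemma card_shell_ratio {R : realType} m d B J h s t :
  (0 < B)%N -> (B ^ 2 <= J)%N -> (J < B.+1 ^ 2)%N -> (B <= m.+1)%N -> (0 < h)%N ->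
  (h ^ 2 * t <= h ^ 2 * s + 16 * B ^ 2 + 4 * h ^ 2)%N -> (t <= 2 * J)%N ->
  #|[set z : 'rV['I_(m.*2.+3)]_d.+1 | (s < radius2 z <= t)%N]|%:R
    <= shell_ratio B d h * #|ball_set m d.+1 J|%:R :> R.
Proof.
move=> B_gt0 le_BJ lt_JB le_Bm h_gt0 le_ts le_tJ.
set g := ((4 * B) %/ h + 3)%N.
have g_ge : (4 * B + 2 * h <= h * g)%N.
  have := ltn_ceil (4 * B) h_gt0; rewrite /g; nia.
have le_g : (t <= s + g ^ 2)%N.
  have h2 : (0 < h ^ 2)%N by rewrite expn_gt0 h_gt0.
  rewrite -(leq_pmul2l h2) mulnDr -expnMn; nia.
have lt_b : (t < (2 * B).+2 ^ 2)%N by move: le_tJ lt_JB; clear; nia.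
have le1 := card_shell_le m d le_g lt_b.
have le2 := card_ball_ge B_gt0 le_BJ lt_JB le_Bm (ltn0Sn d).
apply: (@le_trans _ _ ((7 * B) ^ d * (2 * g.+1))%N%:R).
  rewrite ler_nat; apply: leq_trans le1 _.
  rewrite leq_mul2r; apply/orP; right.
  have : ((2 * (2 * B).+1).+1 <= 7 * B)%N by lia.
  by case: (d) => // e; rewrite leq_exp2r.
have B0 : 0 < B%:R :> R by rewrite ltr0n.
have h0 : 0 < h%:R :> R by rewrite ltr0n.
have le3 : (2 * g.+1)%:R <= B%:R * (8 / h%:R + 8 / B%:R) :> R.
  have : ((4 * B) %/ h)%:R <= 4 * B%:R / h%:R :> R.
    by rewrite ler_pdivlMr // -!natrM ler_nat leq_trunc_div.
  rewrite /g -addn1 natrM !natrD mulrDr => le3.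
  have -> : B%:R * (8 / B%:R) = 8 :> R by field; rewrite gt_eqF.
  have -> : B%:R * (8 / h%:R) = 2 * (4 * B%:R / h%:R) :> R by field; rewrite gt_eqF.
  lra.
rewrite natrM; apply: (le_trans (ler_wpM2l _ le3)) => //.
rewrite /shell_ratio mulrA -[leRHS]mulrA [X in _ <= _ * X]mulrC [leRHS]mulrA.
apply: ler_wpM2r; first by rewrite addr_ge0 // divr_ge0.
rewrite -natrX -!natrM ler_nat.
apply: (@leq_trans (7 ^ d.+1 * (d.+1 ^ d.+1 * #|ball_set m d.+1 J|))).
  apply: (@leq_trans (7 ^ d.+1 * B ^ d.+1)); last by rewrite leq_mul2l le2 orbT.
  by rewrite expnMn -mulnA -expnSr leq_mul2r leq_pexp2l ?orbT.
by rewrite mulnA -expnMn.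
Qed.

(** ** One scale *)

Lemma sum_indicator (R : pzSemiRingType) (T : finType) (S : {set T}) :
  \sum_x (x \in S)%:R = #|S|%:R :> R.
Proof. by rewrite -sum1_card natr_sum [RHS]big_mkcond; apply: eq_bigr => x _; case: ifP. Qed.

Lemma exists_sqrt N : exists l, (l ^ 2 <= N < l.+1 ^ 2)%N.
Proof.
have ex_l : exists l, (N < l.+1 ^ 2)%N by exists N; nia.
exists (ex_minn ex_l); case: ex_minnP => l lt_N min_l; rewrite lt_N andbT.
case: l min_l {lt_N} => // l min_l; rewrite leqNgt; apply/negP => /min_l.
by rewrite ltnn.
Qed.

(** [J] is the squared radius of the profile and [B] its integer square root,
[J %/ mI] the squared radius of the source, [1 / h ^ 2] the relative width of the
windows in which the profile is evaluated, and [2 ^ k] the smoothing length, a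
fraction [1 / 2 ^ p] of [B]. The ball exceeds the aggregate by a factor
[1 + gam], which leaves room for scaling the sink below [1]. *)
Section OneScale.

Context {R : realType}.
Variables (m d0 B J h mI p k : nat) (gam : R).
Local Notation d := d0.+1.
Local Notation I := (J %/ mI)%N.
Local Notation torus := 'rV['I_(m.*2.+3)]_d.
Let del : R := (h%:R ^+ 2)^-1.
Local Notation e := (sink_error d J I del).
Local Notation g := (growth d J I : R).
Hypotheses (B_gt0 : (0 < B)%N) (le_BJ : (B ^ 2 <= J)%N) (lt_JB : (J < B.+1 ^ 2)%N)
  (le_Bm : (B <= m)%N) (h_large : (2 * d.+1 <= h ^ 2)%N)
  (mI_ge2 : (2 <= mI)%N) (I_large : (4 * h ^ 4 <= I)%N)
  (gam_gt0 : 0 < gam) (gam_le1 : gam <= 1) (e_le : e <= gam / 8)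
  (shell_le : shell_ratio B d0 h <= gam / 32)
  (k_le : (2 ^ k * 2 ^ p <= B)%N) (k_ge : (B < 2 * 2 ^ k * 2 ^ p)%N).
Variables (A : {set torus}) (v : torus -> R) (r : torus -> direction d -> R).
Local Notation n := (#|A|%:R : R).
Hypotheses (A_gt0 : (0 < #|A|)%N)
  (v_ge0 : forall z, 0 <= v z) (v_supp : forall z, z \notin A -> v z = 0)
  (r_le1 : forall z u, `|r z u| <= 1)
  (flow : forall f, \sum_(z in A) f z - n * f 0 =
     \sum_z v z * lap (@step m d) f z
     + \sum_(z in A) \sum_u r z u * (f (z + step m u) - f z)).
Local Notation V := (#|ball_set m d J|%:R : R).
Hypotheses (V_ge : (1 + gam) * n <= V)
  (V_min : #|[set z : torus | (radius2 z < J)%N]|%:R <= (1 + gam) * n).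

Let h_gt1 : (1 < h)%N. Proof. by rewrite -(@ltn_exp2r _ _ 2) //; apply: leq_trans h_large. Qed.
Let h2_gt0 : 0 < h%:R ^+ 2 :> R.
Proof. by rewrite exprn_gt0 // ltr0n; apply: ltnW. Qed.
Let del_gt0 : 0 < del. Proof. by rewrite invr_gt0. Qed.
Let h2_del : h%:R ^+ 2 * del = 1. Proof. by rewrite divff // gt_eqF. Qed.
Let del_small : 2 * (d%:R + 1) * del <= 1.
Proof.
have : (2 * d.+1)%:R <= h%:R ^+ 2 :> R by rewrite -natrX ler_nat.
rewrite natrM -[d.+1%:R]natr1 => le1; rewrite -[leRHS]h2_del.
by apply: ler_wpM2r => //; apply: ltW.
Qed.
Let I_large' : 4 <= del ^+ 2 * I%:R.
Proof.
have : (4 * h ^ 4)%:R <= I%:R :> R by rewrite ler_nat.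
rewrite natrM natrX => le1.
have d2 : 0 <= del ^+ 2 by apply: sqr_ge0.
have := ler_wpM2l d2 le1.
have -> : del ^+ 2 * (4 * h%:R ^+ 4) = 4 * (h%:R ^+ 2 * del) ^+ 2 by ring.
by rewrite h2_del expr1n mulr1.
Qed.
Let I_gt0 : (0 < I)%N.
Proof. by apply: leq_trans I_large; rewrite muln_gt0 expn_gt0 (ltnW h_gt1). Qed.
Let le_IJ : (2 * I <= J)%N.
Proof.
apply: leq_trans (leq_trunc_div J mI); by rewrite mulnC leq_mul2l mI_ge2 orbT.
Qed.
Let I_leJ : (I <= J)%N. Proof. exact: leq_div. Qed.
Let J_gt0 : (0 < J)%N. Proof. exact: leq_trans I_gt0 I_leJ. Qed.
Let le_Jm : (J <= m.+1 ^ 2)%N.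
Proof. by apply: leq_trans (ltnW lt_JB) _; rewrite leq_exp2r. Qed.
Let n_gt0 : 0 < n. Proof. by rewrite ltr0n. Qed.
Let e_ge0 : 0 <= e. Proof. exact: (sink_error_ge0 _ _ _ del_gt0). Qed.
Let e_le1 : e <= 1.
Proof. by have := e_le; have := gam_le1; lra. Qed.

Let S : {set torus} :=
  [set z | (h ^ 2 * J %/ (h ^ 2).+1 < radius2 z <= h ^ 2 * J %/ (h ^ 2).-1)%N].

Let inS (z : torus) : J%:R < (1 + del) * (radius2 z)%:R ->
  (1 - del) * (radius2 z)%:R < J%:R -> z \in S.
Proof.
have h2 : (1 < h ^ 2)%N by rewrite -(exp1n 2) ltn_exp2r.
rewrite -[_ < (1 + del) * _](ltr_pM2l h2_gt0) -[(1 - del) * _ < _](ltr_pM2l h2_gt0).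
rewrite !mulrA.
rewrite mulrDr mulrBr h2_del mulr1 inE; set q := radius2 z.
have -> : h%:R ^+ 2 + 1 = (h ^ 2).+1%:R :> R by rewrite -natr1 natrX.
have -> : h%:R ^+ 2 - 1 = (h ^ 2).-1%:R :> R.
  by rewrite -natrX -[in LHS](prednK (ltnW h2)) -natr1 addrK.
rewrite -natrX -!natrM !ltr_nat => lt1 lt2.
rewrite ltn_divLR // [(q * _)%N]mulnC lt1 /= leq_divRL; last by rewrite -subn1 subn_gt0.
by rewrite mulnC ltnW.
Qed.

Let card_S : #|S|%:R <= gam / 32 * V.
Proof.
have h2 : (1 < h ^ 2)%N by rewrite -(exp1n 2) ltn_exp2r.
have h2p : (0 < (h ^ 2).-1)%N by rewrite -subn1 subn_gt0.
rewrite /S; set s := (_ %/ (h ^ 2).+1)%N; set t := (_ %/ (h ^ 2).-1)%N.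
have t_le : (t * (h ^ 2).-1 <= h ^ 2 * J)%N by apply: leq_trunc_div.
have s_ge : (h ^ 2 * J < s.+1 * (h ^ 2).+1)%N by apply: ltn_ceil.
have s_le : (s * (h ^ 2).+1 <= h ^ 2 * J)%N by apply: leq_trunc_div.
apply: (@le_trans _ _ (shell_ratio B d0 h * V)); last by apply: ler_wpM2r.
apply: (@card_shell_ratio R m d0 B J h s t) => //.
- exact: leqW.
- exact: ltnW.
- have le_B : (J <= 4 * B ^ 2)%N by clear -lt_JB B_gt0; nia.
  have hE := prednK (ltnW h2); move: t_le s_ge s_le le_B h2p; rewrite -hE /=.
  by move: (h ^ 2).-1 s t (B ^ 2)%N => H s' t' b; clear; nia.
- move: t_le; have : (3 < h ^ 2)%N by clear -h_large; lia.
  by move: (h ^ 2)%N t => H t'; clear; nia.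
Qed.

Let V_le : V <= (1 + gam) * n + #|S|%:R.
Proof.
apply: le_trans (lerD V_min (lexx _)); rewrite -natrD ler_nat.
apply: leq_trans (leq_card_setU _ _); apply: subset_leq_card.
apply/fintype.subsetP => z; rewrite !inE leq_eqVlt => /orP[/eqP eqJ|->] //.
apply/orP; right; have := @inS z; rewrite inE eqJ; apply.
  by rewrite ltr_pMl ?ltr0n // ltrDl.
by rewrite gtr_pMl ?ltr0n // gtrBl.
Qed.

Let V_le4 : V <= 4 * n.
Proof.
have := V_le; have := card_S; have := n_gt0; have := gam_gt0; have := gam_le1.
have : 0 <= V by []. nra.
Qed.

Lemma card_ball_le4 : V <= 4 * n.
Proof. exact: V_le4. Qed.

Let card_S_le : #|S|%:R <= gam / 8 * n.
Proof. have := card_S; have := V_le4; have := gam_gt0; nra. Qed.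

(** The sink approximates the indicator of the ball except on the shell [S], where
only crude bounds are available. *)
Let sink_case (z : torus) :
  (1 - e) * (z \in ball_set m d J)%:R - 2 * (z \in S)%:R <= ball_sink J I z
  <= (1 + e) * ((z \in ball_set m d J)%:R + (z \in S)%:R).
Proof.
have le1 := ball_sink_le (ltn0Sn d0) I_gt0 le_IJ le_Jm del_gt0 del_small I_large' z.
have geN1 := ball_sink_geN1 (ltn0Sn d0) I_gt0 le_IJ le_Jm del_gt0 del_small
  I_large' e_le1 z.
have e0 := e_ge0; have e1 := e_le1.
have [zS|zS] := boolP (z \in S).
  move: (ball_sink J I z) e e0 e1 le1 geN1 => y e' *.
  by case: (z \in ball_set _ _ _) => /=; apply/andP; split; lra.
have J0 : 0 < J%:R :> R by rewrite ltr0n.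
have [zB|zB] := boolP (z \in ball_set m d J).
  rewrite /= addr0 !mulr1 mulr0 subr0 le1 andbT.
  apply: (ball_sink_ge (ltn0Sn d0) I_gt0 le_IJ le_Jm del_gt0 del_small I_large').
  rewrite leNgt; apply/negP => lt_J; move/negP: zS; apply; apply: inS => //.
  have : (radius2 z)%:R <= J%:R :> R by move: zB; rewrite inE ler_nat.
  have q0 : 0 <= (radius2 z)%:R :> R by [].
  have := del_gt0; move: (_%:R) J0 q0 lt_J => Jr J0 q0; move: (radius2 z)%:R q0 => q.
  nra.
rewrite /= addr0 !mulr0 subr0.
rewrite (ball_sink_eq0 (ltn0Sn d0) I_gt0 le_IJ le_Jm del_gt0 del_small I_large') ?lexx //.
rewrite leNgt; apply/negP => lt_J; move/negP: zS; apply; apply: inS => //.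
have : J%:R < (radius2 z)%:R :> R by move: zB; rewrite inE -ltnNge ltr_nat.
have := del_gt0; nra.
Qed.

Let M := \sum_(z : torus) (ball_sink J I z : R).

Let M_bounds : (1 - e) * V - 2 * #|S|%:R <= M <= (1 + e) * (V + #|S|%:R).
Proof.
rewrite -!sum_indicator -big_split /= !mulr_sumr -sumrB; apply/andP; split;
  by apply: ler_sum => z _; case/andP: (sink_case z).
Qed.

Let M_ge : (1 + e) * n <= M.
Proof.
have /andP[M1 _] := M_bounds; apply: le_trans M1.
have h1 := card_S_le; have h2 := V_ge; have h3 := e_le; have h4 := e_ge0.
have h5 := n_gt0; have h6 := gam_gt0; have h7 := gam_le1.
move: e n V (#|S|%:R) h1 h2 h3 h4 h5 => e' n' V' S' h1 h2 h3 h4 h5.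
have h8 : (1 - e') * ((1 + gam) * n') <= (1 - e') * V' by apply: ler_wpM2l; lra.
have h9 : e' * (2 + gam) <= 3 / 8 * gam by nra.
have h10 : 0 <= n' * (3 / 8 * gam - e' * (2 + gam)).
  by apply: mulr_ge0; lra.
have h11 : 0 <= n' * gam by apply: mulr_ge0; lra.
lra.
Qed.

Let M_le : M <= (1 + 2 * gam) * n.
Proof.
have /andP[_ M1] := M_bounds; apply: le_trans M1 _.
have h1 := card_S_le; have h2 := V_le; have h3 := e_le; have h4 := e_ge0.
have h5 := n_gt0; have h6 := gam_gt0; have h7 := gam_le1.
move: e n V (#|S|%:R) h1 h2 h3 h4 h5 => e' n' V' S' h1 h2 h3 h4 h5.
have h8 : V' + S' <= (1 + 5 / 4 * gam) * n' by lra.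
have h9 : (1 + e') * (V' + S') <= (1 + e') * ((1 + 5 / 4 * gam) * n').
  by apply: ler_wpM2l => //; lra.
have h10 : (1 + e') * (1 + 5 / 4 * gam) <= 1 + 2 * gam by nra.
have h11 := ler_wpM2r (ltW h5) h10.
lra.
Qed.

Let lam := n / M.

Let M_gt0 : 0 < M.
Proof.
apply: lt_le_trans M_ge; apply: mulr_gt0 n_gt0.
by rewrite (lt_le_trans ltr01) // lerDl e_ge0.
Qed.

Let lam_bounds : [/\ 0 < lam, lam <= 1, 1 / 3 <= lam & 1 - 2 * gam <= lam].
Proof.
have n0 := n_gt0; have M0 := M_gt0; have M1 := M_ge; have M2 := M_le.
have e0 := e_ge0; have g0 := gam_gt0; have g1 := gam_le1.
rewrite /lam; split.
- by rewrite divr_gt0.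
- by rewrite ler_pdivrMr // mul1r; nra.
- by rewrite ler_pdivlMr //; nra.
- by rewrite ler_pdivlMr //; nra.
Qed.

Let g_ge1 : 1 <= g. Proof. exact: growth_ge1. Qed.

Let profile_error (z : torus) :
  ball_profile J I z * (1 - lam * ball_sink J I z) <=
  (z \in ball_set m d J)%:R * (J%:R * ((2 * gam + e) * g + 2 * del)).
Proof.
have [l0 l1 _ l3] := lam_bounds; have e0 := e_ge0; have e1 := e_le1.
have g1 := g_ge1; have d1 := del_gt0; have gam0 := gam_gt0.
have w0 : 0 <= ball_profile J I z :> R by apply: profile_ge0.
have J0 : 0 <= J%:R :> R by [].
rewrite inE; case: leqP => [le_qJ|lt_Jq] /=; last first.
  by rewrite /ball_profile profile_far ?mul0r // ltnW.
rewrite mul1r.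
have [near|edge] := lerP ((1 + del) * (radius2 z)%:R) J%:R.
  have s1 := ball_sink_ge (ltn0Sn d0) I_gt0 le_IJ le_Jm del_gt0 del_small I_large' near.
  have w1 : ball_profile J I z <= J%:R * g :> R by apply: profile_le.
  have s2 : 1 - lam * ball_sink J I z <= 2 * gam + e.
    by move: (ball_sink J I z) e s1 e0 e1 => y e' *; nra.
  have ge0 : 0 <= 2 * gam + e by lra.
  apply: (@le_trans _ _ (ball_profile J I z * (2 * gam + e))).
    exact: ler_wpM2l.
  apply: (@le_trans _ _ (J%:R * g * (2 * gam + e))); first exact: ler_wpM2r.
  have : 0 <= J%:R * (2 * del) by rewrite mulr_ge0 // mulr_ge0 // ltW.
  by move: (J%:R) g e => J' g' e' *; lra.
have le_Iq : (I <= radius2 z)%N.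
  rewrite leqNgt; apply/negP => lt_q.
  have : 2 * I%:R <= J%:R :> R by rewrite -natrM ler_nat le_IJ.
  have : (radius2 z)%:R < I%:R :> R by rewrite ltr_nat.
  have : del <= 1.
    have : 1 <= d%:R :> R by rewrite ler1n.
    by have := del_small; nra.
  have : 0 <= (radius2 z)%:R :> R by [].
  by move: edge; move: (radius2 z)%:R (I%:R) (J%:R) => q I' J' *; nra.
have w1 : ball_profile J I z <= del * J%:R :> R.
  by apply: profile_edge => //; apply: ltW.
have s1 := ball_sink_geN1 (ltn0Sn d0) I_gt0 le_IJ le_Jm del_gt0 del_small
  I_large' e_le1 z.
have s2 : 1 - lam * ball_sink J I z <= 2.
  by move: (ball_sink J I z) s1 => y *; nra.
apply: (@le_trans _ _ (ball_profile J I z * 2)); first exact: ler_wpM2l.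
apply: (@le_trans _ _ (del * J%:R * 2)); first exact: ler_wpM2r.
have : 0 <= J%:R * ((2 * gam + e) * g).
  by rewrite mulr_ge0 // mulr_ge0 ?addr_ge0 ?mulr_ge0 // ltW // (lt_le_trans ltr01).
by move: (J%:R) g e => J' g' e' *; lra.
Qed.

(** The number of points well inside the ball that the aggregate misses. The four
terms come from the accuracy of the profile, the discreteness of the rotors, the
extent of the source, and the smoothing time. *)
Lemma missed_inside_le (M' : nat) : (0 < M')%N -> (4 * M' <= J)%N ->
  #|[set z in ~: A | (M' * radius2 z <= (M' - 1) * J)%N]|%:R <=
  64 * M'%:R ^+ 2 * n *
    (4 * ((2 * gam + e) * g + 2 * del)
     + 3 * (4 * d%:R / J%:R
            + 8 * d%:R * (6 * 2 ^+ p) ^+ d / mI%:R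
            + 16 * d%:R ^+ 2 * 2 ^+ d / 4 ^+ p)) :> R.
Proof.
move=> M'_gt0 le_M'J.
have [l /andP[l_le l_ge]] := exists_sqrt (d * (2 * I)).
have [l0 l1 l3 _] := lam_bounds.
have k_le_m : (2 ^ k <= m.+1)%N.
  apply: leq_trans (leqW le_Bm); apply: leq_trans k_le.
  by rewrite leq_pmulr // expn_gt0.
have := ball_comparison (ltn0Sn d0) I_gt0 le_IJ le_Jm del_gt0 del_small I_large'
  e_le1 A_gt0 v_ge0 v_supp r_le1 flow l_ge k_le_m M_ge (erefl lam).
set Xs := [set z in ~: A | _]; set W := \sum_(z in ~: A) _; set err := \sum_z _ => main.
have J0 : 0 < J%:R :> R by rewrite ltr0n.
have M'0 : 0 < M'%:R :> R by rewrite ltr0n.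
have W_ge : #|Xs|%:R * (J%:R / (64 * M'%:R ^+ 2)) <= W.
  rewrite mulr_natl -sumr_const /W [leRHS](bigID (mem Xs)) /= -[leLHS]addr0.
  apply: lerD; last by apply: sumr_ge0 => z _; apply: profile_ge0.
  rewrite [leRHS](eq_bigl (mem Xs)); last first.
    by move=> z; rewrite !inE; case: (z \in A).
  apply: ler_sum => z; rewrite !inE => /andP[_ le_z].
  exact: (profile_ge (ltn0Sn d0) I_gt0 I_leJ M'_gt0 le_M'J le_IJ le_z).
set Z1 := (2 * gam + e) * g + 2 * del.
have Z1_ge0 : 0 <= Z1.
  have g0 := ltW (lt_le_trans ltr01 g_ge1).
  apply: addr_ge0; last by rewrite mulr_ge0 // ltW.
  by rewrite mulr_ge0 // addr_ge0 // mulr_ge0 // ltW.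
have err_le : err <= 4 * n * (J%:R * Z1).
  apply: (@le_trans _ _ (V * (J%:R * Z1))); last first.
    by apply: ler_wpM2r V_le4; rewrite mulr_ge0 // ltW.
  by rewrite -sum_indicator mulr_suml; apply: ler_sum => z _; apply: profile_error.
have n_le : n / (2 ^+ k ^+ d) <= (6 * 2 ^+ p) ^+ d.
  rewrite ler_pdivrMr ?exprn_gt0 // -exprMn.
  have -> : 6 * 2 ^+ p * 2 ^+ k = (3 * (2 * 2 ^ k * 2 ^ p))%N%:R :> R.
    by rewrite !natrM !natrX; ring.
  apply: (@le_trans _ _ V).
    apply: le_trans V_ge; have := n_gt0; have := gam_gt0; nra.
  rewrite -natrX ler_nat; apply: leq_trans (card_ball_le _ _ lt_JB) _.
  by rewrite leq_exp2r //; clear -k_ge B_gt0; lia.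
have l_le' : l%:R ^+ 2 <= 2 * d%:R * (J%:R / mI%:R) :> R.
  rewrite -natrX; apply: (@le_trans _ _ (d * (2 * I))%N%:R); first by rewrite ler_nat.
  rewrite !natrM mulrCA mulrA; apply: ler_wpM2l; first by rewrite mulr_ge0.
  rewrite ler_pdivlMr ?ltr0n; last exact: ltnW.
  by rewrite -natrM ler_nat leq_trunc_div.
have k_le' : 4 ^+ k <= J%:R / 4 ^+ p :> R.
  rewrite ler_pdivlMr ?exprn_gt0 // -!natrX -natrM ler_nat.
  apply: leq_trans le_BJ; apply: (@leq_trans ((2 ^ k * 2 ^ p) ^ 2)).
    by rewrite -(expnM 2 2) -(expnM 2 2) expnMn -!expnM mulnC [(p * 2)%N]mulnC [(k * 2)%N]mulnC mulnC.
  by rewrite leq_exp2r.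
set E2 := 8 * d%:R * _ / mI%:R; set E3 := 16 * _ * _ / _.
have t2 : 4 * n * l%:R ^+ 2 * (2 ^+ k ^+ d)^-1 <= J%:R * E2.
  have -> : 4 * n * l%:R ^+ 2 * (2 ^+ k ^+ d)^-1 =
    4 * (l%:R ^+ 2 * (n / 2 ^+ k ^+ d)) by ring.
  have -> : J%:R * E2 = 4 * (2 * d%:R * (J%:R / mI%:R) * (6 * 2 ^+ p) ^+ d).
    by rewrite /E2; ring.
  by apply: ler_wpM2l => //; apply: ler_pM.
have t3 : 16 * d%:R ^+ 2 * 2 ^+ d * 4 ^+ k <= J%:R * E3.
  have -> : J%:R * E3 = 16 * d%:R ^+ 2 * 2 ^+ d * (J%:R / 4 ^+ p) by rewrite /E3; ring.
  by apply: ler_wpM2l => //; rewrite !mulr_ge0 ?sqr_ge0 ?exprn_ge0.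
have t1 : 4 * d%:R = J%:R * (4 * d%:R / J%:R) :> R by field; rewrite gt_eqF.
set E1 := 4 * d%:R / J%:R in t1 *.
have E_ge0 : 0 <= J%:R * (E1 + E2 + E3).
  have E1_ge0 : 0 <= J%:R * E1 by rewrite -t1 mulr_ge0.
  have E2_ge0 : 0 <= J%:R * E2.
    by apply: le_trans t2; rewrite !mulr_ge0 ?sqr_ge0 ?invr_ge0 ?exprn_ge0.
  have E3_ge0 : 0 <= J%:R * E3.
    by apply: le_trans t3; rewrite !mulr_ge0 ?sqr_ge0 ?exprn_ge0.
  by rewrite !mulrDr !addr_ge0.
have le_W : lam * W <= lam * (n * J%:R * (4 * Z1 + 3 * (E1 + E2 + E3))).
  apply: le_trans main _; rewrite t1.
  have le1 : lam * err <= lam * (4 * n * (J%:R * Z1)) by apply: ler_wpM2l => //; apply: ltW.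
  have le2 : n * (J%:R * E1 + 4 * n * l%:R ^+ 2 * (2 ^+ k ^+ d)^-1 +
      16 * d%:R ^+ 2 * 2 ^+ d * 4 ^+ k) <= n * (J%:R * (E1 + E2 + E3)).
    apply: ler_wpM2l; first by []. lra.
  have le3 : n * (J%:R * (E1 + E2 + E3)) <= 3 * lam * (n * (J%:R * (E1 + E2 + E3))).
    apply: ler_peMl; first by apply: mulr_ge0 E_ge0.
    by move: lam l3 => y; lra.
  apply: le_trans (lerD le1 le2) _; apply: le_trans (lerD (lexx _) le3) _.
  by rewrite le_eqVlt; apply/orP; left; apply/eqP; ring.
rewrite (ler_pM2l l0) in le_W.
have c0 : 0 < J%:R / (64 * M'%:R ^+ 2) :> R by rewrite divr_gt0 // mulr_gt0 // exprn_gt0.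
rewrite -(ler_pM2r c0); apply: le_trans W_ge _; apply: le_trans le_W _.
rewrite le_eqVlt; apply/orP; left; apply/eqP; field.
by rewrite !gt_eqF.
Qed.

End OneScale.

(** ** Choice of scales *)

Lemma exists_nat_ge {R : archiRealFieldType} (x : R) : exists N : nat, x <= N%:R.
Proof.
exists (Num.bound `|x|); apply: ltW; apply: le_lt_trans (ler_norm x) _.
exact: archi_boundP.
Qed.

Lemma div_nat_le {R : realFieldType} (x eps : R) (N M : nat) :
  0 <= x -> 0 < eps -> x / eps <= N%:R -> (0 < M)%N -> (N <= M)%N -> x / M%:R <= eps.
Proof.
move=> x0 eps0 le_N M_gt0; rewrite -(ler_nat R) => le_NM.
rewrite ler_pdivrMr ?ltr0n // mulrC -ler_pdivrMr //; exact: le_trans le_NM.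
Qed.

Lemma growth_le_ratio {R : realFieldType} d J q :
  (0 < q)%N -> (1 <= J %/ q)%N ->
  growth d J (J %/ q) <= (2 * q%:R) ^+ d :> R.
Proof.
move=> q_gt0 I_gt0; set I := (J %/ q)%N in I_gt0 *.
have I0 : 0 < I%:R :> R by rewrite ltr0n.
have := growth_ratio (R := R) d J I_gt0 (leq_div J q).
rewrite [growth d J J]growth_far // mul1r => le1; apply: le_trans le1 _.
rewrite lerXn2r // ?nnegrE ?divr_ge0 ?mulr_ge0 //.
rewrite ler_pdivrMr // -!natrM ler_nat.
have := ltn_ceil J q_gt0; rewrite -/I; nia.
Qed.

Lemma exists_dyadic B p : (2 ^ p <= B)%N ->
  exists k, (2 ^ k * 2 ^ p <= B < 2 * 2 ^ k * 2 ^ p)%N.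
Proof.
move=> le_pB; have p_gt0 : (0 < 2 ^ p)%N by rewrite expn_gt0.
have N_gt0 : (0 < B %/ 2 ^ p)%N by rewrite divn_gt0.
exists (trunc_log 2 (B %/ 2 ^ p)).
have /andP[le1 lt1] := trunc_log_bounds (ltnSn 1) N_gt0.
rewrite -leq_divRL // le1 /= -ltn_divLR //.
by rewrite expnS in lt1.
Qed.

Lemma shell_ratio_le {R : realType} d0 (B h : nat) (a : R) :
  (7 * d0.+1)%:R ^+ d0.+1 * 8 / h%:R <= a / 2 ->
  (7 * d0.+1)%:R ^+ d0.+1 * 8 / B%:R <= a / 2 -> shell_ratio B d0 h <= a.
Proof. by rewrite /shell_ratio; lra. Qed.

Lemma error_budget {R : realFieldType} (tau gam G E g x1 x2 x3 x4 : R) :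
  0 < tau -> 0 < gam -> gam * G <= tau / 64 -> 0 <= E -> E <= gam / 8 ->
  0 <= g -> g <= G -> 8 * x1 <= tau / 8 -> 3 * x2 <= tau / 8 ->
  3 * x3 <= tau / 8 -> 3 * x4 <= tau / 8 ->
  4 * ((2 * gam + E) * g + 2 * x1) + 3 * (x2 + x3 + x4) <= tau.
Proof.
move=> tau0 gam0 gamG E0 Egam g0 gG *.
have : (2 * gam + E) * g <= 3 * gam * G by apply: ler_pM => //; lra.
lra.
Qed.

(** The scales depend on one another in the order [h'] (width of the outer shell
that is given up), [p] (smoothing time), [mI] (size of the source), [gam] (excess
mass of the profile), [h] (width of the windows), [n]: each must be small
compared with constants produced by the previous ones. *)
Theorem aggregate_fills_ball {R : realType} d (c : {perm direction d})
    (rho0 : rotor_config d) (kap : R) :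
  (0 < d)%N -> cyclic_ordering c -> 0 < kap ->
  exists n0, forall n, (n0 <= n)%N -> exists (s D : seq 'rV[int]_d) (J : nat),
  [/\ uniq s, size s = n, forall x, aggregate c rho0 n x <-> x \in s &
   [/\ uniq D, forall x, (x \in D) = (sqnorm x <= J%:Z),
    (n <= size D)%N & (size [seq x <- D | x \notin s])%:R <= kap * n%:R]].
Proof.
case: d c rho0 => // d0 c rho0 _ c_cyclic kap_gt0; set d := d0.+1.
pose K0 : R := (7 * d)%:R ^+ d.
have K0_gt0 : 0 < K0 by rewrite exprn_gt0 // ltr0n.
have d_gt0 : 0 < d%:R :> R by rewrite ltr0n.
have [h'0 h'0P] := exists_nat_ge (K0 * 8 / (kap / 8 / 2)).
pose h' := h'0.+1; pose M' := (h' ^ 2)%N.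
have M'_gt0 : (0 < M')%N by rewrite expn_gt0.
have h'_le : K0 * 8 / h'%:R <= kap / 8 / 2.
  by apply: div_nat_le h'0P _ _; rewrite ?divr_gt0 // mulr_ge0 // ltW.
pose tau := kap / (128 * M'%:R ^+ 2).
have tau_gt0 : 0 < tau by rewrite divr_gt0 // mulr_gt0 // exprn_gt0 // ltr0n.
have tau8 : 0 < tau / 8 by rewrite divr_gt0.
have [p0 p0P] := exists_nat_ge (3 * (16 * d%:R ^+ 2 * 2 ^+ d) / (tau / 8)).
pose p := p0.+1.
have p_le : 3 * (16 * d%:R ^+ 2 * 2 ^+ d) / (4 ^ p)%:R <= tau / 8.
  apply: div_nat_le p0P _ _ => //; rewrite ?expn_gt0 //.
  by apply: leq_trans (ltnW (ltn_expl p (isT : (1 < 4)%N))).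
have [mI0 mI0P] := exists_nat_ge (3 * (8 * d%:R * (6 * 2 ^+ p) ^+ d) / (tau / 8)).
pose mI := mI0.+2.
have mI_le : 3 * (8 * d%:R * (6 * 2 ^+ p) ^+ d) / mI%:R <= tau / 8.
  by apply: div_nat_le mI0P _ _ => //; rewrite /mI; lia.
pose G : R := (2 * mI%:R) ^+ d.
have G_ge1 : 1 <= G.
  by rewrite exprn_ege1 // -natrM ler1n muln_gt0.
have G_gt0 : 0 < G := lt_le_trans ltr01 G_ge1.
pose gam : R := Num.min 1 (tau / (64 * G)).
have gam_gt0 : 0 < gam by rewrite lt_min ltr01 divr_gt0 // mulr_gt0.
have gam_le1 : gam <= 1 by rewrite ge_min lexx.
have gam_G : gam * G <= tau / 64.
  have : gam <= tau / (64 * G) by rewrite ge_min lexx orbT.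
  move=> le1; apply: le_trans (ler_wpM2r (ltW G_gt0) le1) _.
  by rewrite le_eqVlt; apply/orP; left; apply/eqP; field; rewrite gt_eqF.
have [h1 h1P] := exists_nat_ge (2 * (d%:R + 1) * G / (gam / 8)).
have [h2 h2P] := exists_nat_ge (8 / (tau / 8)).
have [h3 h3P] := exists_nat_ge (K0 * 8 / (gam / 32 / 2)).
pose h := (h1 + h2 + h3 + 2 * d.+1).+1.
have [h_ge1 h_ge2 h_ge3 h_ge4] : [/\ h1 <= h, h2 <= h, h3 <= h & 2 * d.+1 <= h]%N.
  by rewrite /h; clear; split; lia.
have h_gt0 : (0 < h)%N by [].
have le_hh2 : (h <= h ^ 2)%N by rewrite -{1}(expn1 h) leq_pexp2l.
have gam8 : 0 < gam / 8 by rewrite divr_gt0.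
have gam64 : 0 < gam / 32 / 2 by rewrite !divr_gt0.
have h1_le : 2 * (d%:R + 1) * G / (h ^ 2)%:R <= gam / 8.
  apply: div_nat_le h1P _ _ => //; rewrite ?expn_gt0 //.
    by rewrite !mulr_ge0 ?addr_ge0 // ltW.
  exact: leq_trans h_ge1 le_hh2.
have h2_le : 8 / (h ^ 2)%:R <= tau / 8.
  apply: div_nat_le h2P _ _ => //; rewrite ?expn_gt0 //.
  exact: leq_trans h_ge2 le_hh2.
have h3_le : K0 * 8 / h%:R <= gam / 32 / 2.
  by apply: div_nat_le h3P _ _ => //; rewrite mulr_ge0 // ltW.
have h_large : (2 * d.+1 <= h ^ 2)%N.
  exact: leq_trans h_ge4 le_hh2.
have [B1 B1P] := exists_nat_ge (K0 * 8 / (gam / 32 / 2)).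
have [B2 B2P] := exists_nat_ge (3 * (4 * d%:R) / (tau / 8)).
have [B3 B3P] := exists_nat_ge (K0 * 8 / (kap / 8 / 2)).
pose B0 := (B1 + B2 + B3 + 4 * mI * h ^ 4 + 4 * M' + 2 ^ p)%N.
exists ((2 * B0).+1 ^ d).+1 => n n_large.
have n_gt0 : (0 < n)%N by apply: leq_trans n_large.
have [s [k [s_uniq size_s sE [_ balance]]]] := aggregate_odometer (R := R) c_cyclic rho0 n_gt0.
(* The torus must contain the aggregate and a ball of at least [2 n] points. *)
pose m := (4 * d * n + \max_(x <- s) \max_(i < d) `|x 0%R i|)%N.
have s_box (x : 'rV[int]_d) i : x \in s -> (`|x 0%R i| <= m.+1)%N.
  move=> xs; apply: leqW; apply: leq_trans (leq_addl _ _).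
  apply: leq_trans (leq_bigmax_seq _ xs isT).
  exact: (bigop.leq_bigmax i).
rewrite -size_s in balance.
have [v [r [[v_ge0 v_supp r_le1] flow]]] := torus_flow s_uniq s_box balance.
have {}r_le1 := r_le1 c_cyclic.
set A := torus_set m s in v_supp flow.
have cardA : #|A| = n by rewrite card_torus_set.
have A_gt0 : (0 < #|A|)%N by rewrite cardA.
have V_big : (1 + gam) * #|A|%:R <= #|ball_set m d (d * (2 * n) ^ 2)|%:R.
  rewrite cardA.
  apply: (@le_trans _ _ (2 * n)%N%:R).
    by rewrite natrM; apply: ler_wpM2r => //; rewrite [2]/(1 + 1) lerD2l.
  rewrite ler_nat; apply: (@leq_trans ((2 * (2 * n)).+1 ^ d)).
    apply: (@leq_trans ((2 * (2 * n)).+1 ^ 1)); last by rewrite leq_pexp2l.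
    by rewrite expn1; clear; lia.
  have le_m : (2 * n <= m.+1)%N.
    apply: leqW; apply: leq_trans (leq_addr _ _).
    by rewrite leq_mul2r; apply/orP; right; rewrite /d; clear; lia.
  apply: leq_trans (card_box_ge d le_m) _; apply: subset_leq_card.
  apply/fintype.subsetP => z; rewrite !inE => /forallP le_b.
  rewrite -[d in (d * _)%N]card_ord -sum_nat_const.
  by apply: leq_sum => i _; rewrite leq_exp2r.
have ex_J : exists J, (1 + gam) * #|A|%:R <= #|ball_set m d J|%:R.
  by exists (d * (2 * n) ^ 2)%N.
(* By minimality, the ball has [(1 + gam) n] points up to its boundary sphere. *)
pose J := ex_minn ex_J.
have [V_ge V_min] : (1 + gam) * #|A|%:R <= #|ball_set m d J|%:R /\
    forall j, (1 + gam) * #|A|%:R <= #|ball_set m d j|%:R -> (J <= j)%N.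
  by rewrite /J; case: ex_minnP => j; split.
have [B /andP[le_BJ lt_JB]] := exists_sqrt J.
have lt_B : (B0 < B)%N.
  rewrite ltnNge; apply/negP => le_B.
  have : (n <= (2 * B0).+1 ^ d)%N; last by rewrite leqNgt n_large.
  apply: (@leq_trans #|ball_set m d J|).
    rewrite -(ler_nat R) -cardA; apply: le_trans V_ge.
    by rewrite ler_peMl // lerDl ltW.
  apply: leq_trans (card_ball_le _ _ lt_JB) _.
  by rewrite leq_exp2r // ltnS leq_mul2l le_B orbT.
have [B_gt1 B_gt2 B_gt3 B_gt4 [B_gt5 B_gt6]] : [/\ B1 <= B, B2 <= B, B3 <= B,
    4 * mI * h ^ 4 <= B & 4 * M' <= B /\ 2 ^ p <= B]%N.
  move: lt_B; rewrite /B0; move: (4 * mI * h ^ 4)%N (4 * M')%N (2 ^ p)%N.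
  by clear => *; split; lia.
have B_gt0 : (0 < B)%N by apply: leq_ltn_trans lt_B.
have le_BJ1 : (B <= J)%N by apply: leq_trans le_BJ; rewrite -{1}(expn1 B) leq_pexp2l.
have le_Bm : (B <= m)%N.
  apply: (@leq_trans (2 * d * n)); last first.
    by apply: leq_trans (leq_addr _ _); rewrite !leq_mul2r orbC.
  have le_J := V_min _ V_big.
  rewrite -(@leq_exp2r _ _ 2) //; apply: leq_trans le_BJ (leq_trans le_J _).
  have -> : ((2 * d * n) ^ 2 = d * (d * (2 * n) ^ 2))%N.
    by rewrite -(mulnn (2 * d * n)) -(mulnn (2 * n)); ring.
  by rewrite leq_pmull.
have V_min' : #|[set z : 'rV['I_(m.*2.+3)]_d | (radius2 z < J)%N]|%:R
    <= (1 + gam) * #|A|%:R.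
  have [J0|J_gt0] := posnP J.
    rewrite eq_card0 => [|z]; last by rewrite inE J0.
    by rewrite mulr_ge0 // addr_ge0 // ltW.
  rewrite (eq_card (B := ball_set m d J.-1)) => [|z]; last first.
    by rewrite !inE -[in LHS](prednK J_gt0).
  rewrite leNgt; apply/negP => /ltW /V_min.
  by rewrite leqNgt -subn1 ltn_subrL J_gt0.
pose del : R := (h%:R ^+ 2)^-1.
have I_large : (4 * h ^ 4 <= J %/ mI)%N.
  rewrite leq_divRL //; apply: leq_trans le_BJ1; apply: leq_trans B_gt4.
  by rewrite mulnAC.
have I_gt0 : (0 < J %/ mI)%N by apply: leq_trans I_large; rewrite muln_gt0 expn_gt0.
have g_le : growth d J (J %/ mI) <= G by apply: growth_le_ratio.
have g_gt0 : 0 < growth d J (J %/ mI) :> R := growth_gt0 _ _ _.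
have e_le : sink_error d J (J %/ mI) del <= gam / 8.
  apply: le_trans h1_le; rewrite /sink_error /del natrX mulrAC.
  apply: ler_wpM2r; first by rewrite invr_ge0 exprn_ge0.
  by apply: ler_wpM2l g_le; rewrite mulr_ge0 // addr_ge0.
have shell_le : shell_ratio B d0 h <= gam / 32.
  apply: shell_ratio_le h3_le _.
  by apply: div_nat_le B1P _ _ => //; rewrite mulr_ge0 // ltW.
have [k' /andP[k_le k_ge]] := exists_dyadic B_gt6.
have le_M'J : (4 * M' <= J)%N := leq_trans B_gt5 le_BJ1.
have missed := missed_inside_le B_gt0 le_BJ lt_JB le_Bm h_large (isT : (2 <= mI)%N)
  I_large gam_gt0 gam_le1 e_le shell_le k_le k_ge A_gt0 v_ge0 v_supp r_le1 flow
  V_ge V_min' M'_gt0 le_M'J.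
have V_le4 := card_ball_le4 B_gt0 le_BJ lt_JB le_Bm h_large I_large gam_gt0
  gam_le1 shell_le A_gt0 V_min'.
set Xs := [set z in ~: A | _] in missed.
have n0 : 0 < #|A|%:R :> R by rewrite ltr0n.
have Xs_le : #|Xs|%:R <= kap / 2 * #|A|%:R.
  apply: le_trans missed _; rewrite mulrAC ler_pM2r //.
  have -> : kap / 2 = 64 * M'%:R ^+ 2 * tau.
    by rewrite /tau; field; rewrite pnatr_eq0 -lt0n.
  apply: ler_wpM2l; first by rewrite mulr_ge0 ?exprn_ge0.
  apply: (error_budget tau_gt0 gam_gt0 gam_G _ e_le (ltW g_gt0) g_le).
  - by apply: sink_error_ge0; rewrite invr_gt0 exprn_gt0 // ltr0n.
  - by move: h2_le; rewrite natrX.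
  - rewrite mulrA.
    by apply: div_nat_le B2P (leq_trans B_gt0 le_BJ1) (leq_trans B_gt2 le_BJ1).
  - by rewrite mulrA.
  - by rewrite mulrA; move: p_le; rewrite natrX.
pose s0 := ((M' - 1) * J %/ M')%N.
have shell_small : #|[set z : 'rV['I_(m.*2.+3)]_d | (s0 < radius2 z <= J)%N]|%:R
    <= kap / 2 * #|A|%:R.
  apply: (@le_trans _ _ (shell_ratio B d0 h' * #|ball_set m d J|%:R)).
    apply: card_shell_ratio => //; first exact: leqW.
    - have lt_s0 := ltn_ceil ((M' - 1) * J) M'_gt0.
      have le_B : (J <= 4 * B ^ 2)%N by move: lt_JB B_gt0; clear; nia.
      have aux (M s1 j b : nat) : ((M - 1) * j < s1.+1 * M)%N -> (j <= 4 * b)%N ->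
          (0 < M)%N -> (M * j <= M * s1 + 16 * b + 4 * M)%N by clear; nia.
      exact: aux lt_s0 le_B M'_gt0.
    by rewrite leq_pmull.
  have sh_le : shell_ratio B d0 h' <= kap / 8.
    apply: shell_ratio_le h'_le _.
    by apply: div_nat_le B3P _ _ => //; rewrite ?divr_gt0 // mulr_ge0 // ltW.
  apply: (@le_trans _ _ (kap / 8 * #|ball_set m d J|%:R)); first by apply: ler_wpM2r.
  have k8 : 0 <= kap / 8 by rewrite divr_ge0 // ltW.
  apply: le_trans (ler_wpM2l k8 V_le4) _.
  by rewrite le_eqVlt; apply/orP; left; apply/eqP; field.
exists s, (map (@centered m d) (enum (ball_set m d J))), J; split=> //; split.
- by rewrite map_inj_uniq ?enum_uniq //; apply: centered_inj.
- move=> x; apply/mapP/idP => [[z]|le_x].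
    by rewrite mem_enum inE => le_z ->; rewrite sqnorm_centered lez_nat.
  have cx : centered (proj m x) = x.
    apply: centered_proj => i; apply: leqW; apply: leq_trans le_Bm.
    have : (x 0 i) ^+ 2 <= J%:Z.
      apply: le_trans le_x; rewrite /sqnorm (bigD1 i) //= lerDl.
      by apply: sumr_ge0 => j _; apply: sqr_ge0.
    have aux (t : int) (j b : nat) : t ^+ 2 <= j%:Z -> (j < b.+1 ^ 2)%N -> (`|t| <= b)%N.
      by clear; rewrite expr2; nia.
    by move=> le_xJ; apply: aux le_xJ lt_JB.
  exists (proj m x); last by rewrite cx.
  by rewrite mem_enum inE -lez_nat -sqnorm_centered cx.
- rewrite size_map -cardE -(ler_nat R) -cardA; apply: le_trans V_ge.
  by rewrite ler_peMl // lerDl ltW.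
rewrite filter_map size_map.
set Sh := [set z : 'rV_d | _] in shell_small.
apply: (@le_trans _ _ (#|Xs| + #|Sh|)%N%:R); last first.
  by rewrite natrD -cardA [kap in leRHS]splitr mulrDl; apply: lerD.
rewrite ler_nat; apply: leq_trans (leq_card_setU _ _); rewrite cardE.
apply: uniq_leq_size => [|z]; first by rewrite filter_uniq ?enum_uniq.
rewrite mem_filter !mem_enum !inE /= => /andP[zs le_z].
rewrite zs le_z andbT /= ltn_divLR //.
by rewrite [(radius2 z * _)%N]mulnC; case: leqP.
Qed.

Local Open Scope classical_set_scope.
Local Open Scope ring_scope.

(** * Lebesgue measure of unions of cubes *)

Section Boxes.

Context {R : realType}.
Local Notation T := (measurableTypeR R).

Definition box d (A : 'I_d -> set T) : set (d.-tuple T) :=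
  [set y | forall i, A i (tnth y i)].

Lemma measurable_box d (A : 'I_d -> set T) :
  (forall i, measurable (A i)) -> measurable (box A).
Proof.
move=> mA; have -> : box A = \bigcap_(i in [set: 'I_d]) ((@tnth d T)^~ i @^-1` A i).
  by apply/seteqP; split=> y /= yA i; [move=> _|]; apply: yA.
apply: fin_bigcap_measurable => // i _; rewrite -[X in measurable X]setTI.
exact: measurable_tnth.
Qed.

Lemma lebesgue_box d (A : 'I_d -> set T) (a : R) :
  (forall i, measurable (A i)) -> (forall i, lebesgue_measure (A i) = a%:E) ->
  lebesgue_tuple d (box A) = (a ^+ d)%:E.
Proof.
elim: d A => [|d IH] A mA A_a.
  rewrite /= diracE mem_set // => i; by case: i.
rewrite [LHS]/= /lebesgue_cons /pushforward.
have -> : @tcons R d @^-1` box A = A ord0 `*` box (fun i => A (lift ord0 i)).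
  apply/seteqP; split=> [[y0 y] yA|[y0 y] [yA0 yA] i].
    split=> [|i]; first by have := yA ord0; rewrite /tcons /= tnth0.
    by have := yA (lift ord0 i); rewrite /tcons /= tnthS.
  by case: (unliftP ord0 i) => [j|] ->; rewrite /= ?tnthS ?tnth0 //; apply: yA.
rewrite product_measure2E //; last exact: measurable_box.
rewrite [X in (X * _)%E](A_a ord0) [X in (_ * X)%E]IH //.
by rewrite -EFinM exprS.
Qed.

Definition sqnormR d (y : d.-tuple T) : R := \sum_(i < d) tnth y i ^+ 2.

Lemma euclidean_ballE d (r : R) (y : d.-tuple T) : 0 < r ->
  euclidean_ball r y <-> sqnormR y < r ^+ 2.
Proof.
move=> r0; rewrite /euclidean_ball /= -/(sqnormR y).
have y0 : 0 <= sqnormR y by apply: sumr_ge0 => i _; apply: sqr_ge0.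
rewrite -[X in X < _ ^+ 2](sqr_sqrtr y0).
by rewrite ltr_pXn2r ?nnegrE ?sqrtr_ge0 // ltW.
Qed.

Lemma euclidean_ball_le0 d (r : R) : r <= 0 -> euclidean_ball r = set0 :> set (d.-tuple T).
Proof.
move=> r0; apply/seteqP; split=> y //; rewrite /euclidean_ball /= ltNge.
by rewrite (le_trans r0) // sqrtr_ge0.
Qed.

Lemma measurable_euclidean_ball d (r : R) :
  measurable (euclidean_ball r : set (d.-tuple T)).
Proof.
have [r0|r0] := leP r 0; first by rewrite euclidean_ball_le0.
have -> : euclidean_ball r = @sqnormR d @^-1` `]-oo, r ^+ 2[%classic.
  apply/seteqP; split=> y /=; rewrite in_itv /=.
    by move/(euclidean_ballE _ r0).
  by move=> lt_y; apply/(euclidean_ballE _ r0).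
rewrite -[X in measurable X]setTI.
have : measurable_fun setT (@sqnormR d).
  by apply: measurable_sum => i; apply: measurable_realfun.measurable_funX; apply: measurable_tnth.
by apply => //; apply: measurable_itv.
Qed.

(** ** Scaled cubes *)

Variables (d : nat) (a : R).
Hypothesis a_gt0 : 0 < a.
Local Notation site := 'rV[int]_d.
Local Notation mu := (@lebesgue_tuple R d).

Definition closed_cube (x : site) : set (d.-tuple T) :=
  box (fun i => `[a * ((x 0 i)%:~R - 2^-1), a * ((x 0 i)%:~R + 2^-1)]%classic).

(** Half-open cubes of distinct sites are disjoint, so they carry exact counts. *)
Definition half_open_cube (x : site) : set (d.-tuple T) :=
  box (fun i => `[a * ((x 0 i)%:~R - 2^-1), a * ((x 0 i)%:~R + 2^-1)[%classic).

Definition closed_cubes (s : seq site) := \big[setU/set0]_(x <- s) closed_cube x.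

Definition half_open_cubes (s : seq site) :=
  \big[setU/set0]_(x <- s) half_open_cube x.

Let side (t : R) : a * (t - 2^-1) < a * (t + 2^-1).
Proof. by rewrite ltr_pM2l //; lra. Qed.

Let side_length (t : R) : a * (t + 2^-1) - a * (t - 2^-1) = a.
Proof. by field. Qed.

Lemma measurable_closed_cube x : measurable (closed_cube x).
Proof. by apply: measurable_box => i; apply: measurable_itv. Qed.

Lemma measurable_half_open_cube x : measurable (half_open_cube x).
Proof. by apply: measurable_box => i; apply: measurable_itv. Qed.

Lemma lebesgue_closed_cube x : mu (closed_cube x) = (a ^+ d)%:E.
Proof.
apply: lebesgue_box => i; first exact: measurable_itv.
by rewrite lebesgue_measure_itv /= lte_fin side -EFinB side_length.
Qed.

Lemma lebesgue_half_open_cube x : mu (half_open_cube x) = (a ^+ d)%:E.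
Proof.
apply: lebesgue_box => i; first exact: measurable_itv.
by rewrite lebesgue_measure_itv /= lte_fin side -EFinB side_length.
Qed.

Lemma measurable_closed_cubes s : measurable (closed_cubes s).
Proof. by apply: bigsetU_measurable => x _; apply: measurable_closed_cube. Qed.

Lemma measurable_half_open_cubes s : measurable (half_open_cubes s).
Proof. by apply: bigsetU_measurable => x _; apply: measurable_half_open_cube. Qed.

Lemma closed_cubesP s y :
  closed_cubes s y <-> exists2 x, x \in s & closed_cube x y.
Proof. by rewrite /closed_cubes -bigcup_seq. Qed.

Lemma half_open_cubesP s y :
  half_open_cubes s y <-> exists2 x, x \in s & half_open_cube x y.
Proof. by rewrite /half_open_cubes -bigcup_seq. Qed.

Lemma half_open_sub_closed s : half_open_cubes s `<=` closed_cubes s.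
Proof.
move=> y /half_open_cubesP[x xs yx]; apply/closed_cubesP; exists x => // i.
have := yx i; rewrite /= !in_itv /= => /andP[-> /ltW]; by [].
Qed.

Let succ_mul n : (n.+1%:R * a ^+ d)%:E = ((a ^+ d)%:E + (n%:R * a ^+ d)%:E)%E.
Proof. by rewrite -EFinD -natr1; congr (_%:E); ring. Qed.

Lemma lebesgue_closed_cubes s : (mu (closed_cubes s) <= ((size s)%:R * a ^+ d)%:E)%E.
Proof.
elim: s => [|x s IH]; first by rewrite /closed_cubes big_nil measure0 mul0r.
rewrite /closed_cubes big_cons; apply: le_trans (measureU2 _ _ _) _.
- exact: measurable_closed_cube.
- exact: measurable_closed_cubes.
rewrite [X in (X + _ <= _)%E]lebesgue_closed_cube succ_mul.
exact: leeD2l.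
Qed.

Lemma lebesgue_half_open_cubes s : uniq s ->
  mu (half_open_cubes s) = ((size s)%:R * a ^+ d)%:E.
Proof.
elim: s => [|x s IH] /=; first by rewrite /half_open_cubes big_nil measure0 mul0r.
move=> /andP[xs s_uniq]; rewrite /half_open_cubes big_cons measureU.
- rewrite succ_mul [X in (X + _)%E = _]lebesgue_half_open_cube.
  by congr (_ + _)%E; apply: IH.
- exact: measurable_half_open_cube.
- exact: measurable_half_open_cubes.
apply/seteqP; split=> // y [yx /half_open_cubesP[x' x's yx']].
move: xs; suff -> : x = x' by rewrite x's.
apply/matrixP => i0 i; rewrite (ord1 i0).
have := yx i; have := yx' i; rewrite /= !in_itv /= => /andP[l1 u1] /andP[l2 u2].
have lt1 := le_lt_trans l1 u2; have lt2 := le_lt_trans l2 u1.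
rewrite ltr_pM2l // in lt1; rewrite ltr_pM2l // in lt2.
apply/eqP; rewrite eq_le -!ltzD1 -!(ltr_int R) !rmorphD /=.
by apply/andP; split; lra.
Qed.

Lemma dilate_cube_union (A : set site) s : (forall x, A x <-> x \in s) ->
  dilate a (cube_union A) = closed_cubes s.
Proof.
move=> As; have cubeE x (y : d.-tuple T) :
    closed_cube x [tuple a * tnth y i | i < d] <->
    forall i, `|tnth y i - (x 0 i)%:~R| <= 2^-1.
  split=> y_x i; have := y_x i; rewrite /= tnth_mktuple in_itv /= !ler_pM2l //.
    by move=> /andP[? ?]; rewrite ler_norml; apply/andP; split; lra.
  by rewrite ler_norml => /andP[? ?]; apply/andP; split; lra.
apply/seteqP; split=> [_ [y [x Ax yx] <-]|y /closed_cubesP[x xs yx]].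
  by apply/closed_cubesP; exists x; [apply/As | apply/cubeE].
have yE : [tuple a * tnth [tuple a^-1 * tnth y i | i < d] i | i < d] = y.
  by apply: eq_from_tnth => i; rewrite !tnth_mktuple mulrA divff ?mul1r // gt_eqF.
exists [tuple a^-1 * tnth y i | i < d] => //.
by exists x; [apply/As | apply/cubeE; rewrite yE].
Qed.

End Boxes.

(** * Convergence to the ball *)

Section Geometry.

Context {R : realType}.
Variables (d : nat) (a eta : R).
Hypotheses (a_gt0 : 0 < a) (eta_gt0 : 0 < eta).
Local Notation T := (measurableTypeR R).

(** The price, in units of [a ^ 2], of the half-diagonal of a cube of side [a] in
[(u + v) ^ 2 <= (1 + eta) u ^ 2 + (1 + 1 / eta) v ^ 2]. *)
Definition cube_slack : R := (1 + eta^-1) * (d%:R / 4).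

Let sqr_add_le (u v : R) : `|v| <= a / 2 ->
  (u + v) ^+ 2 <= (1 + eta) * u ^+ 2 + (1 + eta^-1) * (a ^+ 2 / 4).
Proof.
move=> v_le; apply: (@le_trans _ _ ((1 + eta) * u ^+ 2 + (1 + eta^-1) * v ^+ 2)).
  rewrite -subr_ge0.
  have -> : (1 + eta) * u ^+ 2 + (1 + eta^-1) * v ^+ 2 - (u + v) ^+ 2 =
    eta^-1 * (eta * u - v) ^+ 2 by field; rewrite gt_eqF.
  by rewrite mulr_ge0 ?sqr_ge0 // invr_ge0 ltW.
rewrite lerD2l; apply: ler_wpM2l; first by rewrite addr_ge0 // invr_ge0 ltW.
have -> : a ^+ 2 / 4 = (a / 2) ^+ 2 by field.
by rewrite -(real_normK (num_real v)) lerXn2r // nnegrE divr_ge0 // ltW.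
Qed.

Let sum_sqr_add (u v : 'I_d -> R) : (forall i, `|v i| <= a / 2) ->
  \sum_i (u i + v i) ^+ 2 <= (1 + eta) * (\sum_i u i ^+ 2) + a ^+ 2 * cube_slack.
Proof.
move=> v_le.
have -> : a ^+ 2 * cube_slack = \sum_(i < d) (1 + eta^-1) * (a ^+ 2 / 4).
  by rewrite sumr_const card_ord -[RHS]mulr_natl /cube_slack; ring.
rewrite mulr_sumr -big_split; apply: ler_sum => i _; exact: sqr_add_le.
Qed.

Lemma sqnormR_cube_le (x : 'rV[int]_d) (y : d.-tuple T) : closed_cube a x y ->
  sqnormR y <= (1 + eta) * (a ^+ 2 * (sqnorm x)%:~R) + a ^+ 2 * cube_slack.
Proof.
move=> yx.
have -> : sqnormR y =
    \sum_i (a * (x 0 i)%:~R + (tnth y i - a * (x 0 i)%:~R)) ^+ 2.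
  by apply: eq_bigr => i _; rewrite addrC subrK.
have -> : a ^+ 2 * (sqnorm x)%:~R = \sum_i (a * (x 0 i)%:~R) ^+ 2.
  rewrite /sqnorm rmorph_sum mulr_sumr; apply: eq_bigr => i _ /=.
  by rewrite rmorphXn exprMn.
apply: sum_sqr_add => i; have := yx i; rewrite /= in_itv /= mulrBr mulrDr.
by move=> /andP[? ?]; rewrite ler_norml; apply/andP; split; lra.
Qed.

Lemma nearest_site (y : d.-tuple T) : exists2 x : 'rV[int]_d, closed_cube a x y &
  a ^+ 2 * (sqnorm x)%:~R <= (1 + eta) * sqnormR y + a ^+ 2 * cube_slack.
Proof.
pose x : 'rV[int]_d := \row_i Num.floor (tnth y i / a + 2^-1).
have x_near i : `|tnth y i - a * (x 0 i)%:~R| <= a / 2.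
  rewrite mxE; set z := tnth y i / a + 2^-1.
  have l1 := floor_le z; have l2 := floorD1_gt z; rewrite rmorphD /= in l2.
  have -> : tnth y i = a * (z - 2^-1) by rewrite /z; field; rewrite gt_eqF.
  rewrite -mulrBr normrM gtr0_norm // ler_pM2l // ler_norml.
  by apply/andP; split; lra.
exists x => [i|].
  have := x_near i; rewrite /= in_itv /= mulrBr mulrDr ler_norml => /andP[? ?].
  by apply/andP; split; lra.
have -> : a ^+ 2 * (sqnorm x)%:~R =
    \sum_i (tnth y i + (a * (x 0 i)%:~R - tnth y i)) ^+ 2.
  rewrite /sqnorm rmorph_sum mulr_sumr; apply: eq_bigr => i _ /=.
  by rewrite addrC subrK rmorphXn exprMn.
by apply: sum_sqr_add => i; rewrite distrC.
Qed.

End Geometry.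

Section Balls.

Context {R : realType}.
Variable d : nat.
Local Notation T := (measurableTypeR R).
Local Notation mu := (@lebesgue_tuple R d).
Local Notation ball := (@euclidean_ball R d).

Lemma euclidean_ball_sub (p q : R) : p <= q -> ball p `<=` ball q.
Proof. by move=> le_pq y /lt_le_trans; apply. Qed.

(** Continuity of the measure along increasing concentric balls. *)
Lemma inner_ball (r : R) (eps : R) : mu (ball r) = 1%E -> 0 < eps ->
  exists r', [/\ 0 < r', r' < r & ((1 - eps)%:E <= mu (ball r'))%E].
Proof.
move=> mu_r eps_gt0.
have r_gt0 : 0 < r.
  rewrite ltNge; apply/negP => /euclidean_ball_le0 ball0.
  by move: mu_r; rewrite ball0 measure0 => /eqP; rewrite eq_sym onee_eq0.
pose F k := ball (r - k.+1%:R^-1).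
have union : \bigcup_k F k = ball r.
  apply/seteqP; split=> y.
    by move=> [k _]; apply: euclidean_ball_sub; rewrite gerBl.
  rewrite /euclidean_ball /= => lt_y; set t := Num.sqrt _ in lt_y.
  have gap : 0 < r - t by rewrite subr_gt0.
  have [k le_k] := exists_nat_ge (r - t)^-1.
  exists k => //; rewrite /F /euclidean_ball /= -/t ltrBrDr -ltrBrDl.
  rewrite invf_plt ?posrE ?ltr0n //; apply: le_lt_trans le_k _.
  by rewrite ltr_nat.
have F_homo : {homo F : n m / (n <= m)%N >-> (n <= m)%O}.
  move=> n m le_nm; apply/subsetPset; apply: euclidean_ball_sub.
  by rewrite lerB // lef_pV2 ?posrE ?ltr0n // ler_nat.
have mF k : measurable (F k) by apply: measurable_euclidean_ball.
have mU : measurable (\bigcup_k F k).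
  by rewrite union; apply: measurable_euclidean_ball.
have /fine_cvgP[fin_F close] : (mu \o F) x @[x --> \oo] --> 1%:E.
  by have := nondecreasing_cvg_mu (mu := mu) mF mU F_homo; rewrite union -mu_r.
move/cvgrPdist_le : close => /(_ _ eps_gt0) close.
have [k _ Fk] := filterI fin_F close.
have [/= fin_k le_k] := Fk k (leqnn k).
exists (Num.max (r - k.+1%:R^-1) (r / 2)); split.
- by rewrite lt_max divr_gt0 ?orbT.
- by rewrite gt_max ltrBlDr ltrDl invr_gt0 ltr0n /=; lra.
apply: (@le_trans _ _ (mu (F k))).
  rewrite -(fineK fin_k) lee_fin; move: le_k; rewrite ler_norml => /andP[_].
  by rewrite /=; lra.
apply: le_measure; rewrite ?inE; try exact: measurable_euclidean_ball.
by apply: euclidean_ball_sub; rewrite le_max lexx.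
Qed.

End Balls.

Section Uncovered.

Context {R : realType}.
Variable d : nat.
Local Notation T := (measurableTypeR R).
Local Notation mu := (@lebesgue_tuple R d).
Local Notation ball := (@euclidean_ball R d).

(** The part of [C] outside [B] is no larger than the part of [B] outside [C],
since [C] has no more measure than [B]. *)
Lemma symdiff_le (B C : set (d.-tuple T)) (eps : R) :
  measurable B -> measurable C -> mu B = 1%E -> (mu C <= 1)%E ->
  (mu (B `\` C) <= eps%:E)%E -> (mu (C `+` B) <= (2 * eps)%:E)%E.
Proof.
move=> mB mC muB muC le_eps.
have mBC : measurable (B `\` C) by apply: measurableD.
have mCB : measurable (C `\` B) by apply: measurableD.
have mI : measurable (C `&` B) by apply: measurableI.
rewrite /setY; apply: le_trans (measureU2 _ mCB mBC) _.
have splitC : mu C = (mu (C `\` B) + mu (C `&` B))%E := measureDI mu mC mB.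
have splitB : mu B = (mu (B `\` C) + mu (C `&` B))%E.
  by rewrite setIC; exact: (measureDI mu mB mC).
have ge0 X : (0 <= mu X)%E by exact: measure_ge0.
change ((mu (C `\` B) + mu (B `\` C))%E <= (2 * eps)%:E)%E.
move: muB muC le_eps (ge0 (B `\` C)) (ge0 (C `\` B)) (ge0 (C `&` B)).
rewrite splitB splitC.
move: (mu (C `&` B)) (mu (C `\` B)) (mu (B `\` C)) => [x| |] [y| |] [z| |] //=.
by move=> [eq1]; rewrite !lee_fin => *; lra.
Qed.

(** The lattice ball [D] of radius [sqrt J] has at least [n] points, so its scaled
cubes either lie inside the ball and fill it by volume, or reach close enough to
the boundary to contain the smaller ball of radius [r']. *)
Lemma lattice_ball_covers (a eta r r' eps : R) (D : seq 'rV[int]_d) (J n : nat) :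
  0 < a -> 0 < eta -> 0 < r' -> r' < r -> 0 <= eps ->
  mu (ball r) = 1%E -> ((1 - eps)%:E <= mu (ball r'))%E ->
  uniq D -> (forall x, (x \in D) = (sqnorm x <= J%:Z)) ->
  n%:R * a ^+ d = 1 -> (n <= size D)%N ->
  (2 + eta) * (a ^+ 2 * cube_slack d eta) <= r ^+ 2 - ((1 + eta) * r') ^+ 2 ->
  (mu (ball r `\` closed_cubes a D) <= eps%:E)%E.
Proof.
move=> a_gt0 eta_gt0 r'_gt0 lt_r' eps_ge0 mu_r mu_r' D_uniq inD na le_nD gap.
have r_gt0 : 0 < r by apply: lt_trans lt_r'.
have mb q := @measurable_euclidean_ball R d q.
have mc := measurable_closed_cubes a D; have mh := measurable_half_open_cubes a D.
have a2_gt0 : 0 < a ^+ 2 by rewrite exprn_gt0.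
set slack := a ^+ 2 * cube_slack d eta in gap.
have J_a : 0 <= a ^+ 2 * J%:R by rewrite mulr_ge0 // ltW.
have diff_le (X Y : set (d.-tuple T)) : measurable X -> measurable Y ->
    X `<=` ball r -> X `<=` Y -> ((1 - eps)%:E <= mu X)%E ->
    (mu (ball r `\` Y) <= eps%:E)%E.
  move=> mX mY Xr XY le_X.
  apply: (@le_trans _ _ (mu (ball r `\` X))).
    apply: le_measure; rewrite ?inE; try exact: measurableD.
    by move=> y [yr nY]; split=> // /XY.
  have fin_r : (mu (ball r) < +oo)%E by rewrite mu_r ltry.
  have -> : mu (ball r `\` X) = (mu (ball r) - mu X)%E.
    by have := measureD (mu := mu) (mb r) mX fin_r; rewrite (setIidr Xr).
  rewrite mu_r; have := measure_ge0 mu X; move: le_X.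
  change (((1 - eps)%:E <= mu X)%E -> (0 <= mu X)%E -> (1 - mu X <= eps%:E)%E).
  case: (mu X) => [x| |] //=; last by rewrite leNye.
  by rewrite -EFinB !lee_fin => *; lra.
have [inside|outside] := ltP ((1 + eta) * (a ^+ 2 * J%:R) + slack) (r ^+ 2).
  apply: (diff_le (half_open_cubes a D)) => //.
  - move=> y /half_open_cubesP[x xD yx]; apply/(euclidean_ballE _ r_gt0).
    have ycl : closed_cube a x y.
      have /closed_cubesP[x' _] : closed_cubes a [:: x] y.
        by apply: half_open_sub_closed; apply/half_open_cubesP; exists x;
          rewrite ?inE.
      move=> _ i; have := yx i; rewrite /= !in_itv /= => /andP[-> /ltW].
      by [].
    apply: le_lt_trans (sqnormR_cube_le a_gt0 eta_gt0 ycl) _.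
    apply: le_lt_trans inside; rewrite lerD2r ler_pM2l; last by lra.
    by rewrite ler_pM2l //; move: xD; rewrite inD -(ler_int R).
  - exact: half_open_sub_closed.
  rewrite lebesgue_half_open_cubes // lee_fin.
  apply: (@le_trans _ _ 1); first by rewrite gerBl.
  rewrite -[leLHS]na; apply: ler_wpM2r; last by rewrite ler_nat.
  by apply: exprn_ge0; apply: ltW.
apply: (diff_le (ball r')) => //; first by apply: euclidean_ball_sub; apply: ltW.
move=> y /(euclidean_ballE _ r'_gt0) lt_y.
have [x yx le_x] := nearest_site a_gt0 eta_gt0 y.
apply/closed_cubesP; exists x => //; rewrite inD -(ler_int R) -[J%:Z%:~R]/(J%:R).
rewrite -(ler_pM2l a2_gt0); apply: le_trans le_x _.
rewrite -/slack.
have e1 : 0 < 1 + eta by lra.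
rewrite -(ler_pM2l e1).
have : (1 + eta) * ((1 + eta) * sqnormR y) <= (1 + eta) * ((1 + eta) * r' ^+ 2).
  by rewrite !ler_pM2l // ltW.
rewrite exprMn expr2 in gap; lra.
Qed.

End Uncovered.

Lemma scale_small {R : realType} (d : nat) (a0 : R) : (0 < d)%N -> 0 < a0 ->
  exists N, forall n, (N < n)%N ->
  let a := n%:R `^ (- (d%:R^-1)) in
  [/\ 0 < a, n%:R * a ^+ d = 1 & a <= a0].
Proof.
move=> d_gt0 a0_gt0; have [N le_N] := exists_nat_ge (a0 ^+ d)^-1.
exists N => n lt_n a.
have n_gt0 : 0 < n%:R :> R by rewrite ltr0n; apply: leq_ltn_trans lt_n.
have a_gt0 : 0 < a by apply: powR_gt0.
have a_d : a ^+ d = n%:R^-1.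
  rewrite -powR_mulrn ?ltW // /a -powRrM mulNr mulVf ?pnatr_eq0 -?lt0n //.
  by rewrite powR_inv1 // ltW.
split=> //; first by rewrite a_d divff // gt_eqF.
rewrite -(@ler_pXn2r _ d) ?nnegrE ?(ltW a_gt0) ?(ltW a0_gt0) // a_d.
rewrite -[leRHS]invrK lef_pV2 ?posrE ?invr_gt0 ?exprn_gt0 //.
by apply: le_trans le_N _; rewrite ler_nat ltnW.
Qed.

Theorem theorem1p1 (R : realType) (d : nat) (d_ge1 : (1 <= d)%N)
    (c : {perm direction d}) (c_cyclic : cyclic_ordering c)
    (rho0 : rotor_config d)
    (r : R) (r_unit_volume : lebesgue_tuple d (euclidean_ball r) = 1%E) :
  (fun n : nat =>
     lebesgue_tuple d
       (dilate (n%:R `^ (- (d%:R^-1))) (cube_union (aggregate c rho0 n))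
        `+` euclidean_ball r)) @ \oo --> 0%E.
Proof.
set f := fun n : nat => _.
have small eps : 0 < eps -> \forall n \near \oo, (f n <= eps%:E)%E.
  move=> eps_gt0; pose e4 := eps / 4.
  have e4_gt0 : 0 < e4 by rewrite divr_gt0.
  have [r' [r'_gt0 lt_r' mu_r']] := inner_ball r_unit_volume e4_gt0.
  have r_gt0 : 0 < r := lt_trans r'_gt0 lt_r'.
  pose eta := (r - r') / (2 * r).
  have eta_gt0 : 0 < eta by rewrite divr_gt0 ?subr_gt0 // mulr_gt0.
  have gap : 0 < r ^+ 2 - ((1 + eta) * r') ^+ 2.
    rewrite subr_gt0 ltr_pXn2r ?nnegrE ?(ltW r_gt0) //; last first.
      by rewrite mulr_ge0 ?addr_ge0 // ltW.
    have : eta * r' <= (r - r') / 2.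
      have -> : (r - r') / 2 = eta * r by rewrite /eta; field; rewrite gt_eqF.
      by rewrite ler_pM2l // ltW.
    lra.
  set gp := _ - _ in gap.
  pose K := (2 + eta) * cube_slack d eta.
  have K_ge0 : 0 <= K.
    rewrite mulr_ge0 ?addr_ge0 ?(ltW eta_gt0) // mulr_ge0 //.
    by rewrite addr_ge0 // invr_ge0 ltW.
  have K1_gt0 : 0 < K + 1 by lra.
  have a0_gt0 : 0 < Num.min 1 (gp / (K + 1)) by rewrite lt_min ltr01 divr_gt0.
  have [N1 scale] := scale_small d_ge1 a0_gt0.
  have [N2 fill] := aggregate_fills_ball rho0 d_ge1 c_cyclic e4_gt0.
  exists (N1 + N2).+1 => // n /= le_n.
  have [a_gt0 na] := scale n (leq_ltn_trans (leq_addr _ _) le_n).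
  have [s [D [J [s_uniq size_s sE [D_uniq inD le_nD miss]]]]] :=
    fill n (ltnW (leq_ltn_trans (leq_addl _ _) le_n)).
  rewrite /f; move: (n%:R `^ _) a_gt0 na => a a_gt0 na.
  rewrite le_min => /andP[a_le1 a_le].
  rewrite (dilate_cube_union a_gt0 sE).
  have mb q := @measurable_euclidean_ball R d q.
  have mcs (s' : seq 'rV[int]_d) := measurable_closed_cubes a s'.
  have -> : eps = 2 * (e4 + e4) by rewrite /e4; field.
  apply: symdiff_le => //.
    by apply: le_trans (lebesgue_closed_cubes _ _) _; rewrite // size_s na.
  have gap_a : (2 + eta) * (a ^+ 2 * cube_slack d eta) <= gp.
    have -> : (2 + eta) * (a ^+ 2 * cube_slack d eta) = a ^+ 2 * K by rewrite /K; ring.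
    have a2 : a ^+ 2 <= a by rewrite expr2 ger_pMl.
    have : a * (K + 1) <= gp by rewrite -ler_pdivlMr.
    have := ler_wpM2r K_ge0 a2; lra.
  have cover := lattice_ball_covers a_gt0 eta_gt0 r'_gt0 lt_r' (ltW e4_gt0)
    r_unit_volume mu_r' D_uniq inD na le_nD gap_a.
  set miss_s := [seq x <- D | x \notin s] in miss.
  apply: (@le_trans _ _ (lebesgue_tuple d (closed_cubes a miss_s
      `|` (euclidean_ball r `\` closed_cubes a D)))).
    have mU := measurableU _ _ (mcs miss_s) (measurableD (mb r) (mcs D)).
    have mBs := measurableD (mb r) (mcs s).
    apply: le_measure; rewrite ?inE //.
    move=> y [yr ys]; have [/closed_cubesP[x xD yx]|yD] := pselect (closed_cubes a D y).
      left; apply/closed_cubesP; exists x => //; rewrite mem_filter xD andbT.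
      by apply/negP => xs; apply: ys; apply/closed_cubesP; exists x.
    by right.
  apply: le_trans (measureU2 _ _ _) _ => //; first exact: measurableD.
  rewrite EFinD; apply: leeD cover.
  apply: le_trans (lebesgue_closed_cubes a_gt0 _) _; rewrite lee_fin.
  have ad : 0 <= a ^+ d by rewrite exprn_ge0 // ltW.
  apply: le_trans (ler_wpM2r ad miss) _.
  by rewrite -mulrA na mulr1.
have f_ge0 n : (0 <= f n)%E by apply: measure_ge0.
have f_fin n eps : (f n <= eps%:E)%E -> f n \is a fin_num.
  by move=> le_f; rewrite ge0_fin_numE //; apply: le_lt_trans le_f (ltry _).
apply/fine_cvgP; split.
  by apply: filterS (small 1 ltr01) => n; apply: f_fin.
apply/cvgrPdist_le => eps eps_gt0; apply: filterS (small eps eps_gt0) => n le_f.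
rewrite sub0r normrN /= ger0_norm ?fine_ge0 //.
by rewrite -lee_fin fineK //; apply: f_fin le_f.
Qed.
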